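(* The operators $e_k$, $d_\pm$, $T_i$ on $V_*=\bigoplus_{k\ge0}V_k$ define a representation of the Dyck path algebra $\mathbb{A}=\mathbb{A}_q$ on $V_*$. Furthermore, there is an isomorphism of representations $$\varphi:\mathbb{A}e_0\xrightarrow{\ \sim\ }V_*$$ which sends $e_0$ to $1\in V_0$, and maps $e_k\mathbb{A}e_0$ isomorphically onto $V_k$ for every $k$.
   Context: **The algebra.** $\mathbb{A}=\mathbb{A}_q$, over $\mathbb{Q}(q,t)$, is the path algebra of the quiver with vertex set $\mathbb{Z}_{\ge0}$, arrows $d_+$ from $i$ to $i+1$, arrows $d_-$ from $i+1$ to $i$ ($i\in\mathbb{Z}_{\ge0}$), and loops $T_1,\dots,T_{k-1}$ at each vertex $k$, with vertex idempotents $e_k$, modulo the relations $$(T_i-1)(T_i+q)=0,\quad T_iT_{i+1}T_i=T_{i+1}T_iT_{i+1},\quad T_iT_j=T_jT_i\ (|i-j|>1),$$ $$T_id_-=d_-T_i\ (i<k-1),\quad d_+T_i=T_{i+1}d_+,\quad T_1d_+^2=d_+^2,\quad d_-^2T_{k-1}=d_-^2,$$ $$d_-(d_+d_--d_-d_+)T_{k-1}=q(d_+d_--d_-d_+)d_-\quad(k\ge2),$$ $$T_1(d_+d_--d_-d_+)d_+=q\,d_+(d_+d_--d_-d_+),$$ where in each identity $k$ is the index of the vertex where the paths begin, and each relation is imposed at all vertices $k$ at which it makes sense. Products are composed right to left like operators, so $e_k\mathbb{A}e_0$ is spanned by paths from $0$ to $k$. **The operators.** $\mathrm{Sym}[X]$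 is the ring of symmetric functions over $\mathbb{Q}(q,t)$ in $X=x_1+x_2+\cdots$. Plethysm: $F[A]$ is the image of $F$ under the $\mathbb{Q}(q,t)$-algebra homomorphism $p_n\mapsto p_n[A]$, with $p_n[A]$ obtained from $A$ by replacing every variable (including $q,t,x_i,y_i,z$) by its $n$-th power and fixing rational numbers. $\mathrm{Exp}[A]=\sum_{n\ge0}h_n[A]$. $(B_rF)[X]=F[X-(q-1)z^{-1}]\,\mathrm{Exp}[-zX]\big|_{z^r}$ (coefficient of $z^r$). $V_k=\mathrm{Sym}[X]\otimes\mathbb{Q}[y_1,\dots,y_k]$; for $F\in V_k$, $F[A]$ substitutes $X\mapsto A$ with the $y_i$ fixed. $e_k:V_*\to V_k$ is the projection. $T_iP=\dfrac{(q-1)y_iP+(y_{i+1}-qy_i)\,s_iP}{y_{i+1}-y_i}$ on $V_k$, $1\le i\le k-1$, where $s_i$ swaps $y_i,y_{i+1}$. $d_+:V_k\to V_{k+1}$, $d_+F=T_1\cdots T_k\big(F[X+(q-1)y_{k+1}]\big)$. $d_-:V_k\to V_{k-1}$ ($k\ge1$) is linear with $d_-(y_k^iF)=-B_{i+1}F$ for $F$ not depending on $y_k$. The generators $e_k,d_\pm,T_i$ of $\mathbb{A}$ act by the operators of the same name. *)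

(* Defs.v *)
From HB Require Import structures.
From mathcomp Require Import all_boot all_order perm all_algebra.
From mathcomp Require Import boolp ring.
From mathcomp.multinomials Require Import freeg mpoly.

Set Implicit Arguments.
Unset Strict Implicit.
Unset Printing Implicit Defensive.

Import GRing.Theory.
Local Open Scope ring_scope.

Section SymmetricFunctions.
Context (R : comNzRingType).

(* p(x_1, ..., x_n, 0). *)
Definition mrestr n (p : {mpoly R[n.+1]}) : {mpoly R[n]} := (muni p)`_0.

Lemma mcoeff_mrestr n (p : {mpoly R[n.+1]}) m :
  (mrestr p)@_m = p@_(mnmwiden m).
Proof.
rewrite /mrestr muniE coef_sum raddf_sum /=.
rewrite (eq_bigr (fun m' => p@_m' * (m' == mnmwiden m)%:R)) => [|m' _]; last first.
  rewrite !coefZ coefXn -scalerAl mcoeffZ; congr (_ * _).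
  rewrite mulr_natr mcoeffMn mcoeffX -mulrnA mulnb; congr (_ : bool)%:R.
  apply/andP/eqP => [[/eqP<- /eqP h]|->]; last first.
    rewrite mnmwiden_ordmax; split=> //; apply/eqP/mnmP => i.
    by rewrite mnmE mnmwiden_widen.
  apply/mnmP => i; case: (unliftP ord_max i) => [j ->|->]; last first.
    by rewrite mnmwiden_ordmax -h.
  have -> : fintype.lift ord_max j = widen_ord (leqnSn n) j.
    by apply/val_inj; rewrite /= /bump leqNgt ltn_ord.
  by rewrite mnmwiden_widen mnmE.
case: (boolP (mnmwiden m \in msupp p)) => [mp|mp]; last first.
  rewrite memN_msupp_eq0 // big_seq big1 // => m' m'p.
  by case: eqP mp => [<-|_]; rewrite ?m'p // mulr0.
rewrite (bigD1_seq (mnmwiden m)) //= eqxx mulr1 big1 ?addr0 // => m' /negPf->.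
by rewrite mulr0.
Qed.

Lemma mrestrD n : {morph @mrestr n : p q / p + q}.
Proof. by move=> p q; rewrite /mrestr raddfD coefD. Qed.

Lemma mrestrN n : {morph @mrestr n : p / - p}.
Proof. by move=> p; rewrite /mrestr raddfN coefN. Qed.

Lemma mrestrM n : {morph @mrestr n : p q / p * q}.
Proof. by move=> p q; rewrite /mrestr rmorphM /= coefM big_ord1 subnn. Qed.

Lemma mrestrC n c : mrestr (c%:MP : {mpoly R[n.+1]}) = c%:MP.
Proof. by rewrite /mrestr muniC coefC. Qed.

Lemma mrestr0 n : mrestr (0 : {mpoly R[n.+1]}) = 0.
Proof. by rewrite -mpolyC0 mrestrC mpolyC0. Qed.

Lemma mrestr_sum n I (r : seq I) (P : pred I) (F : I -> {mpoly R[n.+1]}) :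
  mrestr (\sum_(i <- r | P i) F i) = \sum_(i <- r | P i) mrestr (F i).
Proof. exact: (big_morph _ (@mrestrD n) (mrestr0 n)). Qed.

Lemma mrestrZ n c (p : {mpoly R[n.+1]}) : mrestr (c *: p) = c *: mrestr p.
Proof. by apply/mpolyP => m; rewrite mcoeff_mrestr !mcoeffZ mcoeff_mrestr. Qed.

(* The ring of symmetric functions in x_1, x_2, ... as the graded inverse
   limit of the rings of symmetric polynomials: F n is F(x_1, ..., x_n). *)
Definition is_symfun (f : forall n, {mpoly R[n]}) : Prop :=
  [/\ forall n, f n \is symmetric,
      forall n, mrestr (f n.+1) = f n
    & exists d, forall n, (msize (f n) <= d)%N].

Record symfun := SymFun {
  symfun_val :> forall n, {mpoly R[n]};
  _ : `[< is_symfun symfun_val >] }.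
HB.instance Definition _ := [isSub for symfun_val].
HB.instance Definition _ := [Choice of symfun by <:].

Lemma symfunP (F : symfun) : is_symfun F.
Proof. by apply/asboolP; case: F. Qed.

Lemma symfun_sym (F : symfun) n : F n \is symmetric.
Proof. by case: (symfunP F). Qed.

Lemma symfun_restr (F : symfun) n : mrestr (F n.+1) = F n.
Proof. by case: (symfunP F). Qed.

Lemma symfun_eq (F G : symfun) : (forall n, F n = G n) -> F = G.
Proof. by move=> FG; apply: val_inj; apply: functional_extensionality_dep. Qed.

Definition mksym f (fP : is_symfun f) : symfun := SymFun (asboolT fP).

Lemma symfunC_subproof c : is_symfun (fun n => c%:MP).
Proof.
split=> [n|n|]; [apply/issymP => s; by rewrite /msym mmapC | exact: mrestrC |].
by exists 1%N; move=> n; rewrite msizeC leq_b1.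
Qed.

Lemma symfunN_subproof (F : symfun) : is_symfun (fun n => - F n).
Proof.
have [sF rF [d dF]] := symfunP F.
split=> [n|n|]; [by rewrite rpredN sF | by rewrite mrestrN rF |].
by exists d; move=> n; rewrite msizeN.
Qed.

Lemma symfunD_subproof (F G : symfun) : is_symfun (fun n => F n + G n).
Proof.
have [sF rF [d dF]] := symfunP F; have [sG rG [e eG]] := symfunP G.
split=> [n|n|]; [by rewrite rpredD ?sF ?sG | by rewrite mrestrD rF rG |].
exists (maxn d e); move=> n; rewrite (leq_trans (msizeD_le _ _)) //.
by rewrite geq_max !leq_max dF eG orbT.
Qed.

Lemma symfunM_subproof (F G : symfun) : is_symfun (fun n => F n * G n).
Proof.
have [sF rF [d dF]] := symfunP F; have [sG rG [e eG]] := symfunP G.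
split=> [n|n|]; [by rewrite rpredM ?sF ?sG | by rewrite mrestrM rF rG |].
exists (d + e).+1%N; move=> n; rewrite (leq_trans (msizeM_le _ _)) //.
by rewrite ltnS leq_add.
Qed.

Lemma symfunZ_subproof c (F : symfun) : is_symfun (fun n => c *: F n).
Proof.
have [sF rF [d dF]] := symfunP F.
split=> [n|n|]; [by rewrite rpredZ ?sF | by rewrite mrestrZ rF |].
by exists d; move=> n; rewrite (leq_trans (msizeZ_le _ _)).
Qed.

Definition symfunC c := mksym (symfunC_subproof c).
Definition symfunN F := mksym (symfunN_subproof F).
Definition symfunD F G := mksym (symfunD_subproof F G).
Definition symfunM F G := mksym (symfunM_subproof F G).
Definition symfunZ c F := mksym (symfunZ_subproof c F).

Local Ltac pointwise := move=> *; apply: symfun_eq => n /=.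

Fact symfun_addA : associative symfunD. Proof. by pointwise; rewrite addrA. Qed.
Fact symfun_addC : commutative symfunD. Proof. by pointwise; rewrite addrC. Qed.
Fact symfun_add0 : left_id (symfunC 0) symfunD.
Proof. by pointwise; rewrite mpolyC0 add0r. Qed.
Fact symfun_addN : left_inverse (symfunC 0) symfunN symfunD.
Proof. by pointwise; rewrite mpolyC0 addNr. Qed.
HB.instance Definition _ := GRing.isZmodule.Build symfun
  symfun_addA symfun_addC symfun_add0 symfun_addN.

Fact symfun_mulA : associative symfunM. Proof. by pointwise; rewrite mulrA. Qed.
Fact symfun_mulC : commutative symfunM. Proof. by pointwise; rewrite mulrC. Qed.
Fact symfun_mul1 : left_id (symfunC 1) symfunM.
Proof. by pointwise; rewrite mpolyC1 mul1r. Qed.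
Fact symfun_mulDl : left_distributive symfunM symfunD.
Proof. by pointwise; rewrite mulrDl. Qed.
Fact symfun_1_neq0 : symfunC 1 != 0.
Proof.
apply/eqP => /(congr1 (fun F : symfun => (F 0%N)@_0)) /=.
by rewrite !mcoeffC eqxx !mulr1 => /eqP; rewrite oner_eq0.
Qed.
HB.instance Definition _ := GRing.Zmodule_isComNzRing.Build symfun
  symfun_mulA symfun_mulC symfun_mul1 symfun_mulDl symfun_1_neq0.

Fact symfun_scaleA a b F : symfunZ a (symfunZ b F) = symfunZ (a * b) F.
Proof. by pointwise; rewrite scalerA. Qed.
Fact symfun_scale1 : left_id 1 symfunZ. Proof. by pointwise; rewrite scale1r. Qed.
Fact symfun_scaleDr : right_distributive symfunZ +%R.
Proof. by pointwise; rewrite scalerDr. Qed.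
Fact symfun_scaleDl F : {morph symfunZ^~ F : a b / a + b}.
Proof. by pointwise; rewrite scalerDl. Qed.
HB.instance Definition _ := GRing.Zmodule_isLmodule.Build R symfun
  symfun_scaleA symfun_scale1 symfun_scaleDr symfun_scaleDl.

Fact symfun_scaleAl a (F G : symfun) : a *: (F * G) = a *: F * G.
Proof. by pointwise; rewrite scalerAl. Qed.
HB.instance Definition _ := GRing.Lmodule_isLalgebra.Build R symfun symfun_scaleAl.
HB.instance Definition _ := GRing.Lalgebra_isComAlgebra.Build R symfun.


Lemma mrestrX n (i : 'I_n) :
  mrestr ('X_(widen_ord (leqnSn n) i) : {mpoly R[n.+1]}) = 'X_i.
Proof.
apply/mpolyP => m; rewrite mcoeff_mrestr !mcoeffX -mnmwiden1.
by rewrite (inj_eq (@inj_mnmwiden n)).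
Qed.

Lemma mrestrX_max n : mrestr ('X_ord_max : {mpoly R[n.+1]}) = 0.
Proof.
apply/mpolyP => m; rewrite mcoeff_mrestr mcoeffX mcoeff0.
case: eqP => // /(congr1 (fun m : 'X_{1..n.+1} => m ord_max)).
by rewrite mnmwiden_ordmax mnm1E eqxx.
Qed.

Lemma mrestr1 n : mrestr (1 : {mpoly R[n.+1]}) = 1.
Proof. by rewrite -mpolyC1 mrestrC mpolyC1. Qed.

Lemma mrestrXn n (p : {mpoly R[n.+1]}) k : mrestr (p ^+ k) = mrestr p ^+ k.
Proof.
by elim: k => [|k IH]; rewrite ?expr0 ?mrestr1 // !exprS mrestrM IH.
Qed.

Lemma psum_subproof m :
  is_symfun (fun n => if m is 0 then 0 else \sum_(i < n) 'X_i ^+ m).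
Proof.
case: m => [|m].
  split=> [n|n|]; rewrite ?rpred0 ?mrestr0 //.
  by exists 0%N; move=> n; rewrite msize0.
split=> [n|n|].
- apply/issymP => s; rewrite raddf_sum /= [RHS](reindex_perm s) /=.
  by apply/eq_bigr => i _; rewrite rmorphXn /= /msym mmapX mmap1U.
- rewrite big_ord_recr /= mrestrD mrestr_sum mrestrXn mrestrX_max expr0n addr0.
  by apply/eq_bigr => i _; rewrite mrestrXn mrestrX.
- exists m.+2; move=> n; rewrite (leq_trans (msize_sum _ _ _)) //.
  apply/bigmax_leqP => i _.
  by rewrite mpolyXn msizeX mdegMn mdeg1 mul1n.
Qed.

(* The power sum p_m, for m >= 1; psum 0 = 0 is a dummy value. *)
Definition psum m : symfun := mksym (psum_subproof m).

Lemma hsym_subproof m :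
  is_symfun (fun n => \sum_(d : 'X_{1..n < m.+1} | mdeg d == m) 'X_[d]).
Proof.
have hE n e : (\sum_(d : 'X_{1..n < m.+1} | mdeg d == m) 'X_[R, d])@_e
    = (mdeg e == m)%:R.
  rewrite raddf_sum /=; case: eqP => [em|em]; last first.
    rewrite big1 // => d /eqP dm; rewrite mcoeffX.
    by case: eqP => // de; case: em; rewrite -de.
  have em' : (mdeg e < m.+1)%N by rewrite em.
  rewrite (bigD1 (BMultinom em')) /=; last by rewrite em.
  rewrite mcoeffX eqxx big1 ?addr0 // => d /andP[_ de].
  by rewrite mcoeffX; case: eqP => // E; case/eqP: de; apply: val_inj.
split=> [n|n|].
- apply/issymP => s; apply/mpolyP => e; rewrite mcoeff_sym !hE.
  congr (_ == _)%:R; rewrite !mdegE [RHS](reindex_perm s) /=.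
  by apply: eq_bigr => i _; rewrite mnmE.
- apply/mpolyP => e; rewrite mcoeff_mrestr !hE; congr (_ == _)%:R.
  rewrite !mdegE big_ord_recr /= mnmwiden_ordmax addn0.
  by apply: eq_bigr => i _; rewrite mnmwiden_widen.
- exists m.+1; move=> n; rewrite (leq_trans (msize_sum _ _ _)) //.
  by apply/bigmax_leqP => i /eqP im; rewrite msizeX im.
Qed.

Definition hsym m : symfun := mksym (hsym_subproof m).

Lemma esym_subproof m : is_symfun (fun n => mesym n R m).
Proof.
split=> [n|n|]; first exact: mesym_sym.
- case: m => [|m]; first by rewrite !mesym0E mrestr1.
  rewrite mesymSS mrestrD mrestrM mrestrX_max mulr0 addr0.
  by apply/mpolyP => e; rewrite mcoeff_mrestr mwiden_mnmwiden.
- exists m.+1; move=> n; have := dhomog_mesym n R m; set p := mesym _ _ _.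
  move=> /dhomogP ph; rewrite mmeasureE; apply/bigmax_leqP_seq => d dp _.
  by rewrite ltnS (ph _ dp).
Qed.

Definition esym m : symfun := mksym (esym_subproof m).

End SymmetricFunctions.

Section Newton.
Context (A : comNzRingType).
Implicit Types (e p : nat -> A).

(* Newton's identities, with p j standing for the power sum p_(j+1). *)
Definition newton e p : Prop := e 0%N = 1 /\ forall k,
  e k.+1 *+ k.+1 = \sum_(j < k.+1) (-1) ^+ j * e (k - j)%N * p j.

Lemma newton_addvar e p x : newton e p ->
  newton (fun k => e k + (if k is k'.+1 then x * e k' else 0))
         (fun j => p j + x ^+ j.+1).
Proof.
move=> [e0 ep]; split=> [|k]; first by rewrite addr0.
set e' := fun k => if k is k'.+1 then x * e k' else 0.
rewrite (_ : \sum_(j < k.+1) _ = \sum_(j < k.+1) (-1) ^+ j * e (k - j)%N * p j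
  + \sum_(j < k.+1) (-1) ^+ j * e' (k - j)%N * p j
  + \sum_(j < k.+1) (-1) ^+ j * (e (k - j)%N + e' (k - j)%N) * x ^+ j.+1);
  last by rewrite -!big_split /=; apply: eq_bigr => j _; rewrite -/(e' _); ring.
rewrite -ep.
have -> : \sum_(j < k.+1) (-1) ^+ j * e' (k - j)%N * p j = x * e k *+ k.
  rewrite big_ord_recr /= subnn mulr0 mul0r addr0.
  case: k => [|k]; first by rewrite big_ord0 mulr0n.
  rewrite -mulrnAr ep mulr_sumr; apply: eq_bigr => j _.
  by rewrite subSn /=; [ring | rewrite -ltnS].
have -> : \sum_(j < k.+1) (-1) ^+ j * (e (k - j)%N + e' (k - j)%N) * x ^+ j.+1
    = x * e k.
  have H n : (n <= k)%N ->
    \sum_(j < n.+1) (-1) ^+ j * (e (k - j)%N + e' (k - j)%N) * x ^+ j.+1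
    = x * e k + (-1) ^+ n * e' (k - n)%N * x ^+ n.+1.
    elim: n => [|n IH] nk; first by rewrite big_ord1 subn0 /=; ring.
    rewrite big_ord_recr /= IH ?(ltnW nk) // -(subnSK nk) /=.
    by rewrite !exprS; ring.
  by rewrite H // subnn /= mulr0 mul0r addr0.
by rewrite /= mulrnDl [(x * e k) *+ k.+1]mulrSr addrA.
Qed.

Lemma newton_inj_p e e' p p' N : newton e p -> newton e' p' ->
  (forall k, (k <= N)%N -> e k = e' k) -> forall j, (j < N)%N -> p j = p' j.
Proof.
move=> [e0 ep] [e'0 ep'] ee; elim/ltn_ind => j IH jN.
have := ep' j; rewrite -ee // ep !big_ord_recr /= subnn e0 e'0 !mulr1.
rewrite (eq_bigr (fun i : 'I_j => (-1) ^+ i * e' (j - i)%N * p' i)).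
  by move/addrI/(congr1 (fun x => (-1) ^+ j * x)); rewrite !signrMK.
move=> i _; rewrite IH ?(ltn_trans _ jN) // ee //.
by rewrite (leq_trans (leq_subr _ _)) // ltnW.
Qed.

Lemma strong_rec (F : nat -> (nat -> A) -> A) :
  (forall n s t, (forall i, (i < n)%N -> s i = t i) -> F n s = F n t) ->
  exists s, forall n, s n = F n s.
Proof.
move=> Fext.
pose L := fix L n := if n is n'.+1 then
  let l := L n' in rcons l (F n' (nth 0 l)) else [::].
have sL n : size (L n) = n by elim: n => //= n IH; rewrite size_rcons IH.
have LL m n : (n < m)%N -> nth 0 (L m) n = nth 0 (L n.+1) n.
  elim: m => // m IH; rewrite ltnS leq_eqVlt => /predU1P[->//|nm].
  by rewrite [LHS]/= nth_rcons sL nm IH.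
exists (fun n => nth 0 (L n.+1) n) => n.
rewrite [LHS]/= nth_rcons sL ltnn eqxx.
by apply: Fext => i ni; rewrite LL.
Qed.

Lemma newton_p e : e 0%N = 1 -> exists p, newton e p.
Proof.
move=> e0.
have [n s t st|p pE] := @strong_rec (fun k p => (-1) ^+ k *
  (e k.+1 *+ k.+1 - \sum_(j < k) (-1) ^+ j * e (k - j)%N * p j)).
  by congr (_ * (_ - _)); apply: eq_bigr => i _; rewrite st.
exists p; split=> // k; rewrite big_ord_recr /= subnn e0 mulr1 [p k]pE signrMK.
by rewrite addrC subrK.
Qed.

End Newton.

Lemma newton_rmorph (A B : comNzRingType) (f : {rmorphism A -> B}) e p :
  newton e p -> newton (f \o e) (f \o p).
Proof.
move=> [e0 ep]; split=> [|k] /=; first by rewrite e0 rmorph1.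
rewrite -rmorphMn ep rmorph_sum /=; apply: eq_bigr => j _.
by rewrite !rmorphM rmorph_sign.
Qed.

Lemma newton_mesym (R : comNzRingType) n :
  newton (mesym n R) (fun j => \sum_(i < n) 'X_i ^+ j.+1).
Proof.
elim: n => [|n /(newton_rmorph (mwiden (R:=R) (n:=n)))/(newton_addvar 'X_ord_max)[e0 ep]].
  split=> [|k]; first by rewrite mesym0E.
  by rewrite mesym_geqnE // mul0rn big1 // => j _; rewrite big_ord0 mulr0.
have E k : mesym n.+1 R k = (mwiden (R:=R) (n:=n) \o mesym n R) k
   + (if k is k'.+1 then 'X_ord_max * (mwiden (R:=R) (n:=n) \o mesym n R) k' else 0).
  case: k => [|k] /=; last by rewrite mesymSS mulrC.
  by rewrite !mesym0E rmorph1 addr0.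
split=> [|k]; first by rewrite mesym0E.
rewrite E ep; apply: eq_bigr => j _; rewrite -E; congr (_ * _).
rewrite big_ord_recr /= raddf_sum /=; congr (_ + _); apply: eq_bigr => i _.
by rewrite rmorphXn /= mwidenX mnmwiden1.
Qed.

Section NewtonAlg.
Context (K : fieldType) (charK : [pchar K] =i pred0) (A : comAlgType K).
Implicit Types (e p : nat -> A).

Let natK n : n.+1%:R != 0 :> K.
Proof. by rewrite ((pcharf0P K).1 charK). Qed.

Let muln_inj n (x y : A) : x *+ n.+1 = y *+ n.+1 -> x = y.
Proof.
rewrite -!scaler_nat => /(congr1 (fun z => n.+1%:R^-1 *: z)).
by rewrite !scalerA mulVf ?scale1r.
Qed.

Lemma newton_inj_e e e' p p' N : newton e p -> newton e' p' ->
  (forall j, (j < N)%N -> p j = p' j) -> forall k, (k <= N)%N -> e k = e' k.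
Proof.
move=> [e0 ep] [e'0 ep'] pp; elim/ltn_ind => -[|k] IH kN; first by rewrite e0.
apply: (@muln_inj k); rewrite ep ep'; apply: eq_bigr => j _.
have jk : (j <= k)%N by rewrite -ltnS.
rewrite IH ?ltnS ?leq_subr ?(leq_trans (leq_subr _ _)) // ?(ltnW kN) //.
by rewrite pp // (leq_ltn_trans jk).
Qed.

Lemma newton_e p : exists e, newton e p.
Proof.
have [n s t st|e eE] := @strong_rec A (fun n e => if n is k.+1 then
  k.+1%:R^-1 *: \sum_(j < k.+1) (-1) ^+ j * e (k - j)%N * p j else 1).
  case: n st => // n st; congr (_ *: _); apply: eq_bigr => j _.
  by rewrite st // ltnS leq_subr.
exists e; split=> [|k]; first by rewrite eE.
rewrite [e k.+1]eE -scaler_nat scalerA divff ?scale1r //.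
Qed.
End NewtonAlg.

Lemma rmorph_mmap (K A B : comNzRingType) n (f : {rmorphism A -> B})
    (g : {rmorphism K -> A}) (h : 'I_n -> A) (P : {mpoly K[n]}) :
  f (mmap g h P) = mmap (f \o g) (f \o h) P.
Proof.
rewrite /mmap rmorph_sum /=; apply: eq_bigr => m _.
by rewrite rmorphM rmorph_prod /=; congr (_ * _); apply: eq_bigr => i _; rewrite rmorphXn.
Qed.

Lemma eq_mmap (K A : comNzRingType) n (g g' : K -> A) (h h' : 'I_n -> A)
    (P : {mpoly K[n]}) : g =1 g' -> h =1 h' -> mmap g h P = mmap g' h' P.
Proof.
move=> gg hh; rewrite /mmap; apply: eq_bigr => m _; rewrite gg; congr (_ * _).
by apply: eq_bigr => i _; rewrite hh.
Qed.

(* The power sums generate the symmetric functions (symfun_psum) freely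
   (psum_free). *)
Section SymfunGenerators.
Context (K : fieldType) (charK : [pchar K] =i pred0).
Local Notation sym := (symfun K).

Definition coord n (F : sym) : {mpoly K[n]} := F n.

Fact coord_zmod n : zmod_morphism (coord n). Proof. by []. Qed.
HB.instance Definition _ n :=
  GRing.isZmodMorphism.Build sym {mpoly K[n]} (coord n) (coord_zmod n).
Fact coord_monoid n : monoid_morphism (coord n).
Proof. by split=> //; rewrite /coord /= mpolyC1. Qed.
HB.instance Definition _ n :=
  GRing.isMonoidMorphism.Build sym {mpoly K[n]} (coord n) (coord_monoid n).

Lemma coord_in_alg n c : coord n (c%:A) = c%:MP.
Proof. by rewrite /coord /= mpolyC1 alg_mpolyC. Qed.

Local Notation ev g P := (mmap (in_alg sym) (fun i => g (nat_of_ord i).+1) P).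

Lemma coord_ev N (g : nat -> sym) (P : {mpoly K[N]}) n :
  (ev g P : sym) n = P \mPo [tuple (g i.+1 : sym) n | i < N].
Proof.
rewrite -[LHS]/(coord n _) (rmorph_mmap (coord n)).
apply: eq_mmap => [c|i] /=; first exact: coord_in_alg.
by rewrite tnth_map tnth_ord_tuple.
Qed.

Lemma symfun_eq0 d (G : sym) :
  (forall n, (msize (G n) <= d)%N) -> G d = 0 -> G = 0.
Proof.
move=> dG G0; apply: symfun_eq => n.
suff : G n = 0 by move=> ->; rewrite /= mpolyC0.
have up k : G (d + k)%N = 0.
  elim: k => [|k IH]; first by rewrite addn0.
  rewrite addnS; apply/mpolyP => m; rewrite mcoeff0.
  apply/eqP; apply: contraT; rewrite -mcoeff_msupp => mG; exfalso.
  have [i /eqP mi0|m0] := pickP (fun i => m i == 0%N).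
    have /issymP/(_ (tperm i ord_max)) sG := symfun_sym G (d + k).+1.
    move: mG; rewrite mcoeff_msupp -sG mcoeff_sym.
    set m' := [multinom _ | _ < _].
    have -> : m' = mnmwiden [multinom m' (widen_ord (leqnSn _) j) | j < _].
      apply/mnmP => j; case: (unliftP ord_max j) => [l ->|->]; last first.
        by rewrite mnmwiden_ordmax mnmE tpermR.
      have -> : fintype.lift ord_max l = widen_ord (leqnSn _) l.
        by apply/val_inj; rewrite /= /bump leqNgt ltn_ord.
      by rewrite mnmwiden_widen [RHS]mnmE.
    by rewrite -mcoeff_mrestr symfun_restr IH mcoeff0 eqxx.
  have /leq_trans/(_ (dG _)) := msize_mdeg_lt mG.
  rewrite ltnNge => /negP; apply.
  have : (\sum_(i < (d + k).+1) 1 <= mdeg m)%N.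
    by rewrite mdegE; apply: leq_sum => i _; rewrite lt0n m0.
  by rewrite sum1_card card_ord; apply: leq_trans; rewrite -addnS leq_addr.
have [dn|/ltnW nd] := leqP d n; first by rewrite -(subnKC dn) up.
have down j l : G (j + l)%N = 0 -> G l = 0.
  by elim: j => // j IH H; apply: IH; rewrite -symfun_restr H mrestr0.
by apply: (down (d - n)%N); rewrite subnK.
Qed.

Lemma dhomog_ev_mesym n N (m : 'X_{1..N}) :
  (\prod_(i < N) mesym n K i.+1 ^+ m i) \is (mnmwgt m).-homog.
Proof.
rewrite /mnmwgt; elim/big_rec2: _ => [|i d p _ pd]; first exact: dhomog1.
by apply: dhomogM => //; rewrite mulnC; apply/dhomogMn/dhomog_mesym.
Qed.

Lemma symfun_esym (F : sym) : exists N (P : {mpoly K[N]}), F = ev (esym K) P.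
Proof.
have [_ _ [d dF]] := symfunP F.
have [P [PF wP]] := sym_fundamental (symfun_sym F d).
exists d, P; apply/eqP; rewrite -subr_eq0; apply/eqP.
apply: (@symfun_eq0 d) => [n|]; last first.
  rewrite -[LHS]/(F d - (ev (esym K) P : sym) d) coord_ev.
  by rewrite [X in _ - X]PF subrr.
rewrite -[X in msize X]/(F n - (ev (esym K) P : sym) n) coord_ev.
rewrite (leq_trans (msizeD_le _ _)) // geq_max dF msizeN /=.
rewrite comp_mpolyE (leq_trans (msize_sum _ _ _)) //.
apply/bigmax_leqP_seq => m mP _; rewrite (leq_trans (msizeZ_le _ _)) //.
have mw : (mnmwgt m < d)%N.
  exact: leq_trans (mmeasure_mnm_lt mnmwgt mP) (leq_trans wP (dF d)).
have := dhomog_ev_mesym n m.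
set Q := \prod_(i < d) _; set Q' := \prod_(i < d) _ => hQ.
have -> : Q' = Q by apply: eq_bigr => i _; rewrite tnth_map tnth_ord_tuple.
rewrite mmeasureE; apply/bigmax_leqP_seq => m' m'Q _.
by rewrite (dhomog_mf hQ m'Q).
Qed.

Lemma newton_sym : newton (esym K) (fun j => psum K j.+1).
Proof.
split=> [|k]; apply: symfun_eq => n.
  by rewrite /= mesym0E mpolyC1.
rewrite -[LHS]/(coord n _) -[RHS]/(coord n _) rmorphMn rmorph_sum.
have [_ /(_ k) E] := newton_mesym K n.
rewrite [LHS]E; apply: eq_bigr => j _.
rewrite (rmorphM (coord n)) (rmorphM (coord n)) (rmorph_sign (coord n)).
by [].
Qed.

Let xs N j : {mpoly K[N]} := if insub j is Some i then 'X_i else 0.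

Let xsE N (i : 'I_N) : xs N i = 'X_i.
Proof. by rewrite /xs valK. Qed.

Let ev_xs N (g : nat -> sym) j : (j < N)%N -> ev g (xs N j) = g j.+1.
Proof. by move=> jN; rewrite /xs insubT /= mmapX mmap1U. Qed.

Lemma symfun_psum (F : sym) : exists N (P : {mpoly K[N]}), F = ev (psum K) P.
Proof.
have [N [P ->]] := symfun_esym F.
have [e eN] := newton_e charK (xs N).
exists N, (P \mPo [tuple e i.+1 | i < N]).
pose phi : {rmorphism {mpoly K[N]} -> sym} :=
  mmap (in_alg sym) (fun i => psum K (nat_of_ord i).+1).
have E := newton_inj_e charK (newton_rmorph phi eN) newton_sym
  (fun j jN => ev_xs (psum K) jN).
rewrite -[RHS]/(phi _) /comp_mpoly rmorph_mmap; apply: eq_mmap => [c|i] /=.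
  by rewrite mmapC.
by rewrite tnth_map tnth_ord_tuple -[RHS]/(phi _) -(E i.+1).
Qed.

Lemma psum_free N (P : {mpoly K[N]}) : ev (psum K) P = 0 -> P = 0.
Proof.
move=> P0.
have [e eN] := newton_e charK (xs N).
pose es k : {mpoly K[N]} := if k is k'.+1 then xs N k' else 1.
have [p pN] := newton_p (erefl : es 0%N = 1).
pose psi : {rmorphism {mpoly K[N]} -> sym} :=
  mmap (in_alg sym) (fun i => esym K (nat_of_ord i).+1).
pose tht : {rmorphism {mpoly K[N]} -> {mpoly K[N]}} :=
  mmap (@mpolyC N K) (fun i => e (nat_of_ord i).+1).
have psiE k : (k <= N)%N -> psi (es k) = esym K k.
  case: k => [_|k kN]; last exact: (ev_xs (esym K)).
  by rewrite rmorph1; case: newton_sym => ->.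
have psip := newton_inj_p (newton_rmorph psi pN) newton_sym psiE.
have thtE k : (k <= N)%N -> tht (es k) = e k.
  case: k => [_|k kN]; first by rewrite rmorph1; case: eN => ->.
  by rewrite /es /xs insubT /= mmapX mmap1U.
have thtp := newton_inj_p (newton_rmorph tht pN) eN thtE.
pose Q := P \mPo [tuple p i | i < N].
have Q0 : Q = 0.
  have : psi Q = 0.
    rewrite -P0 /Q /comp_mpoly rmorph_mmap; apply: eq_mmap => [c|i] /=.
      by rewrite mmapC.
    by rewrite tnth_map tnth_ord_tuple -(psip i).
  move=> /(congr1 (coord N)); rewrite rmorph0.
  rewrite -[LHS]/((psi Q : sym) N) coord_ev => /msym_fundamental_un0; exact.
have : tht Q = 0 by rewrite Q0 rmorph0.
rewrite /Q /comp_mpoly rmorph_mmap.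
rewrite (_ : mmap _ _ P = P) // -[RHS]comp_mpoly_id /comp_mpoly.
apply: eq_mmap => [c|i] /=; first by rewrite mmapC.
by rewrite !tnth_map !tnth_ord_tuple -[LHS]/((tht \o p) i) thtp ?xsE.
Qed.

End SymfunGenerators.

Definition Qqt : fieldType := {fraction {mpoly rat[2]}}.
Definition q : Qqt := tofrac 'X_0.
Definition t : Qqt := tofrac 'X_1.

Lemma Qqt_char0 : [pchar Qqt] =i pred0.
Proof.
apply/pcharf0P => n.
rewrite -(rmorph_nat (@tofrac {mpoly rat[2]})) tofrac_eq0.
rewrite -(rmorph_nat (@mpolyC 2 rat)) mpolyC_eq0.
by rewrite Num.Theory.pnatr_eq0.
Qed.

Definition Sym : comAlgType Qqt := symfun Qqt.
Definition p_ (m : nat) : Sym := psum Qqt m.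
Definition h_ (m : nat) : Sym := hsym Qqt m.


Section Widen.
Context (K : comNzRingType) (m n : nat) (le_mn : (m <= n)%N).

Definition mwiden_ord : {mpoly K[m]} -> {mpoly K[n]} :=
  mmap (@mpolyC _ _) (fun i => 'X_(widen_ord le_mn i)).
HB.instance Definition _ := GRing.RMorphism.on mwiden_ord.

Lemma mmap_widen_ord (C : comNzRingType) (f : {rmorphism K -> C}) (b : nat -> C)
    (P : {mpoly K[m]}) :
  mmap f (fun i => b (nat_of_ord i)) (mwiden_ord P)
  = mmap f (fun i => b (nat_of_ord i)) P.
Proof.
rewrite rmorph_mmap; apply: eq_mmap => [c|i] /=; first by rewrite mmapC.
by rewrite mmapX mmap1U.
Qed.

End Widen.

Section PsumPoly.

Lemma psum_poly_ex2 (F G : Sym) : exists N (P Q : {mpoly Qqt[N]}),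
  F = mmap (in_alg Sym) (fun i => p_ (nat_of_ord i).+1) P /\
  G = mmap (in_alg Sym) (fun i => p_ (nat_of_ord i).+1) Q.
Proof.
have [M [P ->]] := symfun_psum Qqt_char0 F.
have [N [Q ->]] := symfun_psum Qqt_char0 G.
exists (maxn M N), (mwiden_ord (leq_maxl M N) P), (mwiden_ord (leq_maxr M N) Q).
by split; rewrite (mmap_widen_ord _ (in_alg Sym) (fun i => p_ i.+1)).
Qed.

Lemma psum_poly_ex (F : Sym) : exists NP : {N & {mpoly Qqt[N]}},
  F = mmap (in_alg Sym) (fun i => p_ (nat_of_ord i).+1) (projT2 NP).
Proof.
by have [N [P ->]] := symfun_psum Qqt_char0 F; exists (existT _ N P).
Qed.

(* F written as a polynomial in p_1, p_2, ..., which generate Sym freely. *)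
Definition psum_poly F := sval (cid (psum_poly_ex F)).

End PsumPoly.

Section Plethysm.
Context (B : comNzRingType) (iota : {rmorphism Qqt -> B}) (a : nat -> B).

(* The homomorphism of Q(q,t)-algebras Sym -> B (B being an algebra through
   iota) that maps p_m to a m for all m >= 1, see plethE, pleth_p and
   pleth_scalar. Hence F |-> F[A] when a m is p_m[A]. *)
Definition pleth (F : Sym) : B :=
  mmap iota (fun i => a (nat_of_ord i).+1) (projT2 (psum_poly F)).

Lemma plethE N (P : {mpoly Qqt[N]}) :
  pleth (mmap (in_alg Sym) (fun i => p_ (nat_of_ord i).+1) P)
  = mmap iota (fun i => a (nat_of_ord i).+1) P.
Proof.
rewrite /pleth /psum_poly; case: cid => -[M Q] /= E.
rewrite -(mmap_widen_ord (leq_maxl M N) iota (fun i => a i.+1)).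
rewrite -[RHS](mmap_widen_ord (leq_maxr M N) iota (fun i => a i.+1)).
suff -> : mwiden_ord (leq_maxl M N) Q = mwiden_ord (leq_maxr M N) P by [].
apply/eqP; rewrite -subr_eq0; apply/eqP/(psum_free Qqt_char0).
rewrite (rmorphB (mmap _ _)) /=.
rewrite (mmap_widen_ord _ (in_alg Sym) (fun i => p_ i.+1)).
rewrite (mmap_widen_ord _ (in_alg Sym) (fun i => p_ i.+1)).
by rewrite E subrr.
Qed.

Fact pleth_zmod : zmod_morphism pleth.
Proof.
move=> F G; have [N [P [Q [-> ->]]]] := psum_poly_ex2 F G.
by rewrite !plethE -!rmorphB plethE.
Qed.
HB.instance Definition _ := GRing.isZmodMorphism.Build Sym B pleth pleth_zmod.

Lemma pleth_scalar c : pleth (c%:A) = iota c.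
Proof.
have -> : c%:A = mmap (in_alg Sym) (fun i => p_ (nat_of_ord i).+1) c%:MP_[0].
  by rewrite mmapC.
by rewrite plethE mmapC.
Qed.

Fact pleth_monoid : monoid_morphism pleth.
Proof.
split=> [|F G]; first by rewrite -[1 in LHS]scale1r pleth_scalar rmorph1.
have [N [P [Q [-> ->]]]] := psum_poly_ex2 F G.
by rewrite !plethE -!rmorphM plethE.
Qed.
HB.instance Definition _ :=
  GRing.isMonoidMorphism.Build Sym B pleth pleth_monoid.

Lemma pleth_p m : pleth (p_ m.+1) = a m.+1.
Proof.
have -> : p_ m.+1 = mmap (in_alg Sym) (fun i => p_ (nat_of_ord i).+1)
    ('X_ord_max : {mpoly Qqt[m.+1]}).
  by rewrite mmapX mmap1U.
by rewrite plethE mmapX mmap1U.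
Qed.

End Plethysm.

Lemma hecke_identity (K : comNzRingType) (A : comAlgType K) (c : K)
    (yi yj P s : A) :
  (yj - yi) * s + (c - 1) *: (yi * (P - s))
  = (c - 1) *: (yi * P) + (yj - c *: yi) * s.
Proof. by rewrite !scalerBl !scale1r mulrBr scalerBr !mulrBl -scalerAl; ring. Qed.

(* V_k: polynomials in y_1, ..., y_k over Sym; y_i is 'X_(i-1). This alias of
   {mpoly Sym[k]} is an algebra over Q(q,t) instead of over Sym. *)
Definition V (k : nat) : Type := {mpoly Sym[k]}.

Section V.
Context (k : nat).
HB.instance Definition _ := GRing.ComNzRing.on (V k).

Definition V_scale (c : Qqt) (F : V k) : V k :=
  (c%:A : Sym) *: (F : {mpoly Sym[k]}).

Fact V_scaleA a b F : V_scale a (V_scale b F) = V_scale (a * b) F.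
Proof. by rewrite /V_scale scalerA -scalerAl mul1r scalerA. Qed.
Fact V_scale1 : left_id 1 V_scale.
Proof. by move=> F; rewrite /V_scale !scale1r. Qed.
Fact V_scaleDr : right_distributive V_scale +%R.
Proof. by move=> a F G; rewrite /V_scale scalerDr. Qed.
Fact V_scaleDl F : {morph V_scale^~ F : a b / a + b}.
Proof. by move=> a b; rewrite /V_scale !scalerDl. Qed.
HB.instance Definition _ := GRing.Zmodule_isLmodule.Build Qqt (V k)
  V_scaleA V_scale1 V_scaleDr V_scaleDl.
Fact V_scaleAl a (F G : V k) : a *: (F * G) = a *: F * G.
Proof. exact: (@scalerAl Sym {mpoly Sym[k]}). Qed.
HB.instance Definition _ := GRing.Lmodule_isLalgebra.Build Qqt (V k) V_scaleAl.
HB.instance Definition _ := GRing.Lalgebra_isComAlgebra.Build Qqt (V k).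

Definition y_ (i : 'I_k) : V k := 'X_i.
Definition SymV (F : Sym) : V k := F%:MP.

Definition swap (i j : 'I_k) (P : V k) : V k := msym (tperm i j) P.

Lemma swap_div i j (P : V k) : exists Q : V k, P - swap i j P = (y_ j - y_ i) * Q.
Proof.
pose D (P : V k) := exists Q : V k, P - swap i j P = (y_ j - y_ i) * Q.
have Dadd P1 P2 : D P1 -> D P2 -> D (P1 + P2).
  move=> [Q1 E1] [Q2 E2]; exists (Q1 + Q2); rewrite mulrDr -E1 -E2.
  by rewrite /swap raddfD opprD addrACA.
have Dmul P1 P2 : D P1 -> D P2 -> D (P1 * P2).
  move=> [Q1 E1] [Q2 E2]; exists (Q1 * P2 + swap i j P1 * Q2).
  rewrite mulrDr mulrA -E1 mulrCA -E2 /swap rmorphM /=.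
  by rewrite mulrBl mulrBr addrA subrK.
have DC c : D (SymV c).
  by exists 0; rewrite mulr0 /swap /msym mmapC subrr.
have D1 : D 1 by have := DC 1; rewrite /SymV mpolyC1.
have DX l : D (y_ l).
  rewrite /D /swap /y_ /msym mmapX mmap1U.
  case: tpermP => [->|->|_ _].
  - by exists (-1); rewrite mulrN1 opprB.
  - by exists 1; rewrite mulr1.
  - by exists 0; rewrite mulr0 subrr.
have Dexp P1 n : D P1 -> D (P1 ^+ n).
  move=> DP1; elim: n => [|n IH]; first by rewrite expr0; exact: D1.
  rewrite exprS; exact: (Dmul _ _ DP1 IH).
elim/mpolyind: P => [|c m P _ _ IH]; first by apply: (DC 0).
apply: Dadd; last exact: IH.
rewrite -mul_mpolyC; apply: (Dmul); first exact: DC.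
rewrite mpolyXE_id; apply: (big_ind D D1 Dmul) => l _.
exact/Dexp/DX.
Qed.

(* Multiplication by y_j - y_i is injective, so that division by it, when
   possible, is unambiguous. *)
Lemma y_sub_reg i j (Q Q' : V k) : i != j ->
  (y_ j - y_ i) * Q = (y_ j - y_ i) * Q' -> Q = Q'.
Proof.
move=> ij /eqP; rewrite -subr_eq0 -mulrBr => /eqP H.
apply/eqP; rewrite -subr_eq0; apply/eqP; move: (Q - Q') H => {Q Q'} P.
rewrite mulrBl => /subr0_eq E.
have {}E e : ((P : {mpoly Sym[k]}) * 'X_j)@_e = ((P : {mpoly Sym[k]}) * 'X_i)@_e.
  have := congr1 (fun F : V k => (F : {mpoly Sym[k]})@_e) E.
  by rewrite (mulrC (y_ j)) (mulrC (y_ i)).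
suff H n : forall m : 'X_{1..k}, m i = n -> (P : {mpoly Sym[k]})@_m = 0.
  by apply/mpolyP => m; rewrite (H _ m erefl) mcoeff0.
elim: n => [|n IH] m mi.
  have := E (U_(j) + m)%MM; rewrite mcoeffMX => ->.
  rewrite [P in LHS]mpolyE mulr_suml raddf_sum /= big1 // => m' _.
  rewrite -scalerAl mcoeffZ -mpolyXD mcoeffX.
  case: eqP => [/(congr1 (fun m : 'X_{1..k} => m i))|_]; last by rewrite mulr0.
  by rewrite !mnmDE !mnm1E mi eqxx [j == i]eq_sym (negPf ij) addn1.
pose m' := (U_(j) + (m - U_(i)))%MM.
have mE : (U_(j) + m = U_(i) + m')%MM.
  apply/mnmP => l; rewrite !(mnmDE, mnmBE, mnm1E).
  by case: (eqVneq i l) => [<-|_] /=; rewrite ?mi; case: (j == _) => /=;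
    rewrite ?(subn0, subn1, add0n, add1n).
have := E (U_(j) + m)%MM; rewrite mcoeffMX => ->.
rewrite mE mcoeffMX IH // /m' mnmDE mnmBE !mnm1E eqxx mi [j == i]eq_sym.
by rewrite (negPf ij) add0n subn1.
Qed.

Definition hecke_num (i j : 'I_k) (P : V k) : V k :=
  (q - 1) *: (y_ i * P) + (y_ j - q *: y_ i) * swap i j P.

Lemma hecke_div i j P : exists Q, (y_ j - y_ i) * Q = hecke_num i j P.
Proof.
have [Q E] := swap_div i j P.
exists (swap i j P + (q - 1) *: (y_ i * Q)).
rewrite mulrDr -scalerAr mulrCA -E /hecke_num.
exact: hecke_identity.
Qed.

End V.

(* ((q-1) y_i P + (y_j - q y_i) s_ij P) / (y_j - y_i), for i != j *)
Definition hecke k (i j : 'I_k) (P : V k) : V k := sval (cid (hecke_div i j P)).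

(* T_i on V_k, indexed as on paper (y_i is the variable of index i.-1); only
   meaningful for 0 < i < k. *)
Definition T_ k (i : nat) (P : V k) : V k :=
  if insub i.-1 is Some a then if insub i is Some b then hecke a b P else 0
  else 0.

(* p_m[X + (q-1) y_(k+1)] *)
Definition alphabet_plus k (m : nat) : V k.+1 :=
  SymV k.+1 (p_ m) + (q ^+ m - 1) *: y_ ord_max ^+ m.

Definition dplus k (F : V k) : V k.+1 :=
  foldr (@T_ k.+1)
    (mmap (pleth (in_alg (V k.+1)) (@alphabet_plus k))
          (fun i : 'I_k => y_ (widen_ord (leqnSn k) i)) F)
    (iota 1 k).

(* p_m[X - (q-1) z^-1], as a polynomial in z^-1 *)
Definition alphabet_B k (m : nat) : {poly V k} :=
  (SymV k (p_ m))%:P - (q ^+ m - 1)%:A%:P * 'X^m.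

(* F[X - (q-1) z^-1], as a polynomial in z^-1 *)
Definition substB k (F : V k) : {poly V k} :=
  mmap (pleth (polyC \o in_alg (V k)) (@alphabet_B k)) (fun i => (y_ i)%:P) F.

(* h_n[-zX], as a polynomial in z *)
Definition h_minus_zX (n : nat) : {poly Sym} :=
  pleth (polyC \o in_alg Sym) (fun m => - ((p_ m)%:P * 'X^m)) (h_ n).

(* The coefficient of z^r in Exp[-zX] = sum_n h_n[-zX]; h_n[-zX] is a multiple
   of z^n, so that the terms with n > r do not contribute. *)
Definition Exp_minus_zX (r : nat) : Sym := \sum_(n < r.+1) (h_minus_zX n)`_r.

(* B_r, for r >= 0: the coefficient of z^r in F[X - (q-1) z^-1] Exp[-zX]. *)
Definition B_ k (r : nat) (F : V k) : V k :=
  \sum_(j < size (substB F)) (substB F)`_j * SymV k (Exp_minus_zX (r + j)).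

(* (muni F)`_i is the coefficient of y_(k+1)^i in F. *)
Definition dminus k (F : V k.+1) : V k :=
  - \sum_(i < size (muni F)) B_ i.+1 ((muni F)`_i : V k).

Section DirectSum.
Context (R : nzRingType) (M : nat -> lmodType R).

Definition finitely_supported (f : forall k, M k) : Prop :=
  exists N, forall k, (N <= k)%N -> f k = 0.

Record dsum := DSum {
  dsum_val :> forall k, M k;
  _ : `[< finitely_supported dsum_val >] }.
HB.instance Definition _ := [isSub for dsum_val].
HB.instance Definition _ := [Choice of dsum by <:].

Lemma dsumP (f : dsum) : finitely_supported f.
Proof. by apply/asboolP; case: f. Qed.

Lemma dsum_eq (f g : dsum) : (forall k, f k = g k) -> f = g.
Proof. by move=> fg; apply: val_inj; apply: functional_extensionality_dep. Qed.

Definition mkdsum f (fP : finitely_supported f) : dsum := DSum (asboolT fP).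

Lemma dsum0_subproof : finitely_supported (fun k => 0 : M k).
Proof. by exists 0%N. Qed.

Lemma dsumN_subproof (f : dsum) : finitely_supported (fun k => - f k).
Proof.
by have [N fN] := dsumP f; exists N; move=> k Nk; rewrite fN ?oppr0.
Qed.

Lemma dsumD_subproof (f g : dsum) : finitely_supported (fun k => f k + g k).
Proof.
have [N fN] := dsumP f; have [N' gN] := dsumP g.
exists (maxn N N'); move=> k; rewrite geq_max => /andP[Nk N'k].
by rewrite fN // gN // addr0.
Qed.

Lemma dsumZ_subproof c (f : dsum) : finitely_supported (fun k => c *: f k).
Proof.
by have [N fN] := dsumP f; exists N; move=> k Nk; rewrite fN ?scaler0.
Qed.

Definition dsum0 := mkdsum dsum0_subproof.
Definition dsumN f := mkdsum (dsumN_subproof f).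
Definition dsumD f g := mkdsum (dsumD_subproof f g).
Definition dsumZ c f := mkdsum (dsumZ_subproof c f).

Local Ltac pointwise := move=> *; apply: dsum_eq => k /=.

Fact dsum_addA : associative dsumD. Proof. by pointwise; rewrite addrA. Qed.
Fact dsum_addC : commutative dsumD. Proof. by pointwise; rewrite addrC. Qed.
Fact dsum_add0 : left_id dsum0 dsumD. Proof. by pointwise; rewrite add0r. Qed.
Fact dsum_addN : left_inverse dsum0 dsumN dsumD.
Proof. by pointwise; rewrite addNr. Qed.
HB.instance Definition _ := GRing.isZmodule.Build dsum
  dsum_addA dsum_addC dsum_add0 dsum_addN.

Fact dsum_scaleA a b f : dsumZ a (dsumZ b f) = dsumZ (a * b) f.
Proof. by pointwise; rewrite scalerA. Qed.
Fact dsum_scale1 : left_id 1 dsumZ. Proof. by pointwise; rewrite scale1r. Qed.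
Fact dsum_scaleDr : right_distributive dsumZ +%R.
Proof. by pointwise; rewrite scalerDr. Qed.
Fact dsum_scaleDl f : {morph dsumZ^~ f : a b / a + b}.
Proof. by pointwise; rewrite scalerDl. Qed.
HB.instance Definition _ := GRing.Zmodule_isLmodule.Build R dsum
  dsum_scaleA dsum_scale1 dsum_scaleDr dsum_scaleDl.

Lemma dinj_subproof k (v : M k) :
  finitely_supported (dfwith (fun j => 0 : M j) v).
Proof.
by exists k.+1; move=> j kj; rewrite dfwith_out // neq_ltn kj.
Qed.

Definition dinj k (v : M k) : dsum := mkdsum (dinj_subproof v).

End DirectSum.

Definition Vstar : lmodType Qqt := dsum V.

(* The quiver: from vertex k there is one arrow for each label l with
   step l k <> None, and it leads to the vertex step l k. *)
Inductive label := Lplus | Lminus | Lloop of nat.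

Definition nat_of_label l :=
  match l with Lplus => 0 | Lminus => 1 | Lloop i => i.+2 end%N.
Definition label_of_nat n :=
  match n with 0 => Lplus | 1 => Lminus | i.+2 => Lloop i end%N.
Fact nat_of_labelK : cancel nat_of_label label_of_nat. Proof. by case. Qed.
HB.instance Definition _ := Countable.copy label (can_type nat_of_labelK).

Definition step (l : label) (k : nat) : option nat :=
  match l with
  | Lplus => Some k.+1
  | Lminus => if k is k'.+1 then Some k' else None
  | Lloop i => if (0 < i < k)%N then Some k else None
  end.

(* Words are read from right to left, like products of operators. *)
Definition walk (w : seq label) (k : nat) : option nat :=
  foldr (fun l o => obind (step l) o) (Some k) w.

Definition qpath := {p : nat * seq label | walk p.2 p.1 != None}.
Definition source (p : qpath) : nat := (val p).1.
Definition word (p : qpath) : seq label := (val p).2.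
Definition target (p : qpath) : option nat := walk (word p) (source p).

Definition path_alg : lmodType Qqt := {freeg qpath / Qqt}.

(* The path with source k and word w (0 if there is none). *)
Definition pth (k : nat) (w : seq label) : path_alg :=
  if insub (k, w) is Some p then << p >> else 0.

Definition path_comp (p1 p2 : qpath) : path_alg :=
  if target p2 == Some (source p1) then pth (source p2) (word p1 ++ word p2)
  else 0.

Definition pmul (a b : path_alg) : path_alg :=
  fglift (fun p1 => fglift (fun p2 => path_comp p1 p2) b) a.

Section FreegLift.
Context (K : comNzRingType) (S : choiceType) (M : lmodType K).

HB.instance Definition _ (f : S -> M) :=
  GRing.isZmodMorphism.Build {freeg S / K} M (fglift f) (lift_is_additive f).

Lemma fgliftZ (f : S -> M) c (D : {freeg S / K}) :
  fglift f (c *: D) = c *: fglift f D.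
Proof.
rewrite -[in RHS](freeg_sumE D) [c *: D]/(fgscale c D) /fgscale.
rewrite !raddf_sum /=.
by apply: eq_bigr => x _; rewrite !liftU scalerA.
Qed.

Lemma fglift_linearf (f g h : S -> M) c (D : {freeg S / K}) :
  (forall x, h x = c *: f x + g x) -> fglift h D = c *: fglift f D + fglift g D.
Proof.
move=> hE; rewrite -(freeg_sumE D) !raddf_sum /= -big_split /=.
by apply: eq_bigr => x _; rewrite !liftU hE scalerDr !scalerA mulrC.
Qed.

End FreegLift.

Lemma pmul_linearl c a b d : pmul (c *: a + b) d = c *: pmul a d + pmul b d.
Proof. by rewrite /pmul raddfD /= fgliftZ. Qed.

Lemma pmul_linearr c a b d : pmul a (c *: b + d) = c *: pmul a b + pmul a d.
Proof. by rewrite /pmul; apply: fglift_linearf => x; rewrite raddfD /= fgliftZ. Qed.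

Lemma pmulBl a b d : pmul (a - b) d = pmul a d - pmul b d.
Proof. by rewrite addrC -scaleN1r pmul_linearl scaleN1r addrC. Qed.

Lemma pmulBr a b d : pmul a (b - d) = pmul a b - pmul a d.
Proof. by rewrite addrC -scaleN1r pmul_linearr scaleN1r addrC. Qed.

(* The defining relations; k is the source of the paths. *)
Inductive dyck_rel : path_alg -> path_alg -> Prop :=
| rel_quadratic k i : (0 < i < k)%N ->
    dyck_rel (pmul (pth k [:: Lloop i] - pth k [::])
                   (pth k [:: Lloop i] + q *: pth k [::])) 0
| rel_braid k i : (0 < i)%N -> (i.+1 < k)%N ->
    dyck_rel (pth k [:: Lloop i; Lloop i.+1; Lloop i])
             (pth k [:: Lloop i.+1; Lloop i; Lloop i.+1])
| rel_commute k i j : (0 < i < k)%N -> (0 < j < k)%N ->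
    (i.+1 < j)%N || (j.+1 < i)%N ->
    dyck_rel (pth k [:: Lloop i; Lloop j]) (pth k [:: Lloop j; Lloop i])
| rel_loop_minus k i : (0 < i)%N -> (i < k.-1)%N ->
    dyck_rel (pth k [:: Lloop i; Lminus]) (pth k [:: Lminus; Lloop i])
| rel_plus_loop k i : (0 < i < k)%N ->
    dyck_rel (pth k [:: Lplus; Lloop i]) (pth k [:: Lloop i.+1; Lplus])
| rel_plus_plus k :
    dyck_rel (pth k [:: Lloop 1; Lplus; Lplus]) (pth k [:: Lplus; Lplus])
| rel_minus_minus k : (2 <= k)%N ->
    dyck_rel (pth k [:: Lminus; Lminus; Lloop k.-1]) (pth k [:: Lminus; Lminus])
| rel_comm_minus k : (2 <= k)%N ->
    dyck_rel (pth k [:: Lminus; Lplus; Lminus; Lloop k.-1]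
              - pth k [:: Lminus; Lminus; Lplus; Lloop k.-1])
             (q *: (pth k [:: Lplus; Lminus; Lminus]
                    - pth k [:: Lminus; Lplus; Lminus]))
| rel_comm_plus k : (1 <= k)%N ->
    dyck_rel (pth k [:: Lloop 1; Lplus; Lminus; Lplus]
              - pth k [:: Lloop 1; Lminus; Lplus; Lplus])
             (q *: (pth k [:: Lplus; Lplus; Lminus]
                    - pth k [:: Lplus; Lminus; Lplus])).

Inductive in_dyck_ideal : path_alg -> Prop :=
| ideal_rel a b : dyck_rel a b -> in_dyck_ideal (a - b)
| ideal_0 : in_dyck_ideal 0
| ideal_linear c a b :
    in_dyck_ideal a -> in_dyck_ideal b -> in_dyck_ideal (c *: a + b)
| ideal_mull c a : in_dyck_ideal a -> in_dyck_ideal (pmul c a)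
| ideal_mulr c a : in_dyck_ideal a -> in_dyck_ideal (pmul a c).

Definition dyck_ideal (a : path_alg) : bool := `[< in_dyck_ideal a >].

Fact dyck_ideal_zmod : zmod_closed dyck_ideal.
Proof.
split=> [|a b]; rewrite !unfold_in.
  by apply/asboolP; exact: ideal_0.
move=> /asboolP ia /asboolP ib; apply/asboolP.
by rewrite addrC -scaleN1r; apply: ideal_linear.
Qed.
HB.instance Definition _ :=
  GRing.isZmodClosed.Build path_alg dyck_ideal dyck_ideal_zmod.

(* The Dyck path algebra (without unit: the quiver has infinitely many
   vertices). *)
Definition dyck_alg : Type :=
  Quotient.quot (GRing.ZmodClosed.clone path_alg dyck_ideal _).
HB.instance Definition _ := GRing.Zmodule.on dyck_alg.

Definition dpi (a : path_alg) : dyck_alg :=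
  (\pi_(Quotient.quot (GRing.ZmodClosed.clone path_alg dyck_ideal _)) a)%qT.
Definition drepr (x : dyck_alg) : path_alg :=
  generic_quotient.repr (x : Quotient.quot (GRing.ZmodClosed.clone path_alg dyck_ideal _)).

Lemma dpiK : cancel drepr dpi. Proof. exact: reprK. Qed.

Lemma dpi_eq a b : dpi a = dpi b <-> in_dyck_ideal (a - b).
Proof.
have E : `[< in_dyck_ideal (a - b) >] = (dpi a == dpi b) :=
  Quotient.idealrBE (GRing.ZmodClosed.clone path_alg dyck_ideal _) a b.
split=> [ab|/asboolP]; last by rewrite E => /eqP.
by apply/asboolP; rewrite E ab.
Qed.

Lemma dpi_reprB a : in_dyck_ideal (drepr (dpi a) - a).
Proof. by apply/dpi_eq; rewrite dpiK. Qed.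

Lemma dpiD : {morph dpi : a b / a + b}.
Proof. exact: raddfD. Qed.

Definition dyck_scale (c : Qqt) (x : dyck_alg) : dyck_alg := dpi (c *: drepr x).
Definition dyck_mul (x y : dyck_alg) : dyck_alg := dpi (pmul (drepr x) (drepr y)).

Lemma dpi_scale c a : dyck_scale c (dpi a) = dpi (c *: a).
Proof.
apply/dpi_eq; rewrite -scalerBr -[X in in_dyck_ideal X]addr0.
exact: ideal_linear (dpi_reprB a) ideal_0.
Qed.

Lemma dpi_mul a b : dyck_mul (dpi a) (dpi b) = dpi (pmul a b).
Proof.
apply/dpi_eq; set a' := drepr _; set b' := drepr _.
rewrite -[X in in_dyck_ideal X](subrKA (pmul a' b)) -pmulBr -pmulBl.
rewrite -[X in in_dyck_ideal (X + _)]scale1r.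
by apply: ideal_linear; [apply: ideal_mull | apply: ideal_mulr];
  exact: dpi_reprB.
Qed.

Fact dyck_scaleA a b x : dyck_scale a (dyck_scale b x) = dyck_scale (a * b) x.
Proof. by rewrite -[x]dpiK !dpi_scale scalerA. Qed.
Fact dyck_scale1 : left_id 1 dyck_scale.
Proof. by move=> x; rewrite -[x]dpiK dpi_scale scale1r. Qed.
Fact dyck_scaleDr : right_distributive dyck_scale +%R.
Proof.
by move=> a x y; rewrite -[x]dpiK -[y]dpiK -dpiD !dpi_scale -dpiD scalerDr.
Qed.
Fact dyck_scaleDl x : {morph dyck_scale^~ x : a b / a + b}.
Proof. by move=> a b; rewrite -[x]dpiK !dpi_scale -dpiD scalerDl. Qed.
HB.instance Definition _ := GRing.Zmodule_isLmodule.Build Qqt dyck_alg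
  dyck_scaleA dyck_scale1 dyck_scaleDr dyck_scaleDl.

Lemma dpiZ c a : dpi (c *: a) = c *: dpi a.
Proof. by rewrite -dpi_scale. Qed.

Lemma dyck_mul_linearl c x y z :
  dyck_mul (c *: x + y) z = c *: dyck_mul x z + dyck_mul y z.
Proof.
rewrite -[x]dpiK -[y]dpiK -[z]dpiK -dpiZ -dpiD !dpi_mul -dpiZ -dpiD.
by rewrite pmul_linearl.
Qed.

Lemma dyck_mul_linearr c x y z :
  dyck_mul x (c *: y + z) = c *: dyck_mul x y + dyck_mul x z.
Proof.
rewrite -[x]dpiK -[y]dpiK -[z]dpiK -dpiZ -dpiD !dpi_mul -dpiZ -dpiD.
by rewrite pmul_linearr.
Qed.

Lemma walk_cat w1 w2 k : walk (w1 ++ w2) k = obind (walk w1) (walk w2 k).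
Proof.
rewrite /walk foldr_cat; case: (foldr _ (Some k) w2) => [j|] //=.
by elim: w1 => //= l w1 ->.
Qed.

Lemma pthU (p : qpath) : pth (source p) (word p) = << p >>.
Proof.
rewrite /pth; have -> : (source p, word p) = val p by case: p => -[].
by rewrite valK.
Qed.

Lemma pth0 k w : walk w k = None -> pth k w = 0.
Proof. by move=> wk; rewrite /pth insubF //= wk. Qed.

Lemma path_alg_ind (P : path_alg -> Prop) : P 0 ->
  (forall c k w a, P a -> P (c *: pth k w + a)) -> forall a, P a.
Proof.
move=> P0 PD a; rewrite -(freeg_sumE a).
elim: (dom a) => [|p s IH]; first by rewrite big_nil.
rewrite big_cons (_ : << _ *g p >> = coeff p a *: pth (source p) (word p)).
  exact: PD.
rewrite pthU; apply/eqP/freeg_eqP => x.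
by rewrite coeffZ !coeffU mul1r.
Qed.

Lemma pmul0l a : pmul 0 a = 0. Proof. exact: raddf0. Qed.
Lemma pmul0r a : pmul a 0 = 0.
Proof. by rewrite -[0 in LHS](subrr 0) pmulBr subrr. Qed.

Lemma pth_comp k1 w1 k2 w2 : pmul (pth k1 w1) (pth k2 w2) =
  if walk w2 k2 == Some k1 then pth k2 (w1 ++ w2) else 0.
Proof.
case E2: (walk w2 k2) => [j|]; last by rewrite (pth0 E2) pmul0r.
case: eqP => [[jk]|jk]; last first.
  rewrite {1}/pth; case: insubP => [p1 _ E1|_]; last exact: pmul0l.
  rewrite /pth; case: insubP => [p2 _ E|_]; last exact: pmul0r.
  rewrite /pmul !liftU !scale1r /path_comp /target /source /word E E1 /= E2.
  by case: eqP.
case E1: (walk w1 k1) => [l|]; last first.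
  by rewrite (pth0 E1) pmul0l pth0 // walk_cat E2 jk /= E1.
rewrite {1}/pth; case: insubP => [p1 _ p1E|]; last by rewrite /= E1.
rewrite {1}/pth; case: insubP => [p2 _ p2E|]; last by rewrite /= E2.
rewrite /pmul !liftU !scale1r.
by rewrite /path_comp /target /source /word p1E p2E /= E2 jk eqxx.
Qed.

Lemma pmulA : associative pmul.
Proof.
move=> a b c; elim/path_alg_ind: a => [|x k w a IH]; first by rewrite !pmul0l.
rewrite !pmul_linearl {}IH; congr (_ *: _ + _).
elim/path_alg_ind: b => [|y l v b IH]; first by rewrite !(pmul0l, pmul0r).
rewrite !(pmul_linearl, pmul_linearr) {}IH; congr (_ *: _ + _).
elim/path_alg_ind: c => [|z j u c IH]; first by rewrite !pmul0r.
rewrite !pmul_linearr {}IH; congr (_ *: _ + _).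
rewrite !pth_comp.
case E: (walk u j) => [i|] /=.
  case: eqP => [[<-]|il].
    rewrite pth_comp walk_cat E /=.
    case: eqP => vi; last by rewrite pmul0l.
    by rewrite pth_comp E eqxx catA.
  rewrite pmul0r; case: eqP => _; last by rewrite pmul0l.
  by rewrite pth_comp E; case: eqP.
rewrite pmul0r; case: eqP => _; last by rewrite pmul0l.
by rewrite pth_comp E.
Qed.

Lemma dyck_mulA : associative dyck_mul.
Proof.
by move=> x y z; rewrite -[x]dpiK -[y]dpiK -[z]dpiK !dpi_mul pmulA.
Qed.

(* The idempotent e_k and, for k with step l k <> None, the arrow from k
   labelled l. *)
Definition e_ (k : nat) : dyck_alg := dpi (pth k [::]).
Definition arr (l : label) (k : nat) : dyck_alg := dpi (pth k [:: l]).

Definition in_Ae0 (x : dyck_alg) : bool :=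
  `[< exists a, x = dyck_mul a (e_ 0) >].

Fact in_Ae0_submod : submod_closed in_Ae0.
Proof.
split=> [|c x y]; rewrite !unfold_in.
  apply/asboolP; exists 0.
  by rewrite -[0 in RHS](subrr 0) -scaleN1r addrC dyck_mul_linearl scaleN1r addNr.
move=> /asboolP[a ->] /asboolP[b ->]; apply/asboolP; exists (c *: a + b).
by rewrite dyck_mul_linearl.
Qed.
HB.instance Definition _ :=
  GRing.isSubmodClosed.Build Qqt dyck_alg in_Ae0 in_Ae0_submod.

Record Ae0 := MkAe0 { Ae0_val :> dyck_alg; _ : Ae0_val \in in_Ae0 }.
HB.instance Definition _ := [isSub for Ae0_val].
HB.instance Definition _ := [Choice of Ae0 by <:].
HB.instance Definition _ := [SubChoice_isSubLmodule of Ae0 by <:].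

Lemma Ae0_mul_subproof (a : dyck_alg) (x : Ae0) : dyck_mul a x \in in_Ae0.
Proof.
case: x => x /= /asboolP[b ->]; apply/asboolP; exists (dyck_mul a b).
by rewrite dyck_mulA.
Qed.

Definition Ae0_mul (a : dyck_alg) (x : Ae0) : Ae0 := MkAe0 (Ae0_mul_subproof a x).

Lemma e0_subproof : e_ 0 \in in_Ae0.
Proof.
apply/asboolP; exists (e_ 0).
by rewrite /e_ dpi_mul pth_comp.
Qed.

Definition e0 : Ae0 := MkAe0 e0_subproof.

Definition in_ekAe0 (k : nat) (x : Ae0) : Prop :=
  exists a, Ae0_val x = dyck_mul (e_ k) (dyck_mul a (e_ 0)).

Definition is_representation (W : lmodType Qqt) (rho : dyck_alg -> W -> W) :=
  [/\ forall c a b v, rho (c *: a + b) v = c *: rho a v + rho b v,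
      forall a c v w, rho a (c *: v + w) = c *: rho a v + rho a w
    & forall a b v, rho (dyck_mul a b) v = rho a (rho b v)].

(* Main.v *)
(* Put G^(k) = G[X + (q-1)(y_1 + ... + y_k)] for G in Sym.  Every element of V_k
   is a combination of y^m G^(k), the T_i fix G^(k), d_+ G^(k) = G^(k+1) and
   d_- (y_(k+1)^a G^(k+1)) = (-1)^a e_(a+1) G^(k).  On such elements the relations
   of the algebra become identities between polynomials, the main one being
   d_+ d_- - d_- d_+ = (q-1) y_1 (q T_1^-1) ... (q T_(k-1)^-1) on V_k.

   Conversely this formula defines y_1, and then y_1, ..., y_k, in the algebra; they
   commute with each other and with d_-.  The operators (-1)^a d_- y_1^a d_+ on e_0 A e_0
   commute with each other and act on V_0 = Sym as multiplication by e_(a+1).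
   The elements y^m d_+^k w, with w a monomial in these operators applied to e_0,
   span e_k A e_0, because their span is stable under all the generators.  They
   are sent to y^m G^(k) with G a monomial in e_1, e_2, ..., and hence to a basis of
   V_k. *)

From HB Require Import structures.
From mathcomp Require Import all_boot all_order perm all_algebra.
From mathcomp Require Import boolp ring zify.
From mathcomp.multinomials Require Import freeg mpoly.
Require Import Defs.

Set Implicit Arguments.
Unset Strict Implicit.
Unset Printing Implicit Defensive.

Import GRing.Theory.
Local Open Scope ring_scope.

(** * The polynomial representation *)

(** The elements G^(k) suit d_- because replacing X by X - (q-1) z^-1 and y_(k+1) by z^-1 undoes F
    |-> F[X + (q-1) y_(k+1)]: on y_(k+1)^a times such an F no plethysm is left, and d_- only reads
    off one coefficient of Exp[-zX]. Multiplication by y_i obeys simple cross relations with the T_i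
    and commutes with d_- unless y_i is the variable being removed. A relation checked on the G^(k)
    therefore extends by induction on factors y_i, the removed variable being carried along as an
    explicit power. In the algebra only the presentation is available, with no normal form for
    paths. The relations are therefore stated for any graded family of spaces with maps T_i, d_+,
    d_- ([dyck_module]). Both V_k and e_k A e_0 are such families, so the y_i and the operators on
    level 0 are studied once for both, and any map of families respects them. Injectivity is then
    proved on a span, without reducing products of generators; that this span is everything is a
    separate matter, in which stability under d_- is the hard point. *)

Lemma q_neq0 : q != 0.
Proof.
rewrite /q tofrac_eq0 -msupp_eq0 msuppX //.
Qed.

Lemma q_neq1 : q - 1 != 0.
Proof.
rewrite subr_eq0 /q -(rmorph1 (@tofrac {mpoly rat[2]})) tofrac_eq.
apply/eqP => /(congr1 (mcoeff 0%MM)).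
by rewrite mcoeffX mcoeff1 eqxx mnm1_eq0 => /eqP; rewrite eq_sym oner_eq0.
Qed.

Lemma Sym_rmorph_ext (B : comNzRingType) (f g : {rmorphism Sym -> B}) :
  (forall c, f c%:A = g c%:A) -> (forall m, f (p_ m.+1) = g (p_ m.+1)) -> f =1 g.
Proof.
move=> fgA fgp F; have [N [P ->]] := symfun_psum Qqt_char0 F.
rewrite (rmorph_mmap f) (rmorph_mmap g).
by apply: eq_mmap => [c|i] /=; [exact: fgA | exact: fgp].
Qed.

(* 0-based: [yv k i] is y_(i+1), and 0 when there is no such variable. *)
HB.lock Definition yv k (i : nat) : V k := if insub i is Some a then y_ a else 0.

Lemma yvE k (i : 'I_k) : yv k i = y_ i.
Proof. by rewrite unlock valK. Qed.

Lemma yv_out k i : (k <= i)%N -> yv k i = 0.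
Proof. by move=> ki; rewrite unlock insubN // -leqNgt. Qed.

Lemma SymV_is_zmod k : zmod_morphism (@SymV k).
Proof. by move=> F G; rewrite /SymV mpolyCB. Qed.
HB.instance Definition _ k :=
  GRing.isZmodMorphism.Build Sym (V k) (@SymV k) (@SymV_is_zmod k).
Lemma SymV_is_monoid k : monoid_morphism (@SymV k).
Proof. by split=> [|F G]; rewrite /SymV ?mpolyC1 ?mpolyCM. Qed.
HB.instance Definition _ k :=
  GRing.isMonoidMorphism.Build Sym (V k) (@SymV k) (@SymV_is_monoid k).

Lemma SymV_alg k c : SymV k c%:A = c%:A.
Proof.
by rewrite -[RHS]/((c%:A : Sym) *: (1 : {mpoly Sym[k]})) alg_mpolyC.
Qed.

Lemma V_ind k (P : V k -> Prop) :
  (forall c, P (SymV k c)) -> (forall F G, P F -> P G -> P (F + G)) ->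
  (forall i F, (i < k)%N -> P F -> P (yv k i * F)) -> forall F, P F.
Proof.
move=> PC PD Py; elim/mpolyind => [|c m F _ _ IH].
  by have := PC 0; rewrite raddf0.
apply: PD => //; rewrite -mul_mpolyC mulrC mpolyXE_id.
have Pprod : forall (r : seq 'I_k) G, P G ->
    P ((\prod_(i <- r) ('X_i : {mpoly Sym[k]}) ^+ m i) * G).
  elim=> [|i r IHr] G PG; first by rewrite big_nil mul1r.
  rewrite big_cons -mulrA; set H := _ * G; have PH : P H by exact: IHr.
  elim: (m i) => [|n IHn]; first by rewrite expr0 mul1r.
  by rewrite exprS -mulrA -[X in X * _]/(y_ i) -yvE; apply: Py.
exact: (Pprod _ (SymV k c) (PC c)).
Qed.

Lemma V_rmorph_ext k (B : comNzRingType) (f g : {rmorphism V k -> B}) :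
  (forall c, f c%:A = g c%:A) ->
  (forall m, f (SymV k (p_ m.+1)) = g (SymV k (p_ m.+1))) ->
  (forall i : 'I_k, f (y_ i) = g (y_ i)) -> f =1 g.
Proof.
move=> fgA fgp fgy; elim/V_ind => [c|F G fF fG|i F ik fF].
- apply: (@Sym_rmorph_ext _ (f \o @SymV k) (g \o @SymV k)) => //= a.
  by rewrite SymV_alg.
- by rewrite !rmorphD fF fG.
- by rewrite !rmorphM fF -[i]/(nat_of_ord (Ordinal ik)) yvE fgy.
Qed.

(** * Newton identities and the coefficients of Exp[-zX] *)

Lemma newton_scale (A : comNzRingType) (e p : nat -> A) c : newton e p ->
  newton (fun n => c ^+ n * e n) (fun j => c ^+ j.+1 * p j).
Proof.
move=> [e0 ep]; split=> [|k]; first by rewrite e0 mulr1.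
rewrite -mulrnAr ep mulr_sumr; apply: eq_bigr => j _.
have -> : c ^+ k.+1 = c ^+ (k - j) * c ^+ j.+1.
  by rewrite -exprD addnS subnK // -ltnS.
ring.
Qed.

Lemma hsymE m n e : (hsym Qqt m n)@_e = (mdeg e == m)%:R.
Proof.
rewrite raddf_sum /=; case: eqP => [em|em]; last first.
  rewrite big1 // => d /eqP dm; rewrite mcoeffX.
  by case: eqP => // de; case: em; rewrite -de.
have em' : (mdeg e < m.+1)%N by rewrite em.
rewrite (bigD1 (BMultinom em')) /=; last by rewrite em.
rewrite mcoeffX eqxx big1 ?addr0 // => d /andP[_ de].
by rewrite mcoeffX; case: eqP => // E; case/eqP: de; apply: val_inj.
Qed.

Lemma mcoeffMXn (R : comNzRingType) n (p : {mpoly R[n]}) i j e :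
  (p * 'X_i ^+ j)@_e = if (j <= e i)%N then p@_(e - U_(i) *+ j)%MM else 0.
Proof.
rewrite mpolyXn; case: leqP => ji.
  rewrite -[in LHS](@submK _ (U_(i) *+ j)%MM e); first by rewrite addmC mcoeffMX.
  apply/mnm_lepP => l; rewrite mulmnE mnm1E.
  by case: eqP => [<-|]; rewrite ?mul1n ?mul0n.
apply: memN_msupp_eq0; rewrite (perm_mem (msuppMX _ _)).
apply/mapP => -[m _ E]; move: ji; rewrite {1}E mnmDE mulmnE mnm1E eqxx mul1n.
by rewrite ltnNge leq_addr.
Qed.

(** The signs cancel those of [newton], leaving (k+1) h_(k+1) = sum_j h_(k-j) p_(j+1). A monomial
    x^e of degree k+1 occurs on the right once for each pair (i, j) with j < e_i, hence k+1 times,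
    since the e_i add up to the degree. *)
Lemma newton_hsym : newton (hsym Qqt) (fun j => (-1) ^+ j * psum Qqt j.+1).
Proof.
split=> [|k].
  apply: symfun_eq => n; apply/mpolyP => e; rewrite hsymE.
  by rewrite -[RHS]/((1%:MP : {mpoly Qqt[n]})@_e) mcoeffC mul1r mdeg_eq0.
rewrite (eq_bigr (fun j : 'I_k.+1 => hsym Qqt (k - j) * psum Qqt j.+1)); last first.
  by move=> j _; rewrite -mulrA mulrCA signrMK.
apply: symfun_eq => n.
rewrite -[LHS]/(coord n _) -[RHS]/(coord n _) rmorphMn rmorph_sum /=.
apply/mpolyP => e; rewrite mcoeffMn hsymE raddf_sum /=.
rewrite (eq_bigr (fun j : 'I_k.+1 => \sum_(i < n)
   if (j < e i)%N then (mdeg e == k.+1)%:R else 0)); last first.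
  move=> j _; rewrite -[X in X * _]/(hsym Qqt (k - j) n) mulr_sumr raddf_sum /=.
  apply: eq_bigr => i _; rewrite mcoeffMXn hsymE; case: ltnP => // ji.
  congr (_%:R); congr (nat_of_bool _).
  have le : (U_(i) *+ j.+1 <= e)%MM.
    apply/mnm_lepP => l; rewrite mulmnE mnm1E.
    by case: eqP => [<-|]; rewrite ?mul1n ?mul0n.
  have {2}-> : e = ((e - U_(i) *+ j.+1) + U_(i) *+ j.+1)%MM by rewrite submK.
  by rewrite mdegD mdegMn mdeg1 mul1n addnS eqSS -(eqn_add2r j) subnK // -ltnS.
case: eqP => ek; last first.
  by rewrite mul0rn !big1 // => j _; rewrite big1 // => i _; case: ifP.
rewrite exchange_big /= -{1}ek mdegE -[LHS]mulr_natl mulr1 natr_sum.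
apply: eq_bigr => i _.
rewrite -big_mkcond /= sumr_const; congr (_%:R).
have ei : (e i <= k.+1)%N by rewrite -ek mdegE (bigD1 i) //= leq_addr.
have := @big_ord_widen _ 0%N addn _ _ (fun=> 1%N) ei.
by rewrite !sum1_card card_ord.
Qed.

Lemma newton_uniq (A : comNzRingType) (e e' p : nat -> A) :
  (forall n (x y : A), x *+ n.+1 = y *+ n.+1 -> x = y) ->
  newton e p -> newton e' p -> e =1 e'.
Proof.
move=> Areg [e0 ep] [e'0 ep']; elim/ltn_ind => -[|n] IH; first by rewrite e0.
apply: (Areg n); rewrite ep ep'; apply: eq_bigr => j _.
by rewrite IH // ltnS leq_subr.
Qed.

Lemma algQqt_regular (A : comAlgType Qqt) n (x y : A) :
  x *+ n.+1 = y *+ n.+1 -> x = y.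
Proof.
rewrite -!(scaler_nat n.+1) => /(congr1 (fun z => n.+1%:R^-1 *: z)).
by rewrite !scalerA mulVf ?scale1r // ((pcharf0P _).1 Qqt_char0).
Qed.

(** The substitution X -> -zX sends (-1)^j p_(j+1) to (-z)^(j+1) p_(j+1), so h_n[-zX] and (-z)^n e_n
    satisfy Newton identities with the same power sums, and these determine the sequence in
    characteristic 0. *)
Lemma h_minus_zXE n : h_minus_zX n = (- 'X) ^+ n * (esym Qqt n)%:P.
Proof.
pose f : {rmorphism Sym -> {poly Sym}} :=
  pleth (polyC \o in_alg Sym) (fun m => - ((p_ m)%:P * 'X^m)).
have H := newton_rmorph f newton_hsym.
have E := newton_scale (- 'X) (newton_rmorph (@polyC Sym) (newton_sym Qqt)).
apply: (newton_uniq _ _ E) => [m x y|].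
  move/polyP => xy; apply/polyP => i; apply: (@algQqt_regular Sym m).
  by rewrite -!coefMn.
case: H => H0 Hp; split=> // k; rewrite [LHS]Hp; apply: eq_bigr => j _.
rewrite [X in _ * X = _](_ : _ = (-1) ^+ j * - ((psum Qqt j.+1)%:P * 'X ^+ j.+1)).
  by rewrite /= [(- 'X) ^+ _]exprNn [(-1) ^+ j.+1]exprS; ring.
by rewrite /= rmorphM rmorph_sign; congr (_ * _); apply: pleth_p.
Qed.

(** Scalars as ring elements: an identity mixing scalars and products in V_k becomes one of
    commutative rings, within reach of [ring]. *)
HB.lock Definition cst k (c : Qqt) : V k := c%:A.
Lemma cst_is_zmod k : zmod_morphism (@cst k).
Proof. by move=> a b; rewrite unlock scalerBl. Qed.
HB.instance Definition _ k :=
  GRing.isZmodMorphism.Build Qqt (V k) (@cst k) (@cst_is_zmod k).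
Lemma cst_is_monoid k : monoid_morphism (@cst k).
Proof.
by split=> [|a b]; rewrite unlock ?scale1r // -scalerAl mul1r scalerA.
Qed.
HB.instance Definition _ k :=
  GRing.isMonoidMorphism.Build Qqt (V k) (@cst k) (@cst_is_monoid k).

Lemma scale_cst k c (F : V k) : c *: F = cst k c * F.
Proof. by rewrite unlock mulr_algl. Qed.

Lemma cstE k c : cst k c = SymV k c%:A.
Proof. by rewrite unlock SymV_alg. Qed.

Lemma Exp_minus_zXE n : Exp_minus_zX n = (-1) ^+ n * esym Qqt n.
Proof.
have coefE i : (h_minus_zX i)`_n = (i == n)%:R * ((-1) ^+ n * esym Qqt n).
  have -> : h_minus_zX i = ((-1) ^+ i * esym Qqt i)%:P * 'X^i.
    by rewrite h_minus_zXE rmorphM rmorph_sign [(- 'X) ^+ _]exprNn; ring.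
  rewrite coefCM coefXn eq_sym.
  by case: eqP => [->|_]; rewrite ?mulr0 ?mul0r // mulrC.
rewrite /Exp_minus_zX (bigD1 ord_max) //= coefE eqxx mul1r big1 ?addr0 // => i.
by rewrite -val_eqE coefE => /negPf ->; rewrite mul0r.
Qed.

(* (-1)^n e_n, the coefficient of z^n in Exp[-zX] *)
HB.lock Definition eps k n : V k := SymV k (Exp_minus_zX n).

Lemma eps0 k : eps k 0 = 1.
Proof.
rewrite unlock Exp_minus_zXE expr0 mul1r.
by have [-> _] := newton_sym Qqt; rewrite rmorph1.
Qed.

(* F |-> F[X + (q-1) y_(k+1)] *)
HB.lock Definition tau k : V k -> V k.+1 :=
  mmap (pleth (in_alg (V k.+1)) (@alphabet_plus k))
       (fun i : 'I_k => y_ (widen_ord (leqnSn k) i)).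
Lemma tau_is_zmod k : zmod_morphism (@tau k).
Proof. by move=> F G; rewrite unlock rmorphB. Qed.
HB.instance Definition _ k :=
  GRing.isZmodMorphism.Build (V k) (V k.+1) (@tau k) (@tau_is_zmod k).
Lemma tau_is_monoid k : monoid_morphism (@tau k).
Proof. by split=> [|F G]; rewrite unlock ?rmorph1 ?rmorphM. Qed.
HB.instance Definition _ k :=
  GRing.isMonoidMorphism.Build (V k) (V k.+1) (@tau k) (@tau_is_monoid k).

Lemma tau_Sym k F : tau (SymV k F) = pleth (in_alg (V k.+1)) (@alphabet_plus k) F.
Proof. by rewrite unlock mmapC. Qed.

Lemma tau_alg k c : tau (c%:A : V k) = c%:A.
Proof. by rewrite -SymV_alg tau_Sym pleth_scalar. Qed.

Lemma tau_p k m : tau (SymV k (p_ m.+1)) = alphabet_plus k m.+1.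
Proof. by rewrite tau_Sym pleth_p. Qed.


Lemma tau_y k i : (i < k)%N -> tau (yv k i) = yv k.+1 i.
Proof.
move=> ik; rewrite -[i]/(nat_of_ord (Ordinal ik)) yvE [@tau]unlock mmapX mmap1U.
by rewrite -yvE.
Qed.

Lemma tauZ k c (F : V k) : tau (c *: F) = c *: tau F.
Proof. by rewrite -mulr_algl rmorphM /= tau_alg mulr_algl. Qed.

Lemma yv_last k : yv k.+1 k = y_ ord_max.
Proof. by rewrite -yvE. Qed.

(* Both sides are generated by Exp[-zX] (1 - q y z): the two sequences of
   elementary functions have equal power sums once y and q y are adjoined. *)
Lemma tau_eps k n :
  tau (eps k n.+1) - yv k.+1 k * tau (eps k n)
  = eps k.+1 n.+1 - q *: (yv k.+1 k * eps k.+1 n).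
Proof.
set y := yv _ _; pose E j i := SymV j (esym Qqt i).
have N1 := newton_addvar y (newton_rmorph (@tau k \o @SymV k) (newton_sym Qqt)).
have N2 := newton_addvar (q *: y) (newton_rmorph (@SymV k.+1) (newton_sym Qqt)).
have H := newton_inj_e Qqt_char0 N1 N2 _ (leqnn n.+1).
have /= {}H : tau (E k n.+1) + y * tau (E k n) = E k.+1 n.+1 + q *: y * E k.+1 n.
  apply: H => j _ /=; rewrite [tau _]tau_p /alphabet_plus -yv_last -/y.
  by rewrite exprZn scalerBl scale1r addrA subrK.
rewrite [@eps]unlock !Exp_minus_zXE !rmorphM !rmorph_sign /= -/(E k _) -/(E k.+1 _).
rewrite exprS !scale_cst in H *.
have -> : tau (E k n.+1) = E k.+1 n.+1 + cst k.+1 q * y * E k.+1 n - y * tau (E k n).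
  by rewrite -H addrK.
ring.
Qed.

(** Solves the recursion [tau_eps]: the quotient (1 - q y z)/(1 - y z) is 1 + (1-q) sum_(m >= 1) y^m
    z^m. *)
Lemma eps_tau_sum k n : tau (eps k n)
  = eps k.+1 n + (1 - q) *: \sum_(j < n) eps k.+1 j * yv k.+1 k ^+ (n - j).
Proof.
elim: n => [|n IH]; first by rewrite big_ord0 scaler0 addr0 !eps0 rmorph1.
rewrite -[LHS](subrK (yv k.+1 k * tau (eps k n))) tau_eps {}IH.
rewrite big_ord_recr /= subSnn expr1.
have -> : \sum_(i < n) eps k.+1 i * yv k.+1 k ^+ (n.+1 - i) =
  yv k.+1 k * \sum_(i < n) eps k.+1 i * yv k.+1 k ^+ (n - i).
  rewrite mulr_sumr; apply: eq_bigr => i _; rewrite subSn 1?ltnW // exprS; ring.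
rewrite !scale_cst rmorphB rmorph1; ring.
Qed.

(* p_m[X + a (y_1 + ... + y_k)], where c m = p_m[a] *)
Definition shift_alphabet (c : nat -> Qqt) k m : V k :=
  SymV k (p_ m) + c m *: \sum_(i < k) y_ i ^+ m.

Definition shift c k : V k -> V k :=
  mmap (pleth (in_alg (V k)) (shift_alphabet c k)) (@y_ k).
HB.instance Definition _ c k := GRing.RMorphism.on (@shift c k).

Lemma shift_Sym c k F :
  shift c (SymV k F) = pleth (in_alg (V k)) (shift_alphabet c k) F.
Proof. by rewrite /shift mmapC. Qed.

Lemma shift_alg c k a : shift c (a%:A : V k) = a%:A.
Proof. by rewrite -[in LHS]SymV_alg shift_Sym pleth_scalar. Qed.

Lemma shift_p c k m : shift c (SymV k (p_ m.+1)) = shift_alphabet c k m.+1.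
Proof. by rewrite shift_Sym pleth_p. Qed.

Lemma shift_y c k (i : 'I_k) : shift c (y_ i) = y_ i.
Proof. by rewrite /shift mmapX mmap1U. Qed.

Lemma shift_yv c k i : shift c (yv k i) = yv k i.
Proof. by rewrite unlock; case: insubP => [a _ _|_]; rewrite ?shift_y ?rmorph0. Qed.

Lemma shiftZ c k a (F : V k) : shift c (a *: F) = a *: shift c F.
Proof. by rewrite -mulr_algl rmorphM /= shift_alg mulr_algl. Qed.

Lemma shiftK c k : cancel (shift (fun m => - c m) (k:=k)) (shift c (k:=k)).
Proof.
pose f : {rmorphism V k -> V k} := @shift c k \o @shift (fun m => - c m) k.
pose g : {rmorphism V k -> V k} := idfun.
move=> F; rewrite -[LHS]/(f F) -[RHS]/(g F).
apply: V_rmorph_ext => {F} [a|m|i] /=; rewrite ?shift_alg ?shift_y //.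
rewrite shift_p rmorphD /= shiftZ shift_p rmorph_sum /=.
under eq_bigr do rewrite rmorphXn /= shift_y.
by rewrite /shift_alphabet scaleNr addrK.
Qed.

(** * The elements G[X + (q-1)(y_1 + ... + y_k)] *)

(** The plethystic value p_m[q - 1]. *)
Definition qc m : Qqt := q ^+ m - 1.

(* G[X + (q-1)(y_1 + ... + y_k)]; these are the elements d_+^k G *)
HB.lock Definition base k (G : Sym) : V k := shift qc (SymV k G).

Lemma base_is_zmod k : zmod_morphism (@base k).
Proof. by move=> F G; rewrite [@base]unlock !rmorphB. Qed.
HB.instance Definition _ k :=
  GRing.isZmodMorphism.Build Sym (V k) (@base k) (@base_is_zmod k).
Lemma base_is_monoid k : monoid_morphism (@base k).
Proof. by split=> [|F G]; rewrite [@base]unlock ?rmorph1 ?rmorphM. Qed.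
HB.instance Definition _ k :=
  GRing.isMonoidMorphism.Build Sym (V k) (@base k) (@base_is_monoid k).

Lemma base_alg k c : base k c%:A = c%:A.
Proof. by rewrite [@base]unlock SymV_alg shift_alg. Qed.

Lemma base_p k m : base k (p_ m.+1) = shift_alphabet qc k m.+1.
Proof. by rewrite [@base]unlock shift_p. Qed.

Lemma base0 G : base 0 G = SymV 0 G.
Proof.
apply: (@Sym_rmorph_ext _ (@base 0) (@SymV 0)) => [c|m] /=.
  by rewrite base_alg SymV_alg.
by rewrite base_p /shift_alphabet big_ord0 scaler0 addr0.
Qed.

Lemma tau_yo k (i : 'I_k) : tau (y_ i) = y_ (widen_ord (leqnSn k) i).
Proof. by rewrite [@tau]unlock mmapX mmap1U. Qed.

Lemma tau_base k G : tau (base k G) = base k.+1 G.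
Proof.
apply: (@Sym_rmorph_ext _ (@tau k \o @base k) (@base k.+1)) => [c|m] /=.
  by rewrite !base_alg tau_alg.
rewrite !base_p rmorphD /= tau_p tauZ rmorph_sum /=.
under eq_bigr do rewrite rmorphXn /= tau_yo.
rewrite /alphabet_plus /shift_alphabet big_ord_recr /= scalerDr addrAC -addrA.
by [].
Qed.

(** The automorphism [shift qc] fixes the y_i and maps [SymV k G] to [base k G], so [V_ind] is
    transported along it. Most relations between the operators are proved by this induction: the T_i
    fix [base k G], and factors y_i are moved through by cross relations. *)
Lemma base_ind k (P : V k -> Prop) :
  (forall G, P (base k G)) -> (forall F G, P F -> P G -> P (F + G)) ->
  (forall i F, (i < k)%N -> P F -> P (yv k i * F)) -> forall F, P F.
Proof.
move=> PG PD Py F; rewrite -(shiftK qc F); move: (shift _ F) => {}F.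
elim/V_ind: F => [c|F G pF pG|i F ik pF]; first by have := PG c; rewrite [@base]unlock.
  rewrite rmorphD /=.
 exact: PD pF pG.
rewrite rmorphM /= shift_yv. exact: Py ik pF.
Qed.

(** Since d_- does not commute with the variable that it removes, powers of that variable belong to
    the base case, and only the other variables are adjoined in the inductive step. *)
Lemma base_ind_last k (P : V k.+1 -> Prop) :
  (forall a G, P (yv k.+1 k ^+ a * base k.+1 G)) ->
  (forall F G, P F -> P G -> P (F + G)) ->
  (forall i F, (i < k)%N -> P F -> P (yv k.+1 i * F)) -> forall F, P F.
Proof.
move=> PG PD Py F; suff H : forall a, P (yv k.+1 k ^+ a * F).
  by have := H 0%N; rewrite mul1r.
elim/base_ind: F => [G a|F G pF pG a|i F ik pF a]; first exact: PG.
  by rewrite mulrDr; apply: PD.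
move: ik; rewrite ltnS leq_eqVlt => /predU1P[->|ik].
  by rewrite mulrA -exprSr.
by rewrite mulrCA; apply: Py.
Qed.

(* F[X - (q-1) z^-1] with y_(k+1) replaced by z^-1 *)
Definition ev k (F : V k.+1) : {poly V k} :=
  (map_poly (@substB k) (muni F : {poly V k})).['X].

(* With z^-1 standing for 'X: the coefficient of z^0 in P Exp[-zX] / z. *)
Definition resB k (P : {poly V k}) : V k := \sum_(j < size P) P`_j * eps k j.+1.

Lemma resBE k N (P : {poly V k}) : (size P <= N)%N ->
  resB P = \sum_(j < N) P`_j * eps k j.+1.
Proof.
move=> PN; rewrite /resB (big_ord_widen _ (fun j => P`_j * eps k j.+1) PN).
rewrite big_mkcond; apply: eq_bigr => i _; case: ltnP => // Pi.
by rewrite nth_default // mul0r.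
Qed.

Lemma resB_is_zmod k : zmod_morphism (@resB k).
Proof.
move=> P Q; pose N := maxn (size P) (size Q).
rewrite !(@resBE _ N) ?leq_maxl ?leq_maxr //; last first.
  by rewrite (leq_trans (size_polyD _ _)) // size_polyN.
by rewrite -sumrB; apply: eq_bigr => i _; rewrite coefB mulrBl.
Qed.
HB.instance Definition _ k :=
  GRing.isZmodMorphism.Build {poly V k} (V k) (@resB k) (@resB_is_zmod k).

Lemma resB_C k (f : V k) P : resB (f%:P * P) = f * resB P.
Proof.
rewrite (@resBE _ (size P)) ?mulr_sumr; last first.
  by rewrite mul_polyC size_scale_leq.
by apply: eq_bigr => i _; rewrite coefCM mulrA.
Qed.

Lemma resB_MXn k (P : {poly V k}) i :
  resB (P * 'X^i) = \sum_(j < size P) P`_j * eps k (i + j).+1.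
Proof.
rewrite (@resBE _ (i + size P)); last first.
  by rewrite (leq_trans (size_polyMleq _ _)) // size_polyXn addnS /= addnC.
rewrite big_split_ord /= big1 ?add0r => [|j _]; last first.
  by rewrite coefMXn ltn_ord mul0r.
by apply: eq_bigr => j _; rewrite coefMXn ltnNge leq_addr /= addKn.
Qed.

HB.instance Definition _ k := GRing.RMorphism.copy (@substB k)
  (mmap (pleth (polyC \o in_alg (V k)) (@alphabet_B k)) (fun i => (y_ i)%:P)
    : V k -> {poly V k}).
HB.instance Definition _ k := GRing.RMorphism.copy (@ev k)
  (horner_eval ('X : {poly V k}) \o map_poly (@substB k)
    \o (@muni k Sym : V k.+1 -> {poly V k})).

(** Extracting z^(i+1), as B_(i+1) does, is the same as extracting z after multiplication by z^-i.
    Putting z^-1 for y_(k+1) thus lets a single extraction serve all powers of y_(k+1). *)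
Lemma dminusE k (F : V k.+1) : dminus F = - resB (ev F).
Proof.
rewrite /dminus /ev horner_coef (raddf_sum (@resB k)) /=; congr (- _).
set P := map_poly _ _.
have sP : (size P <= size (muni F : {poly V k}))%N := size_poly _ _.
rewrite [RHS](big_ord_widen _ (fun i => resB (P`_i * 'X ^+ i)) sP) [RHS]big_mkcond.
apply: eq_bigr => i _; rewrite [P`_i]coef_map resB_MXn /=.
case: ltnP => Pi; rewrite /B_; first by apply: eq_bigr => j _; rewrite [@eps]unlock.
have -> : substB ((muni F)`_i : V k) = 0 by rewrite -coef_map nth_default.
by rewrite size_poly0 big_ord0.
Qed.

Lemma ev_yo k (i : 'I_k) : ev (y_ (widen_ord (leqnSn k) i)) = (y_ i)%:P.
Proof.
rewrite /ev muniE msuppX big_seq1 mcoeffX eqxx scale1r mnmE.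
rewrite (_ : widen_ord _ _ == ord_max = false) /=; last first.
  by apply/eqP => /(congr1 val) /= E; have := ltn_ord i; rewrite E ltnn.
rewrite expr0 alg_polyC map_polyC /= hornerC.
rewrite (_ : [multinom _ | _ < _] = U_(i)%MM); last first.
  by apply/mnmP => j; rewrite mnmE !mnm1E -!val_eqE.
by rewrite /substB mmapX mmap1U.
Qed.

Lemma ev_last k : ev (y_ (ord_max : 'I_k.+1)) = 'X.
Proof.
rewrite /ev muniE msuppX big_seq1 mcoeffX eqxx scale1r mnm1E eqxx expr1.
rewrite (_ : [multinom _ | _ < _] = 0%MM); last first.
  apply/mnmP => j; rewrite mnmE mnm1E mnm0E.
  by case: eqP => // /(congr1 val) /= E; have := ltn_ord j; rewrite -E ltnn.
by rewrite mpolyX0 scale1r map_polyX hornerX.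
Qed.

Lemma ev_Sym k F : ev (SymV k.+1 F) = substB (SymV k F).
Proof. by rewrite /ev /SymV muniC map_polyC /= hornerC. Qed.

Lemma ev_alg k c : ev (c%:A : V k.+1) = (c%:A)%:P.
Proof.
by rewrite -[in LHS]SymV_alg ev_Sym /substB mmapC [LHS]pleth_scalar.
Qed.

Lemma evZ k c (F : V k.+1) : ev (c *: F) = (c%:A)%:P * ev F.
Proof. by rewrite -[c *: F]mulr_algl rmorphM /= ev_alg. Qed.

(** The two substitutions cancel: [tau] adds (q-1) y_(k+1) to X, while [ev] subtracts (q-1) z^-1 and
    sets y_(k+1) = z^-1. *)
Lemma ev_tau k (F : V k) : ev (tau F) = F%:P.
Proof.
pose f : {rmorphism V k -> {poly V k}} := @ev k \o @tau k.
pose g : {rmorphism V k -> {poly V k}} := @polyC (V k).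
rewrite -[LHS]/(f F) -[RHS]/(g F).
apply: V_rmorph_ext => {F} [a|m|i] /=; last by rewrite tau_yo ev_yo.
  by rewrite tau_alg ev_alg.
rewrite tau_p rmorphD /= evZ rmorphXn /= ev_last ev_Sym /substB mmapC /= pleth_p.
by rewrite /alphabet_B subrK.
Qed.

HB.lock Definition Vdm k (F : V k.+1) : V k := dminus F.

Lemma dmE k (F : V k.+1) : Vdm F = - resB (ev F).
Proof. by rewrite unlock dminusE. Qed.

Lemma dm_is_linear k : linear (@Vdm k).
Proof.
move=> c F G; rewrite !dmE rmorphD /= evZ raddfD /= resB_C opprD.
by rewrite scalerN mulr_algl.
Qed.
HB.instance Definition _ k :=
  GRing.isLinear.Build Qqt (V k.+1) (V k) _ (@Vdm k) (@dm_is_linear k).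

Lemma dm_y k i (F : V k.+1) : (i < k)%N ->
  Vdm (yv k.+1 i * F) = yv k i * Vdm F.
Proof.
move=> ik; rewrite !dmE rmorphM /= -[i]/(nat_of_ord (widen_ord (leqnSn k) (Ordinal ik))).
by rewrite yvE ev_yo resB_C mulrN -yvE.
Qed.

Lemma dm_tau k a (F : V k) :
  Vdm (yv k.+1 k ^+ a * tau F) = - (eps k a.+1 * F).
Proof.
rewrite dmE rmorphM rmorphXn /= yv_last ev_last ev_tau mulrC resB_C.
rewrite -['X^a]mul1r resB_MXn size_poly1 big_ord1 coefC mul1r addn0.
by rewrite mulrC.
Qed.

Lemma dm_base k a G :
  Vdm (yv k.+1 k ^+ a * base k.+1 G) = - (eps k a.+1 * base k G).
Proof. by rewrite -tau_base dm_tau. Qed.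

(** * The operators T_i and the Hecke relations *)

HB.lock Definition Tl k i (F : V k) : V k := T_ i F.

Lemma hecke_linear_aux (A : comNzRingType) (d r y e c P Q tP tQ sP sQ : A) :
  d * tP = r * (y * P) + e * sP -> d * tQ = r * (y * Q) + e * sQ ->
  d * (c * tP + tQ) = r * (y * (c * P + Q)) + e * (c * sP + sQ).
Proof. by move=> EP EQ; rewrite mulrDr mulrCA EP EQ; ring. Qed.

Section Hecke.
Context (k i : nat) (ik : (i.+1 < k)%N).
Let a := Ordinal (ltnW ik).
Let b := Ordinal ik.

Lemma TE (P : V k) : Tl i.+1 P = hecke a b P.
Proof.
rewrite unlock /T_ /=; case: insubP => [u _ ui|]; last by rewrite ltnW.
case: insubP => [v _ vi|]; last by rewrite ik.
by congr hecke; apply: val_inj.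
Qed.

(** Multiplication by the difference of the two variables is injective, so a candidate for T_i P can
    be verified without dividing. *)
Lemma T_char (P Q : V k) :
  (yv k i.+1 - yv k i) * Q
  = cst k (q - 1) * (yv k i * P)
    + (yv k i.+1 - cst k q * yv k i) * swap a b P -> Tl i.+1 P = Q.
Proof.
rewrite -!scale_cst => E; rewrite TE.
have ab : a != b by rewrite -val_eqE /= neq_ltn leqnn.
apply: (y_sub_reg ab); rewrite /hecke; case: cid => /= R ->.
by rewrite /hecke_num -!yvE /= E.
Qed.

Lemma T_spec (P : V k) :
  (yv k i.+1 - yv k i) * Tl i.+1 P
  = cst k (q - 1) * (yv k i * P)
    + (yv k i.+1 - cst k q * yv k i) * swap a b P.
Proof.
rewrite -!scale_cst TE /hecke; case: cid => /= R E.
by rewrite (yvE b) (yvE a) E.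
Qed.


HB.instance Definition _ := GRing.RMorphism.copy (@swap k a b)
  (msym (tperm a b) : V k -> V k).

Lemma swapD P Q : swap a b (P + Q) = swap a b P + swap a b Q.
Proof. exact: (rmorphD (@swap k a b)). Qed.

Lemma swapM P Q : swap a b (P * Q) = swap a b P * swap a b Q.
Proof. exact: (rmorphM (@swap k a b)). Qed.

Lemma swap_yo j : swap a b (y_ j) = y_ (tperm a b j).
Proof. by rewrite /swap /y_ /msym mmapX mmap1U. Qed.

Lemma swap_y j (jk : (j < k)%N) : swap a b (yv k j) = yv k (tperm a b (Ordinal jk)).
Proof.
by rewrite -[j]/(nat_of_ord (Ordinal jk)) !yvE swap_yo.
Qed.

Lemma swap_Sym G : swap a b (SymV k G) = SymV k G.
Proof. by rewrite /swap /msym mmapC. Qed.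

Lemma swap_base G : swap a b (base k G) = base k G.
Proof.
apply: (@Sym_rmorph_ext _ (@swap k a b \o @base k) (@base k)) => [c|m] /=.
  by rewrite base_alg -[in LHS]SymV_alg swap_Sym SymV_alg.
rewrite base_p rmorphD /= swap_Sym scale_cst rmorphM rmorph_sum /=.
rewrite /shift_alphabet scale_cst; congr (_ + _ * _); first by rewrite cstE swap_Sym.
rewrite [RHS](reindex_inj (@perm_inj _ (tperm a b))) /=.
by under eq_bigr do rewrite rmorphXn /= swap_yo.
Qed.

Lemma T_mul_sym (f P : V k) : swap a b f = f -> Tl i.+1 (f * P) = f * Tl i.+1 P.
Proof.
move=> sf; apply: T_char; rewrite [LHS]mulrCA T_spec swapM sf; ring.
Qed.

Lemma T_linear c (P Q : V k) : Tl i.+1 (c *: P + Q) = c *: Tl i.+1 P + Tl i.+1 Q.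
Proof.
have sc : swap a b (cst k c) = cst k c by rewrite cstE swap_Sym.
rewrite ![c *: _]scale_cst; apply: T_char.
by rewrite swapD swapM sc; apply: hecke_linear_aux; apply: T_spec.
Qed.

Lemma T_one : Tl i.+1 (1 : V k) = 1.
Proof. apply: T_char; rewrite rmorph1 rmorphB rmorph1; ring. Qed.

Lemma T_sym (f : V k) : swap a b f = f -> Tl i.+1 f = f.
Proof. by move=> sf; rewrite -[f in LHS]mulr1 T_mul_sym // T_one mulr1. Qed.

Lemma T_base G : Tl i.+1 (base k G) = base k G.
Proof. exact/T_sym/swap_base. Qed.

Lemma cst1q : cst k (1 - q) = 1 - cst k q.
Proof. by rewrite rmorphB rmorph1. Qed.

Lemma cstq1 : cst k (q - 1) = cst k q - 1.
Proof. by rewrite rmorphB rmorph1. Qed.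

(** Together with [T_y2] and [T_yj], these are the Bernstein cross relations of the affine Hecke
    algebra. With [T_base] they determine T_i, and the swap is hardly needed any more. *)
Lemma T_y1 (P : V k) :
  Tl i.+1 (yv k i * P) = yv k i.+1 * Tl i.+1 P + (1 - cst k q) * (yv k i * P).
Proof.
apply: T_char; rewrite mulrDr [X in X + _]mulrCA T_spec swapM (swap_y (ltnW ik)) tpermL /=.
rewrite cstq1; ring.
Qed.

Lemma T_y2 (P : V k) :
  Tl i.+1 (yv k i.+1 * P) = yv k i * Tl i.+1 P + (cst k q - 1) * (yv k i * P).
Proof.
apply: T_char; rewrite mulrDr [X in X + _]mulrCA T_spec swapM (swap_y ik) tpermR /=.
rewrite cstq1; ring.
Qed.

Lemma T_cst c (P : V k) : Tl i.+1 (cst k c * P) = cst k c * Tl i.+1 P.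
Proof. by apply: T_mul_sym; rewrite cstE swap_Sym. Qed.

Lemma T_add (P Q : V k) : Tl i.+1 (P + Q) = Tl i.+1 P + Tl i.+1 Q.
Proof. by have := T_linear 1 P Q; rewrite !scale1r. Qed.

Lemma T_yj j (P : V k) : j != i -> j != i.+1 -> Tl i.+1 (yv k j * P) = yv k j * Tl i.+1 P.
Proof.
move=> ji ji1; case: (ltnP j k) => jk; last first.
  rewrite (yv_out jk) !mul0r; apply: T_char.
  by rewrite raddf0; ring.
apply: T_mul_sym; rewrite (swap_y jk) tpermD // -val_eqE /= eq_sym //.
Qed.
End Hecke.

Section HeckeSteps.
Context (A : comNzRingType) (r : A).

Definition is_hecke (T : A -> A) :=
  [/\ forall P Q, T (P + Q) = T P + T Q, forall P, T (r * P) = r * T P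
    & forall P, T (- P) = - T P].

(** The cross relations alone carry the quadratic relation from P to y_i P and y_(i+1) P;
    [braid_step] does the same for the braid relation. Here r stands for 1 - q, so that 1 - r is
    q. *)
Lemma quad_step (T : A -> A) (y0 y1 P : A) : is_hecke T ->
  (forall P, T (y0 * P) = y1 * T P + r * (y0 * P)) ->
  (forall P, T (y1 * P) = y0 * T P - r * (y0 * P)) ->
  T (T P) = r * T P + (1 - r) * P ->
  T (T (y0 * P)) = r * T (y0 * P) + (1 - r) * (y0 * P) /\
  T (T (y1 * P)) = r * T (y1 * P) + (1 - r) * (y1 * P).
Proof.
move=> [D C N] R0 R1 E.
by split; rewrite !(D, C, N, R0, R1) E; ring.
Qed.

Lemma braid_step (T1 T2 : A -> A) (y0 y1 y2 P : A) : is_hecke T1 -> is_hecke T2 ->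
  (forall P, T1 (y0 * P) = y1 * T1 P + r * (y0 * P)) ->
  (forall P, T1 (y1 * P) = y0 * T1 P - r * (y0 * P)) ->
  (forall P, T1 (y2 * P) = y2 * T1 P) ->
  (forall P, T2 (y1 * P) = y2 * T2 P + r * (y1 * P)) ->
  (forall P, T2 (y2 * P) = y1 * T2 P - r * (y1 * P)) ->
  (forall P, T2 (y0 * P) = y0 * T2 P) ->
  (forall P, T1 (T1 P) = r * T1 P + (1 - r) * P) ->
  (forall P, T2 (T2 P) = r * T2 P + (1 - r) * P) ->
  T1 (T2 (T1 P)) = T2 (T1 (T2 P)) ->
  [/\ T1 (T2 (T1 (y0 * P))) = T2 (T1 (T2 (y0 * P))),
      T1 (T2 (T1 (y1 * P))) = T2 (T1 (T2 (y1 * P)))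
    & T1 (T2 (T1 (y2 * P))) = T2 (T1 (T2 (y2 * P)))].
Proof.
move=> [D1 C1 N1] [D2 C2 N2] R10 R11 R12 R21 R22 R20 Q1 Q2 E.
by split; rewrite !(D1, C1, N1, D2, C2, N2, R10, R11, R12, R20, R21, R22)
  ?(Q1, Q2) E; ring.
Qed.

End HeckeSteps.

Section HeckeRelations.
Context (k : nat).
Implicit Types F : V k.

Lemma T_hecke i : (i.+1 < k)%N -> is_hecke (1 - cst k q) (@Tl k i.+1).
Proof.
move=> ik; split=> [|P|P]; first exact: T_add.
  by rewrite -cst1q (T_cst ik).
by have := T_cst ik (-1) P; rewrite rmorphN rmorph1 !mulN1r.
Qed.

Lemma T_y2' i (ik : (i.+1 < k)%N) F :
  Tl i.+1 (yv k i.+1 * F) = yv k i * Tl i.+1 F - (1 - cst k q) * (yv k i * F).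
Proof. by rewrite (T_y2 ik) -mulNr opprB. Qed.

Lemma T_quad i F : (i.+1 < k)%N ->
  Tl i.+1 (Tl i.+1 F) = (1 - cst k q) * Tl i.+1 F + (1 - (1 - cst k q)) * F.
Proof.
move=> ik; elim/base_ind: F => [G|F G HF HG|j F jk HF].
- by rewrite !(T_base ik) -mulrDl addrC subrK mul1r.
- by rewrite !(T_add ik) HF HG; ring.
have [H1 H2] := quad_step (T_hecke ik) (T_y1 ik) (T_y2' ik) HF.
case: (eqVneq j i) => [->|ji]; first exact: H1.
case: (eqVneq j i.+1) => [->|ji1]; first exact: H2.
by rewrite !(T_yj ik _ ji ji1) HF; ring.
Qed.

Lemma T_braid i F : (i.+2 < k)%N ->
  Tl i.+1 (Tl i.+2 (Tl i.+1 F)) = Tl i.+2 (Tl i.+1 (Tl i.+2 F)).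
Proof.
move=> i2k; have ik := ltnW i2k.
elim/base_ind: F => [G|F G HF HG|j F jk HF].
- by rewrite !(T_base ik, T_base i2k).
- by rewrite !(T_add ik, T_add i2k) HF HG.
have [||H0 H1 H2] := braid_step (T_hecke ik) (T_hecke i2k) (T_y1 ik) (T_y2' ik)
  _ (T_y1 i2k) (T_y2' i2k) _ (fun P => T_quad P ik) (fun P => T_quad P i2k) HF.
- by move=> P; rewrite (T_yj ik) // neq_ltn ?ltnSn ?(ltn_trans (ltnSn i)) ?orbT.
- by move=> P; rewrite (T_yj i2k) // neq_ltn ?ltnSn ?(ltn_trans (ltnSn i)).
case: (eqVneq j i) => [->|ji]; first exact: H0.
case: (eqVneq j i.+1) => [->|ji1]; first exact: H1.
case: (eqVneq j i.+2) => [->|ji2]; first exact: H2.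
by rewrite !(T_yj ik _ ji ji1, T_yj i2k _ ji1 ji2) HF.
Qed.

Lemma T_far_lt i j F : (i.+1 < k)%N -> (j.+1 < k)%N -> (i.+1 < j)%N ->
  Tl i.+1 (Tl j.+1 F) = Tl j.+1 (Tl i.+1 F).
Proof.
move=> ik jk ij; elim/base_ind: F => [G|F G HF HG|l F lk HF].
- by rewrite !(T_base ik, T_base jk).
- by rewrite !(T_add ik, T_add jk) HF HG.
have lt_neq a b : (a < b)%N -> (a != b) /\ (b != a).
  by move=> ab; rewrite !neq_ltn ab orbT.
have [n1 n1'] := lt_neq _ _ ij; have [n2 n2'] := lt_neq _ _ (ltnW ij).
have [n3 n3'] := lt_neq _ _ (ltn_trans ij (ltnSn j)).
have [n4 n4'] := lt_neq _ _ (ltn_trans (ltnSn i) (ltn_trans ij (ltnSn j))).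
have Ti0 F1 := T_yj ik F1 n2' n1'; have Ti1 F1 := T_yj ik F1 n4' n3'.
have Tj0 F1 := T_yj jk F1 n2 n4; have Tj1 F1 := T_yj jk F1 n1 n3.
case: (eqVneq l i) => [->|li].
  by rewrite Tj0 !(T_y1 ik) (T_add jk) -cst1q (T_cst jk) Tj0 Tj1 HF.
case: (eqVneq l i.+1) => [->|li1].
  by rewrite Tj1 !(T_y2 ik) (T_add jk) -cstq1 (T_cst jk) !Tj0 HF.
case: (eqVneq l j) => [->|lj].
  by rewrite Ti0 !(T_y1 jk) (T_add ik) -cst1q (T_cst ik) Ti0 Ti1 HF.
case: (eqVneq l j.+1) => [->|lj1].
  by rewrite Ti1 !(T_y2 jk) (T_add ik) -cstq1 (T_cst ik) !Ti0 HF.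
by rewrite !(T_yj ik _ li li1, T_yj jk _ lj lj1) HF.
Qed.

End HeckeRelations.

(** * Products T_1 ... T_m, and the relations of T_i with d_+ and d_- *)

Lemma foldr_iotaSr (M : Type) (A : nat -> M -> M) x s m :
  foldr A x (iota s m.+1) = foldr A (A (s + m)%N x) (iota s m).
Proof. by rewrite -addn1 iotaD foldr_cat. Qed.

Lemma foldr_comm (M N : Type) (f : M -> N) (A : nat -> M -> M) (B : nat -> N -> N) x r :
  (forall i y, i \in r -> f (A i y) = B i (f y)) -> f (foldr A x r) = foldr B (f x) r.
Proof.
elim: r => //= i r IH fAB; rewrite fAB ?mem_head // IH // => j y jr.
by apply: fAB; rewrite inE jr orbT.
Qed.

Lemma foldr_iotaS (M : Type) (A : nat -> M -> M) x s m :
  foldr (fun i => A i.+1) x (iota s m) = foldr A x (iota s.+1 m).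
Proof. by elim: m s => //= m IH s; rewrite IH. Qed.

(** In A_1 ... A_m T_i, the factor T_i first passes every A_j with j > i+1, becomes T_(i+1) on
    crossing A_i A_(i+1), and then passes the rest. *)
Lemma chain_shift (M : Type) (A T : nat -> M -> M) n :
  (forall i x, (0 < i)%N -> (i.+1 < n)%N ->
     A i (A i.+1 (T i x)) = T i.+1 (A i (A i.+1 x))) ->
  (forall i j x, (0 < i < n)%N -> (0 < j < n)%N -> (i.+1 < j)%N || (j.+1 < i)%N ->
     A i (T j x) = T j (A i x)) ->
  forall m i x, (0 < i)%N -> (i < m)%N -> (m < n)%N ->
    foldr A (T i x) (iota 1 m) = T i.+1 (foldr A x (iota 1 m)).
Proof.
move=> AAT AT; elim=> // m IH i x i0; rewrite ltnS leq_eqVlt => /predU1P[im|im] mn.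
  subst i; case: m mn i0 {IH} => // m mn i0.
  rewrite !foldr_iotaSr !add1n AAT //; symmetry; apply: foldr_comm => j y.
  rewrite mem_iota add1n => /andP[j0 jm]; rewrite AT //.
  - by rewrite j0 (ltn_trans jm) // ltnW.
  - by rewrite ltnS jm.
have mn' := ltnW mn; have i_n := ltn_trans im mn'.
by rewrite !foldr_iotaSr add1n AT ?IH ?mn ?i0 ?i_n ?ltnS ?im ?orbT.
Qed.

(* With C = T_1 ... T_(m+1), both sides are C C x. *)
Lemma chain_chain (M : Type) (T : nat -> M -> M) n :
  (forall i x, (0 < i)%N -> (i.+1 < n)%N ->
     T i (T i.+1 (T i x)) = T i.+1 (T i (T i.+1 x))) ->
  (forall i j x, (0 < i < n)%N -> (0 < j < n)%N -> (i.+1 < j)%N || (j.+1 < i)%N ->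
     T i (T j x) = T j (T i x)) ->
  forall m x, (m.+1 < n)%N ->
    T 1 (foldr T (foldr T x (iota 1 m)) (iota 1 m.+1))
    = foldr T (foldr T (T m.+1 x) (iota 1 m)) (iota 1 m.+1).
Proof.
move=> TTT TT m x mn; set C := fun y => foldr T y (iota 1 m.+1).
have -> : foldr T (foldr T x (iota 1 m)) (iota 1 m.+1)
    = foldr (fun i => T i.+1) (C x) (iota 1 m).
  apply: (@foldr_comm _ _ C) => i y; rewrite mem_iota add1n => /andP[i0 im].
  exact: (chain_shift TTT TT).
rewrite -(add1n m) -foldr_iotaSr foldr_iotaS -/(C _).
by rewrite -[RHS]/(C (C x)).
Qed.

Lemma tau_T k i (F : V k) : (i.+1 < k)%N -> tau (Tl i.+1 F) = Tl i.+1 (tau F).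
Proof.
move=> ik; have ik1 : (i.+1 < k.+1)%N := leqW ik.
elim/base_ind: F => [G|F G HF HG|j F jk HF].
- by rewrite (T_base ik) tau_base (T_base ik1).
- by rewrite (T_add ik) !rmorphD /= (T_add ik1) HF HG.
have tc : tau (cst k q) = cst k.+1 q by rewrite !cstE tau_Sym pleth_scalar SymV_alg.
rewrite rmorphM /= (tau_y jk).
case: (eqVneq j i) => [->|ji].
  rewrite (T_y1 ik) (T_y1 ik1) -HF rmorphD !rmorphM rmorphB rmorph1 /= tc.
  by rewrite (tau_y ik) (tau_y (ltnW ik)).
case: (eqVneq j i.+1) => [->|ji1].
  rewrite (T_y2 ik) (T_y2 ik1) -HF rmorphD !rmorphM rmorphB rmorph1 /= tc.
  by rewrite (tau_y (ltnW ik)).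
by rewrite (T_yj ik _ ji ji1) (T_yj ik1 _ ji ji1) -HF rmorphM /= (tau_y jk).
Qed.

(** The element F[X + (q-1)(y_(k+1) + y_(k+2))] is symmetric in the two new variables. *)
Lemma T_tau_tau k (F : V k) : Tl k.+1 (tau (tau F)) = tau (tau F).
Proof.
have kk := ltnSn k.+1.
elim/base_ind: F => [G|F G HF HG|j F jk HF].
- by rewrite !tau_base (T_base kk).
- by rewrite !rmorphD /= (T_add kk) HF HG.
rewrite !rmorphM /= !tau_y ?(leqW jk) // (T_yj kk) ?HF //.
- by rewrite neq_ltn jk.
- by rewrite neq_ltn (leqW jk).
Qed.

Lemma T_mulXn k i j a (F : V k) : (i.+1 < k)%N -> j != i -> j != i.+1 ->
  Tl i.+1 (yv k j ^+ a * F) = yv k j ^+ a * Tl i.+1 F.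
Proof.
move=> ik ji ji1; elim: a => [|a IH]; first by rewrite !mul1r.
by rewrite !exprS -!mulrA (T_yj ik _ ji ji1) IH.
Qed.

Lemma dm_add k (F G : V k.+1) : Vdm (F + G) = Vdm F + Vdm G.
Proof. exact: raddfD. Qed.

Lemma dm_cst k c (F : V k.+1) : Vdm (cst k.+1 c * F) = cst k c * Vdm F.
Proof. by rewrite -!scale_cst; apply: linearZ. Qed.

Lemma dm_T k i (F : V k.+1) : (i.+1 < k)%N -> Tl i.+1 (Vdm F) = Vdm (Tl i.+1 F).
Proof.
move=> ik; have ik1 : (i.+1 < k.+1)%N := leqW ik.
elim/base_ind_last: F => [a G|F G HF HG|j F jk HF].
- rewrite (T_mulXn _ _ ik1) ?neq_ltn ?ik ?(ltnW ik) ?orbT // (T_base ik1) dm_base.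
  have sE : swap (Ordinal (ltnW ik)) (Ordinal ik) (eps k a.+1 * base k G)
     = eps k a.+1 * base k G.
    by rewrite swapM swap_base [@eps]unlock swap_Sym.
  by have [_ _ N] := T_hecke ik; rewrite N (T_sym sE).
- by rewrite (T_add ik1) !dm_add (T_add ik) HF HG.
rewrite (dm_y _ jk).
case: (eqVneq j i) => [->|ji].
  by rewrite (T_y1 ik) (T_y1 ik1) HF dm_add (dm_y _ ik) -!cst1q dm_cst (dm_y _ (ltnW ik)).
case: (eqVneq j i.+1) => [->|ji1].
  by rewrite (T_y2 ik) (T_y2 ik1) HF dm_add -!cstq1 dm_cst !(dm_y _ (ltnW ik)).
by rewrite (T_yj ik _ ji ji1) (T_yj ik1 _ ji ji1) HF dm_y.
Qed.

Lemma T_exp k i a (F : V k) : (i.+1 < k)%N -> Tl i.+1 (yv k i ^+ a * F)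
  = yv k i.+1 ^+ a * Tl i.+1 F
    + (1 - cst k q) * \sum_(j < a) yv k i.+1 ^+ j * (yv k i ^+ (a - j) * F).
Proof.
move=> ik; elim: a => [|a IH]; first by rewrite !mul1r big_ord0 mulr0 addr0.
rewrite exprS -mulrA (T_y1 ik) IH big_ord_recl expr0 mul1r subn0.
rewrite [X in _ = _ + _ * (_ + X)](eq_bigr (fun j : 'I_a => yv k i.+1 *
  (yv k i.+1 ^+ j * (yv k i ^+ (a - j) * F)))) => [|j _]; last first.
  by rewrite lift0 exprS subSS -!mulrA.
rewrite -mulr_sumr !exprS; ring.
Qed.

Lemma dm_sum k n (f : 'I_n -> V k.+1) : Vdm (\sum_i f i) = \sum_i Vdm (f i).
Proof. exact: raddf_sum. Qed.

Lemma dm_mulXn k i a (F : V k.+1) : (i < k)%N ->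
  Vdm (yv k.+1 i ^+ a * F) = yv k i ^+ a * Vdm F.
Proof.
move=> ik; elim: a => [|a IH]; first by rewrite !mul1r.
by rewrite !exprS -!mulrA (dm_y _ ik) IH.
Qed.

(** The commutator of d_+ and d_- before T_1 ... T_k is applied. On y_(k+1)^a [base], [eps_tau_sum]
    expands the first term and [T_exp] the second into sums that differ by an index shift; what
    survives is the term of [eps] 0 = 1. *)
Lemma tau_dm_sub k (F : V k.+1) :
  tau (Vdm F) - Vdm (Tl k.+1 (tau F)) = (cst k.+1 q - 1) * (yv k.+1 k * F).
Proof.
have kk := ltnSn k.+1; have kk1 := ltnSn k.
elim/base_ind_last: F => [a G|F G HF HG|j F jk HF].
- rewrite dm_base rmorphN rmorphM /= tau_base eps_tau_sum rmorphM rmorphXn /=.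
  rewrite (tau_y kk1) tau_base (T_exp _ _ kk) (T_base kk) dm_add dm_base -cst1q dm_cst.
  rewrite dm_sum (eq_bigr (fun j : 'I_a => - (eps k.+1 j.+1 * yv k.+1 k ^+ (a - j)) *
     base k.+1 G)); last first.
    move=> j _; rewrite [X in Vdm X]mulrCA (dm_mulXn _ _ kk1) dm_base; ring.
  rewrite -mulr_suml sumrN big_ord_recl eps0 subn0 scale_cst cst1q /=.
  rewrite (eq_bigr (fun j : 'I_a => eps k.+1 j.+1 * yv k.+1 k ^+ (a - j))) //.
  rewrite exprS; ring.
- rewrite dm_add !rmorphD /= (T_add kk) dm_add !mulrDr -HF -HG; ring.
rewrite (dm_y _ jk) !rmorphM /= (tau_y jk) (tau_y (leqW jk)) (T_yj kk) ?neq_ltn ?jk ?(leqW jk) //.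
rewrite (dm_y _ (leqW jk)) -mulrBr HF; ring.
Qed.

Lemma hecke_sub_aux (A : comNzRingType) (Q y0 y1 F sF TF h : A) :
  (y1 - y0) * TF = (Q - 1) * (y0 * F) + (y1 - Q * y0) * sF ->
  F - sF = (y1 - y0) * h ->
  (y1 - y0) * (TF - F) = (y1 - y0) * ((Q * y0 - y1) * h).
Proof.
move=> E1 E2; rewrite mulrBr E1 [RHS]mulrCA -E2; ring.
Qed.

(** The witness h is the divided difference (F - s F)/(y_(k+2) - y_(k+1)); it is symmetric because s
    changes the sign of both numerator and denominator. *)
Lemma T_sub k (kk : (k.+1 < k.+2)%N) (F : V k.+2) : exists2 h,
  swap (Ordinal (ltnW kk)) (Ordinal kk) h = h
  & Tl k.+1 F - F = (cst k.+2 q * yv k.+2 k - yv k.+2 k.+1) * h.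
Proof.
set sw := swap _ _.
have [h hE] := swap_div (Ordinal (ltnW kk)) (Ordinal kk) F.
have ab : Ordinal (ltnW kk) != Ordinal kk by rewrite -val_eqE /= neq_ltn leqnn.
have reg := y_sub_reg ab; move: hE reg; rewrite -!yvE /= => hE reg.
have sy : sw (yv k.+2 k.+1 - yv k.+2 k) = - (yv k.+2 k.+1 - yv k.+2 k).
  rewrite /sw swapD -[- yv _ _]mulN1r swapM (swap_y _ kk) (swap_y _ (ltnW kk)).
  rewrite tpermL tpermR /= -[-1](rmorphN1 (@SymV k.+2)) swap_Sym rmorphN1; ring.
have ss H : sw (sw H) = H.
  by rewrite /sw /swap -[LHS]/((msym _ \o msym _) _) /= -msymMm tperm2 msym1m.
exists h; apply: reg.
  apply: oppr_inj; rewrite -[X in _ = - X]hE -mulNr -sy -swapM -hE /sw.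
  rewrite swapD -[- swap _ _ F]mulN1r swapM.
  rewrite -[-1](rmorphN1 (@SymV k.+2)) swap_Sym rmorphN1 -/sw ss; ring.
apply: hecke_sub_aux hE; rewrite -cstq1; apply: T_spec.
Qed.

Lemma dm_dm_base k c d G :
  Vdm (Vdm ((cst k.+2 q * yv k.+2 k - yv k.+2 k.+1)
    * (yv k.+2 k ^+ c * (yv k.+2 k.+1 ^+ d * base k.+2 G))))
  = (eps k c.+2 * eps k d.+1 - eps k c.+1 * eps k d.+2) * base k G.
Proof.
have kk := ltnSn k.
have -> : (cst k.+2 q * yv k.+2 k - yv k.+2 k.+1)
    * (yv k.+2 k ^+ c * (yv k.+2 k.+1 ^+ d * base k.+2 G))
  = cst k.+2 q * (yv k.+2 k ^+ c.+1 * (yv k.+2 k.+1 ^+ d * base k.+2 G))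
    + cst k.+2 (-1) * (yv k.+2 k ^+ c * (yv k.+2 k.+1 ^+ d.+1 * base k.+2 G)).
  by rewrite rmorphN1 !exprS; ring.
rewrite dm_add (dm_cst q) (dm_cst (-1)) (dm_mulXn c.+1 _ kk) (dm_mulXn c _ kk) (dm_base _ d G).
rewrite (dm_base _ d.+1 G) rmorphN1.
(* By [tau_eps], [eps] (d+2) - q y [eps] (d+1) equals the same difference of images of [tau] with q
   replaced by 1. This is the form on which the second d_- is given by [dm_tau]. *)
have -> : cst k.+1 q * (yv k.+1 k ^+ c.+1 * - (eps k.+1 d.+1 * base k.+1 G))
    + -1 * (yv k.+1 k ^+ c * - (eps k.+1 d.+2 * base k.+1 G))
  = yv k.+1 k ^+ c * tau (eps k d.+2 * base k G)
    + cst k.+1 (-1) * (yv k.+1 k ^+ c.+1 * tau (eps k d.+1 * base k G)).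
  rewrite rmorphN1 !rmorphM /= tau_base.
  have := tau_eps k d.+1; rewrite scale_cst => /(canRL (subrK _)) ->.
  by rewrite exprS; ring.
rewrite dm_add dm_cst (dm_tau c) (dm_tau c.+1) rmorphN1; ring.
Qed.

(* The image of T - 1 is (q y_k - y_(k+1)) times the functions symmetric in y_k
   and y_(k+1), and d_-^2 ((q y_k - y_(k+1)) h) is antisymmetric in h. *)
Lemma dm_dm_T k (F : V k.+2) : Vdm (Vdm (Tl k.+1 F)) = Vdm (Vdm F).
Proof.
have kk := ltnSn k.+1; have kk1 := ltnSn k.
have [h hs hE] := T_sub kk F; set sw := swap _ _ in hs.
pose Phi (h : V k.+2) := Vdm (Vdm ((cst k.+2 q * yv k.+2 k - yv k.+2 k.+1) * h)).
have PhiD h1 h2 : Phi (h1 + h2) = Phi h1 + Phi h2.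
  by rewrite /Phi mulrDr !dm_add.
have PhiM i x : (i < k)%N -> Phi (yv k.+2 i * x) = yv k i * Phi x.
  by move=> ik; rewrite /Phi mulrCA (dm_y _ (leqW ik)) (dm_y _ ik).
have PhiG c d G : Phi (yv k.+2 k ^+ c * (yv k.+2 k.+1 ^+ d * base k.+2 G))
  = (eps k c.+2 * eps k d.+1 - eps k c.+1 * eps k d.+2) * base k G := dm_dm_base k c d G.
have swD : {morph sw : x y / x + y} := fun x y => swapD _ x y.
have swM : {morph sw : x y / x * y} := fun x y => swapM _ x y.
have swG G : sw (base k.+2 G) = base k.+2 G := swap_base _ G.
have sw1 : sw 1 = 1 by rewrite -(rmorph1 (@SymV k.+2)) /sw swap_Sym.
have sw_k : sw (yv k.+2 k) = yv k.+2 k.+1.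
  by rewrite /sw (swap_y _ (ltnW kk)) tpermL.
have sw_k1 : sw (yv k.+2 k.+1) = yv k.+2 k.
  by rewrite /sw (swap_y _ kk) tpermR.
have sw_i i : (i < k)%N -> sw (yv k.+2 i) = yv k.+2 i.
  move=> ik; rewrite /sw (swap_y _ (leqW (leqW ik))) tpermD // -val_eqE /=.
    by rewrite neq_ltn ik orbT.
  by rewrite neq_ltn (leqW ik) orbT.
have hE' : Vdm (Vdm (Tl k.+1 F - F)) = Phi h by rewrite hE.
clearbody Phi sw; clear hE.
(* The exponents c and d are kept general because [Phi] commutes only with the first k variables: a
   factor of one of the last two is absorbed in an exponent. The base case is the antisymmetry of
   [PhiG] in c and d. *)
have PhiN : forall h c d,
    Phi (sw (yv k.+2 k ^+ c * (yv k.+2 k.+1 ^+ d * h)))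
    = - Phi (yv k.+2 k ^+ c * (yv k.+2 k.+1 ^+ d * h)).
  have swX a b H : sw (yv k.+2 k ^+ a * (yv k.+2 k.+1 ^+ b * H)) =
      yv k.+2 k ^+ b * (yv k.+2 k.+1 ^+ a * sw H).
    have swXn x n : sw (x ^+ n) = sw x ^+ n.
      by elim: n => [|n IH]; rewrite ?expr0 // !exprS swM IH.
    by rewrite !swM !swXn sw_k sw_k1 mulrCA.
  elim/base_ind => {h hs hE'} [G c d|h1 h2 H1 H2 c d|i h ik H c d].
  - rewrite swX swG (PhiG c d) (PhiG d c); ring.
  - by rewrite !mulrDr swD !PhiD H1 H2 opprD.
  move: ik; rewrite ltnS leq_eqVlt => /predU1P[->|].
    have -> : yv k.+2 k ^+ c * (yv k.+2 k.+1 ^+ d * (yv k.+2 k.+1 * h))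
      = yv k.+2 k ^+ c * (yv k.+2 k.+1 ^+ d.+1 * h) by rewrite exprS; ring.
    exact: H.
  rewrite ltnS leq_eqVlt => /predU1P[->|ik].
    have -> : yv k.+2 k ^+ c * (yv k.+2 k.+1 ^+ d * (yv k.+2 k * h))
      = yv k.+2 k ^+ c.+1 * (yv k.+2 k.+1 ^+ d * h) by rewrite exprS; ring.
    exact: H.
  have -> : yv k.+2 k ^+ c * (yv k.+2 k.+1 ^+ d * (yv k.+2 i * h))
      = yv k.+2 i * (yv k.+2 k ^+ c * (yv k.+2 k.+1 ^+ d * h)) by ring.
  by rewrite swM (sw_i _ ik) (PhiM _ _ ik) (PhiM _ _ ik) H mulrN.
have Phi0 : Phi h = 0.
  apply: (@algQqt_regular (V k) 1%N); rewrite mul0rn mulr2n.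
  have := PhiN h 0%N 0%N; rewrite !expr0 !mul1r hs => {1}->.
  by rewrite addNr.
apply/eqP; rewrite -subr_eq0 -raddfB /= -raddfB /=; apply/eqP.
by rewrite hE'.
Qed.

(** A module over the algebra seen vertex by vertex. The quadratic relation is expanded, and k is
    shifted by one or two where needed for d_- to be defined. It has two instances below, V_k and
    e_k A e_0. *)
Record dyck_module (M : nat -> lmodType Qqt) (T : forall k, nat -> M k -> M k)
    (dp : forall k, M k -> M k.+1) (dm : forall k, M k.+1 -> M k) : Prop :=
  DyckModule {
    dyck_T_linear : forall k i, (0 < i < k)%N -> linear (@T k i);
    dyck_dp_linear : forall k, linear (@dp k);
    dyck_dm_linear : forall k, linear (@dm k);
    dyck_quad : forall k i (x : M k), (0 < i < k)%N ->
      T k i (T k i x) = (1 - q) *: T k i x + q *: x;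
    dyck_braid : forall k i (x : M k), (0 < i)%N -> (i.+1 < k)%N ->
      T k i (T k i.+1 (T k i x)) = T k i.+1 (T k i (T k i.+1 x));
    dyck_far : forall k i j (x : M k), (0 < i < k)%N -> (0 < j < k)%N ->
      (i.+1 < j)%N || (j.+1 < i)%N -> T k i (T k j x) = T k j (T k i x);
    dyck_T_dm : forall k i (x : M k.+1), (0 < i < k)%N ->
      T k i (dm k x) = dm k (T k.+1 i x);
    dyck_dp_T : forall k i (x : M k), (0 < i < k)%N ->
      dp k (T k i x) = T k.+1 i.+1 (dp k x);
    dyck_T_dp_dp : forall k (x : M k), T _ 1 (dp _ (dp _ x)) = dp _ (dp _ x);
    dyck_dm_dm_T : forall k (x : M k.+2), dm _ (dm _ (T _ k.+1 x)) = dm _ (dm _ x);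
    dyck_comm_dm : forall k (x : M k.+2),
      dm _ (dp _ (dm _ (T _ k.+1 x))) - dm _ (dm _ (dp _ (T _ k.+1 x)))
      = q *: (dp _ (dm _ (dm _ x)) - dm _ (dp _ (dm _ x)));
    dyck_comm_dp : forall k (x : M k.+1),
      T _ 1 (dp _ (dm _ (dp _ x))) - T _ 1 (dm _ (dp _ (dp _ x)))
      = q *: (dp _ (dp _ (dm _ x)) - dp _ (dm _ (dp _ x))) }.

(** * d_+, and its commutator with d_- *)

HB.lock Definition Vdp k (F : V k) : V k.+1 := foldr (@Tl k.+1) (tau F) (iota 1 k).

Lemma dpE k (F : V k) : Vdp F = foldr (@Tl k.+1) (tau F) (iota 1 k).
Proof. by rewrite unlock. Qed.

(* q T_i^-1 *)
Definition Ul k i (F : V k) : V k := Tl i F + (cst k q - 1) * F.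

Lemma Tl_quad k i (F : V k) : (0 < i < k)%N ->
  Tl i (Tl i F) = (1 - cst k q) * Tl i F + cst k q * F.
Proof. by case: i => // i ik; rewrite T_quad // subKr. Qed.

Lemma Tl_braid k i (F : V k) : (0 < i)%N -> (i.+1 < k)%N ->
  Tl i (Tl i.+1 (Tl i F)) = Tl i.+1 (Tl i (Tl i.+1 F)).
Proof. by case: i => // i _ ik; rewrite T_braid. Qed.

Lemma Tl_far k i j (F : V k) : (0 < i < k)%N -> (0 < j < k)%N ->
  (i.+1 < j)%N || (j.+1 < i)%N -> Tl i (Tl j F) = Tl j (Tl i F).
Proof.
case: i j => [|i] [|j] //= ik jk /orP[ij|ij]; first by rewrite T_far_lt.
by rewrite -T_far_lt.
Qed.

Lemma Tl_add k i (F G : V k) : (0 < i < k)%N -> Tl i (F + G) = Tl i F + Tl i G.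
Proof. by case: i => // i ik; rewrite T_add. Qed.

Lemma Tl_cst k i c (F : V k) : (0 < i < k)%N -> Tl i (cst k c * F) = cst k c * Tl i F.
Proof. by case: i => // i ik; rewrite T_cst. Qed.

Lemma Ul_Tl k i (F : V k) : (0 < i < k)%N -> Ul i (Tl i F) = cst k q * F.
Proof. by move=> ik; rewrite /Ul Tl_quad //; ring. Qed.

Lemma Ul_cst k i c (F : V k) : (0 < i < k)%N -> Ul i (cst k c * F) = cst k c * Ul i F.
Proof. by move=> ik; rewrite /Ul Tl_cst //; ring. Qed.

Lemma dm_Ul k i (F : V k.+1) : (0 < i < k)%N -> Vdm (Ul i F) = Ul i (Vdm F).
Proof.
case: i => // i ik; rewrite /Ul dm_add -dm_T //; congr (_ + _).
by rewrite -!cstq1 dm_cst.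
Qed.

Lemma Tl_chain k m i (F : V k) : (0 < i)%N -> (i < m)%N -> (m < k)%N ->
  foldr (@Tl k) (Tl i F) (iota 1 m) = Tl i.+1 (foldr (@Tl k) F (iota 1 m)).
Proof.
by apply: chain_shift => [i' x|i' j x]; [exact: Tl_braid | exact: Tl_far].
Qed.

Lemma dp_Tl k i (F : V k) : (0 < i < k)%N -> Vdp (Tl i F) = Tl i.+1 (Vdp F).
Proof.
move=> /andP[i0 ik]; rewrite !dpE -Tl_chain //; congr foldr.
by case: i i0 ik => // i _ ik; rewrite tau_T.
Qed.

Lemma dp_add k (F G : V k) : Vdp (F + G) = Vdp F + Vdp G.
Proof.
rewrite !dpE rmorphD /=; have : {subset iota 1 k <= iota 1 k} by [].
elim: {1 3 4 5}(iota 1 k) => //= i r IH sr.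
rewrite IH => [|j jr]; last by rewrite sr // inE jr orbT.
rewrite Tl_add //; have := sr i (mem_head _ _).
by rewrite mem_iota add1n.
Qed.

Lemma foldrTl_cst k n m c (F : V k) : (0 < n)%N -> (n + m <= k)%N ->
  foldr (@Tl k) (cst k c * F) (iota n m) = cst k c * foldr (@Tl k) F (iota n m).
Proof.
move=> n0 nm; symmetry; apply: (foldr_comm (f := fun x => cst k c * x)) => i y.
rewrite mem_iota => /andP[ni im]; rewrite Tl_cst //.
by rewrite (leq_trans n0) ?(leq_trans im).
Qed.

Lemma tau_cst k c : tau (cst k c) = cst k.+1 c.
Proof. by rewrite !cstE tau_Sym pleth_scalar SymV_alg. Qed.

Lemma dp_cst k c (F : V k) : Vdp (cst k c * F) = cst k.+1 c * Vdp F.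
Proof. by rewrite !dpE rmorphM /= tau_cst foldrTl_cst. Qed.

Lemma dp_sub k (F G : V k) : Vdp (F - G) = Vdp F - Vdp G.
Proof.
by rewrite dp_add; have := dp_cst (-1) G; rewrite !rmorphN1 !mulN1r => ->.
Qed.

Lemma dp_Ul k i (F : V k) : (0 < i < k)%N -> Vdp (Ul i F) = Ul i.+1 (Vdp F).
Proof.
move=> ik; rewrite /Ul dp_add (dp_Tl _ ik); congr (_ + _).
by rewrite -!cstq1 dp_cst.
Qed.

(** Here d_+^2 is T_1 ... T_(k+1) T_1 ... T_k applied to [tau (tau F)]. By [chain_chain] a T_1 on
    the left becomes a T_(k+1) on the right, where it is absorbed by [T_tau_tau]. *)
Lemma Tl_dp_dp k (F : V k) : Tl 1 (Vdp (Vdp F)) = Vdp (Vdp F).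
Proof.
have tC : tau (foldr (@Tl k.+1) (tau F) (iota 1 k))
    = foldr (@Tl k.+2) (tau (tau F)) (iota 1 k).
  apply: foldr_comm => -[|i] y; rewrite mem_iota add1n //= => ik.
  by rewrite tau_T.
rewrite !dpE tC (@chain_chain _ _ k.+2) // ?T_tau_tau //; first exact: Tl_braid.
exact: Tl_far.
Qed.

(** Each step is T_i y_(i+1) = y_i (q T_i^-1), which is [T_y2]. *)
Lemma foldrTl_y k m (F : V k) : (m < k)%N ->
  foldr (@Tl k) (yv k m * F) (iota 1 m) = yv k 0 * foldr (@Ul k) F (iota 1 m).
Proof.
elim: m F => // m IH F mk; rewrite !foldr_iotaSr add1n (T_y2 mk).
by rewrite mulrCA -mulrDr IH // ltnW.
Qed.

Lemma foldrTl_sub k m (F G : V k) : (m < k)%N ->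
  foldr (@Tl k) (F - G) (iota 1 m)
  = foldr (@Tl k) F (iota 1 m) - foldr (@Tl k) G (iota 1 m).
Proof.
elim: m F G => // m IH F G mk; rewrite !foldr_iotaSr add1n -IH ?(ltnW mk) //.
by congr foldr; rewrite (T_add mk); have [_ _ ->] := T_hecke mk.
Qed.

(** Since d_- commutes with T_1, ..., T_k, both terms are T_1 ... T_k applied to the terms of
    [tau_dm_sub], and [foldrTl_y] carries y_(k+1) to the left. *)
Lemma dp_dm_comm k (F : V k.+1) : Vdp (Vdm F) - Vdm (Vdp F)
  = (cst k.+1 q - 1) * (yv k.+1 0 * foldr (@Ul k.+1) F (iota 1 k)).
Proof.
rewrite !dpE foldr_iotaSr add1n.
have -> : Vdm (foldr (@Tl k.+2) (Tl k.+1 (tau F)) (iota 1 k))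
    = foldr (@Tl k.+1) (Vdm (Tl k.+1 (tau F))) (iota 1 k).
  apply: foldr_comm => -[|i] y; rewrite mem_iota add1n //= => ik.
  by rewrite dm_T.
rewrite -foldrTl_sub // tau_dm_sub -cstq1 foldrTl_cst // cstq1; congr (_ * _).
by rewrite foldrTl_y.
Qed.

Lemma Tl_y_far k i (F : V k) : (1 < i < k)%N -> Tl i (yv k 0 * F) = yv k 0 * Tl i F.
Proof. by case: i => [|[|i]] //= ik; rewrite (T_yj ik). Qed.

(** That is, d_+ y_1 = T_1 y_1 T_1^-1 d_+: in T_1 ... T_(k+1) only T_1 fails to commute with y_1. *)
Lemma dp_y k (F : V k.+1) : cst k.+2 q * Vdp (yv k.+1 0 * F)
  = Tl 1 (yv k.+2 0 * Ul 1 (Vdp F)).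
Proof.
rewrite !dpE rmorphM /= tau_y //.
have -> : foldr (@Tl k.+2) (yv k.+2 0 * tau F) (iota 2 k)
    = yv k.+2 0 * foldr (@Tl k.+2) (tau F) (iota 2 k).
  symmetry; apply: (foldr_comm (f := fun x => yv k.+2 0 * x)) => i y.
  rewrite mem_iota => /andP[i2 ik]; rewrite Tl_y_far //.
  by rewrite i2 /= (leq_trans ik).
by rewrite Ul_Tl // mulrCA Tl_cst.
Qed.

(** By [dp_dm_comm] both sides are q (q-1) y_1 U_1 ... U_k d_- F: the last factor U_(k+1) on the
    left meets T_(k+1) and gives q. *)
Lemma V_comm_dm k (F : V k.+2) :
  Vdm (Vdp (Vdm (Tl k.+1 F)) - Vdm (Vdp (Tl k.+1 F)))
  = cst k.+1 q * (Vdp (Vdm (Vdm F)) - Vdm (Vdp (Vdm F))).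
Proof.
rewrite !dp_dm_comm -!cstq1 dm_cst mulrCA; congr (_ * _).
rewrite dm_y // foldr_iotaSr add1n Ul_Tl ?ltnSn // [RHS]mulrCA; congr (_ * _).
have -> : foldr (@Ul k.+2) (cst k.+2 q * F) (iota 1 k)
    = cst k.+2 q * foldr (@Ul k.+2) F (iota 1 k).
  symmetry; apply: (foldr_comm (f := fun x => cst k.+2 q * x)) => i y.
  rewrite mem_iota => /andP[i2 ik]; rewrite Ul_cst // i2 /=.
  by rewrite (leq_trans ik) // add1n.
rewrite dm_cst; congr (_ * _); apply: foldr_comm => i y.
by rewrite mem_iota add1n => ik; rewrite dm_Ul.
Qed.

(** By [dp_dm_comm] and [dp_y] both sides are (q-1) T_1 y_1 U_1 ... U_(k+1) d_+ F, since d_+ turns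
    U_i into U_(i+1). *)
Lemma V_comm_dp k (F : V k.+1) :
  Tl 1 (Vdp (Vdm (Vdp F)) - Vdm (Vdp (Vdp F)))
  = cst k.+2 q * Vdp (Vdp (Vdm F) - Vdm (Vdp F)).
Proof.
rewrite !dp_dm_comm -!cstq1 dp_cst Tl_cst // [RHS]mulrCA; congr (_ * _).
rewrite dp_y; congr (Tl 1 (_ * _)) => /=; congr Ul.
rewrite -foldr_iotaS; symmetry; apply: foldr_comm => i y.
by rewrite mem_iota add1n => ik; rewrite dp_Ul.
Qed.

Lemma V_dyck_module : @dyck_module V (fun k i => @Tl k i) (@Vdp) (@Vdm).
Proof.
split=> //.
- by move=> k [|i] // ik c F G; rewrite (T_linear ik).
- by move=> k c F G; rewrite dp_add scale_cst dp_cst -scale_cst.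
- by move=> k c F G; rewrite dm_add scale_cst dm_cst -scale_cst.
- by move=> k i F ik; rewrite Tl_quad // !scale_cst cst1q.
- exact: Tl_braid.
- exact: Tl_far.
- by move=> k [|i] // F ik; rewrite dm_T.
- exact: dp_Tl.
- exact: Tl_dp_dp.
- exact: dm_dm_T.
- by move=> k F; rewrite scale_cst -V_comm_dm -(raddfB (@Vdm _)).
- move=> k F; rewrite scale_cst -dp_sub -V_comm_dp; symmetry.
  have kk : (1 < k.+2)%N by [].
  by rewrite (T_add kk); have [_ _ ->] := T_hecke kk.
Qed.
(** * Affine Hecke elements of the Dyck path algebra *)

Section LinearFunction.
Context (K : nzRingType) (U W : lmodType K) (f : U -> W) (fL : linear f).
Lemma lin_add x y : f (x + y) = f x + f y.
Proof. by have := fL 1 x y; rewrite !scale1r. Qed.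
Lemma lin_0 : f 0 = 0.
Proof.
by apply: (addrI (f 0)); rewrite -lin_add !addr0.
Qed.
Lemma lin_scale c x : f (c *: x) = c *: f x.
Proof. by have := fL c x 0; rewrite !addr0 lin_0 addr0. Qed.
Lemma lin_sub x y : f (x - y) = f x - f y.
Proof. by rewrite -scaleN1r lin_add lin_scale scaleN1r. Qed.
Lemma lin_sum n (g : 'I_n -> U) : f (\sum_i g i) = \sum_i f (g i).
Proof. exact: (big_morph f lin_add lin_0). Qed.
End LinearFunction.

Lemma iter_comm (X : Type) (f g : X -> X) a x :
  (forall y, f (g y) = g (f y)) -> iter a f (g x) = g (iter a f x).
Proof. by move=> fg; elim: a => //= a ->. Qed.

Lemma iter_comm2 (X : Type) (f g : X -> X) a b x :
  (forall y, f (g y) = g (f y)) -> iter a f (iter b g x) = iter b g (iter a f x).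
Proof.
by move=> fg; apply: iter_comm => y; symmetry; apply: iter_comm.
Qed.

Section DyckModule.
Context (M : nat -> lmodType Qqt) (T : forall k, nat -> M k -> M k).
Context (dp : forall k, M k -> M k.+1) (dm : forall k, M k.+1 -> M k).
Context (D : dyck_module (@T) (@dp) (@dm)).
Local Notation T_ := (@T _).

Let TL k i (ik : (0 < i < k)%N) := dyck_T_linear D ik.
Let dpL k := @dyck_dp_linear _ _ _ _ D k.
Let dmL k := @dyck_dm_linear _ _ _ _ D k.

Lemma scaleqK k (x : M k) : q^-1 *: (q *: x) = x.
Proof. by rewrite scalerA mulVf ?q_neq0 // scale1r. Qed.

(* U_i = q T_i^-1 *)
Definition invT k i (x : M k) : M k := T_ i x + (q - 1) *: x.
Local Notation U_ := (@invT _).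

Lemma hecke_cancel k (x y : M k) : (1 - q) *: y + q *: x + (q - 1) *: y = q *: x.
Proof. by rewrite addrAC -scalerDl subrKA subrr scale0r add0r. Qed.

Lemma TU k i (x : M k) : (0 < i < k)%N -> T_ i (U_ i x) = q *: x.
Proof.
move=> ik; rewrite /invT (lin_add (TL ik)) (lin_scale (TL ik)) (dyck_quad D) //.
exact: hecke_cancel.
Qed.

Lemma UT k i (x : M k) : (0 < i < k)%N -> U_ i (T_ i x) = q *: x.
Proof.
move=> ik; rewrite /invT (dyck_quad D) //.
exact: hecke_cancel.
Qed.

Lemma U_linear k i : (0 < i < k)%N -> linear (U_ i : M k -> M k).
Proof.
move=> ik c x y; rewrite /invT (TL ik) !scalerDr -!addrA; congr (_ + _).
by rewrite addrCA !scalerA [c * _]mulrC.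
Qed.

Lemma T_inj k i : (0 < i < k)%N -> injective (T_ i : M k -> M k).
Proof.
move=> ik x y /(congr1 (fun z => q^-1 *: U_ i z)).
by rewrite !UT // !scaleqK.
Qed.

Lemma commU k l i j (f : M k -> M l) x : linear f ->
  f (T_ i x) = T_ j (f x) -> f (U_ i x) = U_ j (f x).
Proof. by move=> fL fT; rewrite /invT (lin_add fL) (lin_scale fL) fT. Qed.

Lemma T_far k i j (x : M k) : (0 < i < k)%N -> (0 < j < k)%N ->
  (i.+1 < j)%N || (j.+1 < i)%N -> T_ i (T_ j x) = T_ j (T_ i x).
Proof. exact: dyck_far D _ _ _ _. Qed.

Lemma TU_far k i j (x : M k) : (0 < i < k)%N -> (0 < j < k)%N ->
  (i.+1 < j)%N || (j.+1 < i)%N -> T_ i (U_ j x) = U_ j (T_ i x).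
Proof. by move=> ik jk ij; apply: (commU (TL ik)); apply: T_far. Qed.

Lemma UUT k i (x : M k) : (0 < i)%N -> (i.+1 < k)%N ->
  U_ i (U_ i.+1 (T_ i x)) = T_ i.+1 (U_ i (U_ i.+1 x)).
Proof.
move=> i0 ik; have ik0 : (0 < i < k)%N by rewrite i0 ltnW.
apply: (T_inj ik0); apply: (@T_inj k i.+1) => //.
rewrite -(dyck_braid D) // !TU // !(lin_scale (TL _)) // !TU //.
by rewrite !(lin_scale (TL _)).
Qed.

Lemma UUT' k i (x : M k) : (0 < i)%N -> (i.+1 < k)%N ->
  U_ i.+1 (U_ i (T_ i.+1 x)) = T_ i (U_ i.+1 (U_ i x)).
Proof.
move=> i0 ik; have ik0 : (0 < i < k)%N by rewrite i0 ltnW.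
apply: (@T_inj k i.+1) => //; apply: (T_inj ik0).
rewrite (dyck_braid D) // !TU // !(lin_scale (TL _)) // !TU //.
by rewrite !(lin_scale (TL _)).
Qed.

(** * The commutator of d_+ and d_-, and the commuting elements y_i *)

Fixpoint desc k m (x : M k) : M k := if m is m'.+1 then T_ m (desc m' x) else x.

Lemma desc_shift k m i (x : M k) : (0 < i < m)%N -> (m < k)%N ->
  desc m (T_ i.+1 x) = T_ i (desc m x).
Proof.
have far n j (y : M k) : (n.+1 < j < k)%N -> desc n (T_ j y) = T_ j (desc n y).
  by elim: n => //= n IH nj; rewrite IH 1?T_far //; lia.
elim: m => [|m IH] im mk; first lia.
rewrite /=; have [E|im'] := eqVneq i m.
  by case: m E im mk {IH} => [|m] ->; [lia | move=> _ mk /=; rewrite far ?(dyck_braid D) //; lia].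
by rewrite IH 1?T_far //; lia.
Qed.

(** A descending analogue of [chain_chain], used for m = k-2: the square of T_(k-1) ... T_1 can lose
    its leftmost factor in exchange for a T_1 on the right. *)
Lemma desc_desc k m (x : M k) : (m < k.-1)%N ->
  desc k.-1 (desc m.+1 x) = desc m (desc k.-1 (T_ 1 x)).
Proof.
case: k x => // k x; rewrite -[k.+1.-1]/k; elim: m => // m IH mk.
rewrite -[desc m.+2 x]/(T_ m.+2 (desc m.+1 x)) desc_shift ?IH //; lia.
Qed.

(** On V_k with k > 0 this is y_1 U_1 ... U_(k-1). The product T_(k-1) ... T_1, divided by q^(k-1),
    cancels the U_i, whence the form of [Y] 0. The identity at k = 0 is a dummy value. *)
Definition delta k : M k -> M k :=
  if k is k'.+1 then fun x => (q - 1)^-1 *: (dp (dm x) - dm (dp x)) else id.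

Lemma deltaE k (x : M k.+1) : (q - 1) *: delta x = dp (dm x) - dm (dp x).
Proof. by rewrite scalerA mulfV ?q_neq1 // scale1r. Qed.

Lemma delta_linear k : linear (@delta k).
Proof.
case: k => // k c x y; rewrite /delta !(dmL, dpL).
rewrite opprD addrACA -scalerBr scalerDr; congr (_ + _).
by rewrite !scalerA mulrC.
Qed.

Lemma delta_T k i (x : M k) : (0 < i < k.-1)%N -> delta (T_ i x) = T_ i.+1 (delta x).
Proof.
case: k x => [|k] x ik; first lia.
have L : linear (T_ i.+1 : M k.+1 -> M k.+1) by apply: TL; lia.
rewrite /delta (lin_scale L) (lin_sub L) -(dyck_T_dm D); last lia.
rewrite !(dyck_dp_T D); try lia.
rewrite -(dyck_T_dm D) //; lia.
Qed.

(** This and [delta_dp] are the last two defining relations, rewritten with [delta]. *)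
Lemma dm_delta k (x : M k.+2) : dm (delta (T_ k.+1 x)) = q *: delta (dm x).
Proof.
rewrite (lin_scale (@dmL _)) (lin_sub (@dmL _)) (dyck_comm_dm D).
by rewrite scalerA mulrC -scalerA.
Qed.

Lemma delta_dp k (x : M k.+1) : T_ 1 (delta (dp x)) = q *: dp (delta x).
Proof.
have L := @TL k.+2 1 isT.
rewrite (lin_scale L) (lin_sub L) (dyck_comm_dp D) (lin_scale (@dpL _)).
by rewrite (lin_sub (@dpL _)) !scalerA mulrC.
Qed.

(** Write the outer [delta] as a commutator and move T_(k+1) through each term with [dm_delta] and
    [delta_dp]. This is the source of the commutativity of y_1 and y_2. *)
Lemma delta_delta_T k (x : M k.+2) : delta (delta (T_ k.+1 x)) = T_ 1 (delta (delta x)).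
Proof.
have L := @TL k.+2 1 isT.
apply: (scalerI q_neq1); rewrite -(lin_scale L) -(lin_scale (@delta_linear _)) !deltaE.
rewrite dm_delta (lin_scale (@dpL _)) -delta_dp.
rewrite (lin_sub (@delta_linear _)) (lin_sub L); congr (_ - _).
apply: (scalerI q_neq0); rewrite -(lin_scale (@dmL _)) -delta_dp.
by rewrite (dyck_dp_T D) ?ltnSn // -(dyck_T_dm D) // dm_delta (lin_scale L).
Qed.

(* The commuting elements y_1, ..., y_k of the affine Hecke algebra, with
   y_(i+1) = q T_i^-1 y_i T_i^-1; y_(i+1) is Y i. *)
Fixpoint Y k i (x : M k) : M k :=
  if i is i'.+1 then q^-1 *: U_ i (Y i' (U_ i x))
  else q ^- k.-1 *: delta (desc k.-1 x).

Lemma desc_linear k m : (m < k)%N -> linear (@desc k m).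
Proof.
elim: m => // m IH mk c x y; rewrite /= IH ?(ltnW mk) //.
by apply: TL; lia.
Qed.

Lemma Y_linear k i : (i < k)%N -> linear (@Y k i).
Proof.
elim: i => [|i IH] ik c x y /=.
  rewrite desc_linear ?prednK // delta_linear scalerDr; congr (_ + _).
  by rewrite !scalerA mulrC.
have L := @U_linear k i.+1 ik; rewrite L IH ?(ltnW ik) // L scalerDr.
by congr (_ + _); rewrite !scalerA mulrC.
Qed.

Lemma Y0_T k j (x : M k) : (1 < j < k)%N -> Y 0 (T_ j x) = T_ j (Y 0 x).
Proof.
case: j => [|[|j]] // jk; have L : linear (T_ j.+2 : M k -> M k) by apply: TL.
rewrite /= desc_shift ?delta_T ?(lin_scale L) //; lia.
Qed.

Lemma delta_desc k (x : M k) m : (m < k.-1)%N ->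
  desc m.+1 (U_ 1 (delta x)) = q *: delta (desc m x).
Proof.
elim: m => [|m IH] mk; first by rewrite /= TU //; lia.
rewrite -[LHS]/(T_ m.+2 (desc m.+1 (U_ 1 (delta x)))) IH ?(ltnW mk) //.
rewrite (lin_scale (@TL k m.+2 _)) ?delta_T //; lia.
Qed.

(* y_1 U_1 y_1 in terms of delta, to be compared with T_1 delta^2 = delta^2 T_(k-1). *)
Lemma Y0_U1_Y0 k (x : M k) : (1 < k)%N ->
  Y 0 (U_ 1 (Y 0 x))
  = (q ^- k.-1 * q ^- k.-1 * q) *: delta (delta (desc k.-2 (desc k.-1 x))).
Proof.
case: k x => [|[|k]] // x _.
have Y0E (y : M k.+2) : Y 0 y = q ^- k.+1 *: delta (desc k.+1 y) by [].
rewrite !Y0E (lin_scale (@U_linear k.+2 1 isT)) (lin_scale (@desc_linear k.+2 k.+1 _)) //.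
by rewrite delta_desc // !(lin_scale (@delta_linear _)) -[RHS]scalerA -[RHS]scalerA.
Qed.

(** In the formula of [Y0_U1_Y0], [desc_desc] trades the T_1 on the right for a T_(k-1) next to the
    two [delta], and [delta_delta_T] moves it out as T_1. *)
Lemma Y0_U1_Y0_T1 k (x : M k) : (1 < k)%N ->
  Y 0 (U_ 1 (Y 0 (T_ 1 x))) = T_ 1 (Y 0 (U_ 1 (Y 0 x))).
Proof.
case: k x => [|[|k]] // x _; rewrite !Y0_U1_Y0 // (lin_scale (@TL k.+2 1 isT)).
by rewrite -delta_delta_T -(@desc_desc k.+2 k).
Qed.

Lemma YS k i (x : M k) : Y i.+1 x = q^-1 *: U_ i.+1 (Y i (U_ i.+1 x)).
Proof. by []. Qed.

Lemma T_Y_comm_U k i j (x : M k) : (i < k)%N -> (0 < j < k)%N ->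
  (forall y : M k, Y i (T_ j y) = T_ j (Y i y)) -> Y i (U_ j x) = U_ j (Y i x).
Proof. by move=> ik jk YT; apply: (commU (@Y_linear k i ik)). Qed.

Lemma Y01_comm k (x : M k) : (1 < k)%N -> Y 0 (Y 1 x) = Y 1 (Y 0 x).
Proof.
move=> k1; have k0 : (0 < k)%N by lia. have L := @Y_linear k 0 k0.
have LU := @U_linear k 1 k1.
rewrite !YS (lin_scale L); congr (_ *: _).
apply: (commU (f := fun y => Y 0 (U_ 1 (Y 0 y)))).
  by move=> c y z; rewrite L LU L.
exact: Y0_U1_Y0_T1.
Qed.

Lemma U_U_comm k i j (x : M k) : (0 < i < k)%N -> (0 < j < k)%N ->
  (i.+1 < j)%N || (j.+1 < i)%N -> U_ i (T_ j x) = T_ j (U_ i x).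
Proof. by move=> ik jk ij; rewrite TU_far // orbC. Qed.

Lemma Y_T k i j (x : M k) : (i < k)%N -> (0 < j < k)%N -> j != i -> j != i.+1 ->
  Y i (T_ j x) = T_ j (Y i x).
Proof.
elim/ltn_ind: i j x => -[|i] IH j x ik jk ji ji1; first by rewrite Y0_T //; lia.
have Lj := @TL k j jk.
rewrite !YS (lin_scale Lj); congr (_ *: _).
have [E|ji'] := eqVneq j i; last first.
  by rewrite U_U_comm ?IH ?U_U_comm //; lia.
(* The case j = i of T_i against [Y] (i+1). Unfolding [Y] twice, [UUT] turns T_i into T_(i+1), which
   commutes with [Y] (i-1), and [UUT'] turns it back. *)
case: i E IH ik ji ji1 => [|i] E IH ik ji ji1; first lia.
subst j; have ik' : (0 < i.+1 < k)%N by lia.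
have LU1 := @U_linear k i.+1 jk; have LU2 : linear (U_ i.+2 : M k -> M k).
  by apply: U_linear; lia.
rewrite !YS !(lin_scale LU2) (lin_scale Lj); congr (_ *: _).
by rewrite UUT // IH ?UUT' //; lia.
Qed.

Lemma Y_U k i j (x : M k) : (i < k)%N -> (0 < j < k)%N -> j != i -> j != i.+1 ->
  Y i (U_ j x) = U_ j (Y i x).
Proof. by move=> ik jk ji ji1; apply: T_Y_comm_U => // y; rewrite Y_T. Qed.

Lemma T_YS k i (x : M k) : (i.+1 < k)%N -> T_ i.+1 (Y i.+1 x) = Y i (U_ i.+1 x).
Proof. by move=> ik; rewrite YS (lin_scale (@TL k i.+1 ik)) TU // scaleqK. Qed.

Lemma YS_T k i (x : M k) : (i.+1 < k)%N -> Y i.+1 (T_ i.+1 x) = U_ i.+1 (Y i x).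
Proof.
move=> ik; rewrite YS UT // (lin_scale (@Y_linear k i (ltnW ik))).
by rewrite (lin_scale (@U_linear k i.+1 ik)) scaleqK.
Qed.

Lemma T_Y k i (x : M k) : (i.+1 < k)%N ->
  T_ i.+1 (Y i x) = Y i.+1 (T_ i.+1 x) + (1 - q) *: Y i x.
Proof. by move=> ik; rewrite YS_T // /invT -addrA -scalerDl subrKA subrr scale0r addr0. Qed.

Lemma Y_Tsame k i (x : M k) : (i.+1 < k)%N ->
  Y i (T_ i.+1 x) = T_ i.+1 (Y i.+1 x) + (1 - q) *: Y i x.
Proof.
move=> ik; have L := @Y_linear k i (ltnW ik).
rewrite T_YS // /invT (lin_add L) (lin_scale L) -addrA -scalerDl.
by rewrite subrKA subrr scale0r addr0.
Qed.

Lemma Y_comm k i j (x : M k) : (i < j)%N -> (j < k)%N -> Y i (Y j x) = Y j (Y i x).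
Proof.
elim: i x => [|i IH] x ij jk.
  elim: j x ij jk => // -[|j] IH x _ jk; first exact: Y01_comm.
  have k0 : (0 < k)%N by lia.
  rewrite YS (lin_scale (@Y_linear k 0 k0)) Y_U // IH ?(ltnW jk) // Y_U //.
have YU (y : M k) : U_ i.+1 (Y j y) = Y j (U_ i.+1 y) by rewrite Y_U //; lia.
by rewrite !YS (lin_scale (@Y_linear k j jk)) YU IH ?YU // ltnW.
Qed.

Lemma Y_commute k i j (x : M k) : (i < k)%N -> (j < k)%N -> Y i (Y j x) = Y j (Y i x).
Proof.
by move=> ik jk; have [ij|ji|->//] := ltngtP i j; rewrite ?(Y_comm _ ij) // (Y_comm _ ji).
Qed.

(** * The elements y_i against d_- and d_+ *)

Lemma dm_desc k m (x : M k.+1) : (m < k)%N -> dm (desc m x) = desc m (dm x).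
Proof.
by elim: m => //= m IH mk; rewrite -IH ?(ltnW mk) // -(dyck_T_dm D) //; lia.
Qed.

(** For y_1: passing d_-, the product T_(k-1) ... T_1 loses its leftmost factor, which [dm_delta]
    consumes together with a factor q; this matches the change in the normalization q^-(k-1). *)
Lemma dm_Y k i (x : M k.+1) : (i < k)%N -> dm (Y i x) = Y i (dm x).
Proof.
elim: i x => [|i IH] x ik.
  case: k x ik => // k x _.
  have Y0E n (y : M n.+1) : Y 0 y = q ^- n *: delta (desc n y) by [].
  rewrite !Y0E (lin_scale (@dmL _)) -dm_desc // -[desc k.+1 x]/(T_ k.+1 (desc k x)).
  by rewrite dm_delta scalerA exprS invfM mulrAC mulVf ?q_neq0 // mul1r.
have dmU (y : M k.+1) : dm (U_ i.+1 y) = U_ i.+1 (dm y).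
  by apply: (commU (@dmL _)); rewrite (dyck_T_dm D).
by rewrite !YS (lin_scale (@dmL _)) dmU IH ?(ltnW ik) // dmU.
Qed.

Local Notation up m z := (foldr (@T _) z (iota 1 m)).

Lemma up_linear k m : (m < k)%N -> linear (fun z : M k => up m z).
Proof.
elim: m => // m IH mk c x y; rewrite !foldr_iotaSr add1n -IH ?(ltnW mk) //.
by rewrite (@TL k m.+1 mk).
Qed.

Lemma up_T k m i (z : M k) : (0 < i < m)%N -> (m < k)%N ->
  up m (T_ i z) = T_ i.+1 (up m z).
Proof.
move=> /andP[i0 im] mk; apply: (chain_shift (n := k)) => // [j y|j l y].
  exact: (dyck_braid D).
exact: (dyck_far D).
Qed.

Lemma up_U k m i (z : M k) : (0 < i < m)%N -> (m < k)%N ->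
  up m (U_ i z) = U_ i.+1 (up m z).
Proof. by move=> im mk; apply: (commU (up_linear mk)); apply: up_T. Qed.

Lemma dp_U k i (x : M k) : (0 < i < k)%N -> dp (U_ i x) = U_ i.+1 (dp x).
Proof. by move=> ik; apply: (commU (@dpL _)); apply: dyck_dp_T D _ _ _ ik. Qed.

Lemma dp_desc k m (x : M k) z : (m < k)%N -> dp x = T_ 1 z ->
  dp (desc m x) = desc m.+1 z.
Proof.
elim: m => // m IH mk E; rewrite /= -[T_ m.+1 (desc m z)]/(desc m.+1 z).
by rewrite -IH ?(ltnW mk) // (dyck_dp_T D).
Qed.

(* d_+ y_i = (T_1 ... T_i) y_i (T_1 ... T_i)^-1 d_+ *)
Lemma dp_Y k i (x : M k) z : (i < k)%N -> dp x = up i.+1 z -> dp (Y i x) = up i.+1 (Y i z).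
Proof.
elim: i x z => [|i IH] x z ik E.
  case: k x z ik E => // k x z _ E.
  have Y0E n (y : M n.+1) : Y 0 y = q ^- n *: delta (desc n y) by [].
  rewrite -[RHS]/(T_ 1 (Y 0 z)) !Y0E (lin_scale (@dpL _)) -(dp_desc _ E) // (lin_scale (@TL k.+2 1 isT)).
  by rewrite delta_dp scalerA exprS invfM mulrAC mulVf ?q_neq0 // mul1r.
have E' : dp (U_ i.+1 x) = up i.+1 (T_ i.+2 (U_ i.+1 z)).
  by rewrite dp_U // E -up_U ?ltnSn // foldr_iotaSr.
rewrite YS (lin_scale (@dpL _)) dp_U // (IH _ _ (ltnW ik) E').
have -> : Y i (T_ i.+2 (U_ i.+1 z)) = T_ i.+2 (Y i (U_ i.+1 z)).
  by rewrite Y_T //; lia.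
have <- : up i.+2 (Y i (U_ i.+1 z)) = up i.+1 (T_ i.+2 (Y i (U_ i.+1 z))).
  by rewrite foldr_iotaSr.
by rewrite -up_U ?ltnSn // -(lin_scale (@up_linear k.+1 i.+2 ik)).
Qed.

Lemma dp_iterY k i a (x : M k) z : (i < k)%N -> dp x = up i.+1 z ->
  dp (iter a (Y i) x) = up i.+1 (iter a (Y i) z).
Proof. by move=> ik E; elim: a => //= a IH; apply: dp_Y. Qed.

Lemma iterY_linear k i a : (i < k)%N -> linear (iter a (@Y k i)).
Proof.
by move=> ik c x y; elim: a => //= a ->; rewrite (@Y_linear k i ik).
Qed.

Lemma T_iterY k i a (x : M k) : (i.+1 < k)%N -> T_ i.+1 (iter a (Y i) x)
  = iter a (Y i.+1) (T_ i.+1 x)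
    + (1 - q) *: \sum_(j < a) iter j (Y i.+1) (iter (a - j) (Y i) x).
Proof.
move=> ik; elim: a => [|a IH]; first by rewrite big_ord0 scaler0 addr0.
have YL := @Y_linear k i.+1 ik.
rewrite [iter a.+1 _ _]/= T_Y // IH (lin_add YL) (lin_scale YL) -addrA; congr (_ + _).
rewrite big_ord_recl subn0 scalerDr addrC; congr (_ + _ *: _).
by rewrite (lin_sum YL); apply: eq_bigr => j _; rewrite lift0 subSS.
Qed.

(** Mirror image of [T_iterY]. In [E_comm] one form leaves T_1 next to d_+^2 and the other next to
    d_-^2, and both absorb it. *)
Lemma iterY_T k i a (x : M k) : (i.+1 < k)%N -> iter a (Y i) (T_ i.+1 x)
  = T_ i.+1 (iter a (Y i.+1) x)
    + (1 - q) *: \sum_(j < a) iter (a - j) (Y i) (iter j (Y i.+1) x).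
Proof.
move=> ik; elim: a x => [|a IH] x; first by rewrite big_ord0 scaler0 addr0.
have YL := @Y_linear k i (ltnW ik).
rewrite iterSr Y_Tsame // (lin_add (iterY_linear _ (ltnW ik))) IH.
rewrite (lin_scale (iterY_linear _ (ltnW ik))) -iterSr -iterSr -addrA; congr (_ + _).
rewrite big_ord_recl subn0 scalerDr addrC; congr (_ + _ *: _).
by apply: eq_bigr => j _; rewrite lift0 subSS iterSr.
Qed.

(** * The operators d_- y_1^a d_+ on level 0 *)

Definition E a (w : M 0) : M 0 := dm (iter a (Y 0) (dp w)).

Lemma E_linear a : linear (E a).
Proof. by move=> c x y; rewrite /E dpL (@iterY_linear 1 0 _ isT) dmL. Qed.

(** On [M 1] there are no T_i, so [delta] is y_1 itself and the commutator of d_+ and d_- is (q-1)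
    y_1. *)
Lemma dp_dm_iterY0 b (w : M 0) : dp (E b w)
  = dm (T_ 1 (iter b (Y 0) (dp (dp w)))) + (q - 1) *: iter b.+1 (Y 0) (dp w).
Proof.
have Y0E (y : M 1) : Y 0 y = delta y by rewrite /= invr1 scale1r.
rewrite -[iter b.+1 _ _]/(Y 0 (iter b (Y 0) (dp w))) Y0E deltaE.
have -> : dp (iter b (Y 0) (dp w)) = T_ 1 (iter b (Y 0) (dp (dp w))).
  by apply: (dp_iterY (k := 1)); rewrite //= (dyck_T_dp_dp D).
by rewrite addrC subrK.
Qed.

Lemma dm_iterY k i a (x : M k.+1) : (i < k)%N -> dm (iter a (Y i) x) = iter a (Y i) (dm x).
Proof. by move=> ik; elim: a => //= a <-; rewrite dm_Y. Qed.

(* E_a E_b w = d_-^2 y_1^a T_1 y_1^b d_+^2 w up to a term symmetric in a and b;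
   as T_1 is absorbed on both sides, y_1^a T_1 y_1^b and its image under the
   anti-involution fixing T_1 and y_1 act equally. *)
Lemma E_comm a b (w : M 0) : E a (E b w) = E b (E a w).
Proof.
pose X a b := dm (dm (iter a (Y 0) (T_ 1 (iter b (Y 0) (dp (dp w)))))).
have EE c d : E c (E d w) = X c d + (q - 1) *: dm (iter (c + d).+1 (Y 0) (dp w)).
  rewrite {1}/E dp_dm_iterY0 (lin_add (@iterY_linear 1 0 _ isT)).
  rewrite (lin_scale (@iterY_linear 1 0 _ isT)) (lin_add (@dmL _)) (lin_scale (@dmL _)).
  by rewrite -iterD addnS -dm_iterY.
suff XX : X a b = X b a by rewrite !EE XX addnC.
clear EE; set u := dp (dp w) in X *; have Tu : T_ 1 u = u := dyck_T_dp_dp D w.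
have YL (i : nat) c (i2 : (i < 2)%N) := @iterY_linear 2 i c i2.
have -> : X a b = dm (dm (iter a (Y 0) (iter b (Y 1) u)
    + (1 - q) *: \sum_(j < b) iter j (Y 1) (iter (a + b - j) (Y 0) u))).
  rewrite /X T_iterY // Tu (lin_add (YL 0%N a isT)) (lin_scale (YL 0%N a isT)).
  rewrite (lin_sum (YL 0%N a isT)); congr (dm (dm (_ + _ *: _))).
  apply: eq_bigr => j _; rewrite (@iter_comm2 _ (Y 0) (Y 1)) ?iterD; last first.
    by move=> y; rewrite Y_comm.
  by rewrite -addnBA ?iterD // ltnW.
have dmdm (y z : M 2) : dm (dm (T_ 1 y + z)) = dm (dm (y + z)).
  by rewrite !(lin_add (@dmL _)) (dyck_dm_dm_T D).
rewrite /X iterY_T // dmdm; congr (dm (dm (_ + _ *: _))).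
  by apply: iter_comm2 => y; rewrite Y_comm.
apply: eq_bigr => j _; rewrite [RHS](@iter_comm2 _ (Y 0) (Y 1)) -?iterD.
  by congr (iter _ _ (iter _ _ _)); have := ltn_ord j; lia.
by move=> y; rewrite Y_comm.
Qed.

(** * The span of the elements y^m d_+^k w and its stability *)

Fixpoint dpn k (w : M 0) : M k := if k is k'.+1 then dp (dpn k' w) else w.

Lemma dpn_linear k : linear (dpn k).
Proof. by elim: k => //= k IH c x y; rewrite IH dpL. Qed.

Lemma T_dpn k j (w : M 0) : (0 < j < k)%N -> T_ j (dpn k w) = dpn k w.
Proof.
elim: k j => [|k IH] j jk; first lia.
case: j jk => [|[|j]] jk; first lia.
  by case: k jk {IH} => [|k] jk; [lia | rewrite /= (dyck_T_dp_dp D)].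
by rewrite /= -(dyck_dp_T D) ?IH //; lia.
Qed.

Section Span.
Context (S0 : M 0 -> Prop).
Context (S0L : forall c x y, S0 x -> S0 y -> S0 (c *: x + y)).
Context (S0E : forall a x, S0 x -> S0 (E a x)).

Inductive span k : M k -> Prop :=
| span_dpn w : S0 w -> span (dpn k w)
| span_lin c x y : span x -> span y -> span (c *: x + y)
| span_Y i x : (i < k)%N -> span x -> span (Y i x).

Lemma span_scale k c (x : M k) : span x -> span (c *: x).
Proof.
by move=> Sx; rewrite -[c](subrK 1) scalerDl scale1r; apply: span_lin.
Qed.

Lemma span_add k (x y : M k) : span x -> span y -> span (x + y).
Proof. by move=> Sx Sy; rewrite -[x]scale1r; apply: span_lin. Qed.

Lemma span_sub k (x y : M k) : span x -> span y -> span (x - y).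
Proof. by move=> Sx Sy; rewrite addrC -scaleN1r; apply: span_lin. Qed.

Lemma span_sum k n (f : 'I_n -> M k) x : span x ->
  (forall i, span (f i)) -> span (x + \sum_i f i).
Proof.
move=> Sx Sf; elim: n f Sf => [|n IH] f Sf; first by rewrite big_ord0 addr0.
by rewrite big_ord_recr addrA; apply: span_add => //; apply: IH.
Qed.

Lemma span_T k i (x : M k) : (0 < i < k)%N -> span x -> span (T_ i x).
Proof.
move=> ik; elim=> [w Sw|c {}x y _ Sx _ Sy|j {}x jk Sx STx].
- by rewrite T_dpn //; apply: span_dpn.
- by rewrite TL //; apply: span_lin.
case: i ik STx => // i ik STx.
have [E|ji] := eqVneq j i.
  subst j; rewrite T_Y //.
  by apply: span_add; [apply: span_Y | apply/span_scale/span_Y].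
have [E|ji1] := eqVneq j i.+1.
  subst j; rewrite T_YS //; apply: span_Y; first exact: ltnW.
  by rewrite /invT; apply: span_add => //; apply: span_scale.
by rewrite -Y_T //; [apply: span_Y | rewrite eq_sym | rewrite eqSS eq_sym].
Qed.

Lemma span_U k i (x : M k) : (0 < i < k)%N -> span x -> span (U_ i x).
Proof.
by move=> ik Sx; rewrite /invT; apply: span_add; [apply: span_T | apply: span_scale].
Qed.

Lemma span_Tinv k i (x : M k) : (0 < i < k)%N -> span (T_ i x) -> span x.
Proof.
move=> ik STx; rewrite -[x]scaleqK -(UT x ik).
by apply/span_scale/span_U.
Qed.

Lemma span_up_inv k m (x : M k) : (m < k)%N -> span (up m x) -> span x.
Proof.
elim: m x => // m IH x mk; rewrite foldr_iotaSr add1n => /IH H.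
by apply: (@span_Tinv _ m.+1) => //; apply: H; apply: ltnW.
Qed.

Lemma span_up k m (x : M k) : (m < k)%N -> span x -> span (up m x).
Proof.
elim: m x => // m IH x mk Sx; rewrite foldr_iotaSr add1n; apply: IH; first exact: ltnW.
exact: span_T.
Qed.

Lemma up_surj k m (x : M k) : (m < k)%N -> exists z, x = up m z.
Proof.
elim: m => [|m IH] mk; first by exists x.
have [z ->] := IH (ltnW mk); exists (q^-1 *: U_ m.+1 z).
by rewrite foldr_iotaSr add1n (lin_scale (@TL k m.+1 mk)) TU // scaleqK.
Qed.

Lemma desc_surj k m (x : M k) : (m < k)%N -> span x -> exists2 z, span z & x = desc m z.
Proof.
elim: m x => [|m IH] x mk Sx; first by exists x.
have [||z Sz zE] := IH (q^-1 *: U_ m.+1 x); first exact: ltnW.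
  by apply/span_scale/span_U.
by exists z => //=; rewrite -zE (lin_scale (@TL k m.+1 mk)) TU // scaleqK.
Qed.

(** By [dp_Y] a factor y_j becomes y_j conjugated by T_1 ... T_(j+1) in the 0-based numbering of
    [Y], and the span is stable under these T_i and their inverses. *)
Lemma span_dp k (x : M k) : span x -> span (dp x).
Proof.
elim=> [w Sw|c {}x y _ Sx _ Sy|j {}x jk _ Sdx].
- exact: (span_dpn k.+1).
- by rewrite dpL; apply: span_lin.
have [z zE] := @up_surj k.+1 j.+1 (dp x) jk.
rewrite (dp_Y jk zE); apply: span_up => //; apply: span_Y; first exact: ltnW.
by move: Sdx; rewrite zE; apply: span_up_inv.
Qed.

Lemma span_delta k (x : M k.+1) : span x -> span (delta x).
Proof.
move=> Sx; have [z Sz ->] := desc_surj (ltnSn k) Sx.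
have -> : delta (desc k z) = q ^+ k *: Y 0 z.
  by rewrite -[Y 0 z]/(q ^- k *: delta (desc k z)) scalerA mulfV ?scale1r // expf_neq0 ?q_neq0.
by apply/span_scale/span_Y.
Qed.

Lemma span_iterY k i a (x : M k) : (i < k)%N -> span x -> span (iter a (Y i) x).
Proof. by move=> ik Sx; elim: a => //= a; apply: span_Y. Qed.

Lemma up_dpn k m (w : M 0) : (m < k)%N -> up m (dpn k w) = dpn k w.
Proof.
by elim: m => // m IH mk; rewrite foldr_iotaSr add1n T_dpn // IH // ltnW.
Qed.

(* On x = d_+^(k+1) w, commuting d_- past d_+ costs a multiple of delta, and
   moves y_(k+1)^a to y_(k+2)^a up to lower powers of y_(k+2). *)
Lemma span_dm_iterY k a (w : M 0) : S0 w -> span (dm (iter a (@Y k.+1 k) (dpn k.+1 w))).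
Proof.
move=> Sw; elim: k a => [|k IHk] a.
  by rewrite -[dm _]/(E a w) -[E a w]/(dpn 0 (E a w)); apply/span_dpn/S0E.
have kk1 : (k < k.+1)%N by []. have kk2 : (k.+1 < k.+2)%N by [].
have kk : (k < k.+2)%N by apply: ltnW.
elim/ltn_ind: a => a IHa.
set x := dpn k.+1 w; set u := dpn k.+2 w.
have Sdp : span (dp (iter a (@Y k.+1 k) x)).
  by apply: span_dp; apply: span_iterY => //; apply: span_dpn.
have dpx : dp (iter a (@Y k.+1 k) x) = up k.+1 (iter a (@Y k.+2 k) u).
  by apply: dp_iterY => //; rewrite up_dpn.
have S1 : span (dm (dp (iter a (@Y k.+1 k) x))).
  have -> : dm (dp (iter a (@Y k.+1 k) x))
     = dp (dm (iter a (@Y k.+1 k) x)) - (q - 1) *: delta (iter a (@Y k.+1 k) x).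
    by rewrite deltaE opprB addrC subrK.
  apply: span_sub; first by apply: span_dp; apply: IHk.
  by apply/span_scale/span_delta/span_iterY => //; apply: span_dpn.
(* By [dpx], [S1] concerns d_- T_1 ... T_(k+1) y_(k+1)^a u. The factors T_1, ..., T_k commute with
   d_- and can be inverted within the span, so only T_(k+1) remains; expanding it gives y_(k+2)^a
   and lower powers, left to [IHa]. *)
have S2 : span (dm (T_ k.+1 (iter a (@Y k.+2 k) u))).
  apply: (@span_up_inv _ k) => //; move: S1; rewrite dpx foldr_iotaSr add1n.
  rewrite (@foldr_comm _ _ (@dm k.+1) (@T _) (@T _)) // => j y; rewrite mem_iota => jk.
  by rewrite (dyck_T_dm D).
pose g (j : 'I_a) := (1 - q) *: dm (iter j (@Y k.+2 k.+1) (iter (a - j) (Y k) u)).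
have {}S2 : span (dm (iter a (Y k.+1) u) + \sum_j g j).
  move: S2; rewrite T_iterY // T_dpn // (lin_add (@dmL _)) (lin_scale (@dmL _)).
  by rewrite (lin_sum (@dmL _)) scaler_sumr.
rewrite -[dm _](addrK (\sum_j g j)) -sumrN; apply: span_sum => // j.
rewrite -scaleN1r /g; do 2!apply: span_scale.
rewrite (@iter_comm2 _ (Y k.+1) (Y k)); last by move=> y; rewrite Y_commute.
by rewrite dm_iterY //; apply: span_iterY => //; apply: IHa.
Qed.

Lemma span_dm k (x : M k.+1) : span x -> span (dm x).
Proof.
(* The statement is strengthened to all powers of y_(k+1), since d_- commutes only with y_1, ...,
   y_k. *)
move=> Sx; suff : forall a, span (dm (iter a (@Y k.+1 k) x)) by move/(_ 0%N).
elim: Sx => {x} [w Sw a|c x y _ Sx _ Sy a|i x ik _ IH a].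
- exact: span_dm_iterY.
- by rewrite (iterY_linear a (ltnSn k)) dmL; apply: span_lin.
have [->|ik'] := eqVneq i k; first by rewrite -iterSr.
have {}ik' : (i < k)%N by lia.
rewrite iter_comm; last by move=> y; rewrite Y_commute.
by rewrite dm_Y //; apply: span_Y.
Qed.
End Span.
End DyckModule.

(** * Maps to the polynomial representation *)

Section MonomialAction.
Context (X : Type) (n : nat) (A : 'I_n -> X -> X).
Context (AC : forall i j x, A i (A j x) = A j (A i x)).

Definition mact (m : 'X_{1..n}) (x : X) : X :=
  foldr (fun i => iter (m i) (A i)) x (index_enum 'I_n).

Lemma mact0 x : mact 0%MM x = x.
Proof. by rewrite /mact; elim: (index_enum _) => //= i r ->; rewrite mnm0E. Qed.

Lemma mactU i m x : mact (U_(i) + m)%MM x = A i (mact m x).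
Proof.
have act_notin r : i \notin r -> foldr (fun j => iter ((U_(i) + m)%MM j) (A j)) x r
    = foldr (fun j => iter (m j) (A j)) x r.
  elim: r => //= j r IH; rewrite inE negb_or => /andP[ij ir].
  by rewrite IH // mnmDE mnm1E (negPf ij).
rewrite /mact; have := index_enum_uniq 'I_n; have := mem_index_enum i.
elim: (index_enum _) => //= j r IH; rewrite inE.
have [E|ij] := eqVneq i j.
  by subst j; move=> _ /andP[ir _]; rewrite act_notin // mnmDE mnm1E eqxx.
move=> /= ir /andP[_ ru]; rewrite IH // mnmDE mnm1E (negPf ij) add0n.
exact: iter_comm.
Qed.

Lemma mact_ind (P : X -> Prop) m x :
  (forall i y, P y -> P (A i y)) -> P x -> P (mact m x).
Proof.
move=> PA Px; rewrite /mact; elim: (index_enum _) => //= i r IH.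
by elim: (m i) => //= l; apply: PA.
Qed.
End MonomialAction.

Lemma mact_linear (K : nzRingType) (U : lmodType K) n (A : 'I_n -> U -> U) m :
  (forall i, linear (A i)) -> linear (mact A m).
Proof.
move=> AL c x y; rewrite /mact; elim: (index_enum _) => //= i r ->.
by elim: (m i) => //= l ->; rewrite AL.
Qed.

Lemma mact_mul (K : comNzRingType) (X : Type) n (A : 'I_n -> X -> X) (f : X -> K) g m x :
  (forall i y, f (A i y) = g i * f y) -> f (mact A m x) = mmap1 g m * f x.
Proof.
move=> fA; rewrite /mmap1 /mact.
elim: (index_enum _) => [|i r IH]; first by rewrite big_nil mul1r.
rewrite big_cons /= -mulrA -IH; elim: (m i) => [|l IHl]; first by rewrite mul1r.
by rewrite exprS -mulrA -IHl fA.
Qed.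

Section MonomialLift.
Context (K : comNzRingType) (U : lmodType K) (n : nat) (g : 'X_{1..n} -> U).

Definition mlift (P : {mpoly K[n]}) : U := fglift g (mpoly_val P).

Lemma mlift_linear : linear mlift.
Proof. by move=> c P Q; rewrite /mlift -fgliftZ -raddfD. Qed.

Lemma mliftX m : mlift 'X_[m] = g m.
Proof. by rewrite /mlift unlock liftU scale1r. Qed.

End MonomialLift.

Lemma esym_free N (P : {mpoly Qqt[N]}) :
  mmap (in_alg Sym) (fun i => esym Qqt (nat_of_ord i).+1) P = 0 -> P = 0.
Proof.
move=> /(congr1 (coord N)); rewrite rmorph0.
by rewrite -[LHS]/((mmap _ _ P : Sym) N) coord_ev => /msym_fundamental_un0.
Qed.

Lemma SymV_inj k : injective (@SymV k).
Proof.
move=> F G /(congr1 (fun P : {mpoly Sym[k]} => P@_0)).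
by rewrite !mcoeffC eqxx !mulr1.
Qed.

Lemma SymV_eq0 k F : SymV k F = 0 -> F = 0.
Proof.
move=> /(congr1 (fun P : {mpoly Sym[k]} => P@_0)).
by rewrite mcoeffC eqxx mulr1 mcoeff0.
Qed.

(** Reduces linear independence among the y^m [base k G] to that of monomials over Sym, as
    [shift qc] is injective. *)
Lemma shift_monomial k (G : Sym) (m : 'X_{1..k}) :
  shift qc (G *: 'X_[m] : {mpoly Sym[k]}) = ('X_[m] : V k) * base k G.
Proof.
rewrite mulrC -mul_mpolyC [LHS](rmorphM (@shift qc k)) [@base]unlock; congr (_ * _).
rewrite mpolyXE_id [LHS](rmorph_prod (@shift qc k)); apply: eq_bigr => i _.
by rewrite [LHS](rmorphXn (@shift qc k)) [X in X ^+ _]shift_y.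
Qed.

Lemma V0_Sym (F : V 0) : exists G, F = SymV 0 G.
Proof.
elim/V_ind: F => [c|_ _ [F ->] [G ->]|i F //]; first by exists c.
by exists (F + G); rewrite raddfD.
Qed.

Lemma dp_base k G : Vdp (base k G) = base k.+1 G.
Proof.
rewrite dpE tau_base; have : {subset iota 1 k <= iota 1 k} by [].
elim: {1 3}(iota 1 k) => //= i r IH sr; rewrite IH => [|j jr]; last first.
  by rewrite sr // inE jr orbT.
have := sr i (mem_head _ _); rewrite mem_iota add1n.
by case: i {sr} => // i ik; rewrite T_base.
Qed.

Lemma dp0 (F : V 0) : Vdp F = tau F.
Proof. by rewrite dpE. Qed.

(** * The elements y_i and E in the polynomial representation *)

Section VY.
Local Notation TV := (fun k i => @Tl k i).

Lemma V_invT k i (F : V k) : invT TV i F = Ul i F.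
Proof. by rewrite /invT /Ul scale_cst cstq1. Qed.

(** For y_1, the factors U_1 ... U_(k-1) of [delta] cancel against T_(k-1) ... T_1 up to the power
    of q built into [Y]; then y_i U_i = T_i y_(i+1) gives the next one. *)
Lemma V_Y k i (F : V k) : (i < k)%N -> Y TV (@Vdp) (@Vdm) i F = yv k i * F.
Proof.
elim: i F => [|i IH] F ik.
  case: k F ik => // k F _.
  have desc_U m (G : V k.+1) : (m < k.+1)%N ->
      foldr (@Ul k.+1) (desc TV m G) (iota 1 m) = q ^+ m *: G.
    elim: m => [|m IHm] mk; first by rewrite scale1r.
    rewrite foldr_iotaSr add1n /= Ul_Tl // exprS -scalerA -IHm ?(ltnW mk) //.
    rewrite [RHS]scale_cst; symmetry.
    apply: (foldr_comm (f := fun x => cst k.+1 q * x)) => j y.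
    by rewrite mem_iota add1n => jm; rewrite Ul_cst //; lia.
  rewrite -[LHS]/(q ^- k *: delta (@Vdp) (@Vdm) (desc TV k F)) /delta dp_dm_comm.
  rewrite -cstq1 -scale_cst desc_U // scalerK ?q_neq1 // -scalerAr scalerK //.
  by rewrite expf_neq0 ?q_neq0.
rewrite -[LHS]/(q^-1 *: invT TV i.+1 (Y TV (@Vdp) (@Vdm) i (invT TV i.+1 F))).
rewrite !V_invT IH ?(ltnW ik) //.
have -> : yv k i * Ul i.+1 F = Tl i.+1 (yv k i.+1 * F).
  by rewrite (T_y2 ik) mulrCA -mulrDr.
by rewrite Ul_Tl // -scale_cst scalerK ?q_neq0.
Qed.

Lemma V_dpn k G : dpn (@Vdp) k (SymV 0 G) = base k G.
Proof. by elim: k => [|k IH]; rewrite ?base0 // -dp_base -IH. Qed.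

Lemma V_E a (F : V 0) : E TV (@Vdp) (@Vdm) a F = - (eps 0 a.+1 * F).
Proof.
rewrite /E dp0 -dm_tau; congr (Vdm _).
by elim: a => [|a IH]; rewrite ?mul1r // iterS IH V_Y // exprS -mulrA.
Qed.
End VY.

(** * Maps of such modules into V_k: bijectivity on the span *)

Section Intertwiner.
Context (M : nat -> lmodType Qqt) (T : forall k, nat -> M k -> M k).
Context (dp : forall k, M k -> M k.+1) (dm : forall k, M k.+1 -> M k).
Context (D : dyck_module T dp dm).
Context (f : forall k, M k -> V k).
Context (fL : forall k, linear (@f k)).
Context (fT : forall k i (x : M k), (0 < i < k)%N -> f (T i x) = Tl i (f x)).
Context (fdp : forall k (x : M k), f (dp x) = Vdp (f x)).
Context (fdm : forall k (x : M k.+1), f (dm x) = Vdm (f x)).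
Context (v0 : M 0) (fv0 : f v0 = 1).
Local Notation TV := (fun k i => @Tl k i).
Local Notation Y_ := (Y T dp dm).
Local Notation E_ := (E T dp dm).

Lemma f_Y k i (x : M k) : (i < k)%N -> f (Y_ i x) = yv k i * f x.
Proof.
move=> ik; rewrite -V_Y //.
elim: i x ik => [|i IH] x ik.
  case: k x ik => // k x _.
  have fdesc m (y : M k.+1) : (m < k.+1)%N -> f (desc T m y) = desc TV m (f y).
    by elim: m => //= m IHm mk; rewrite fT // IHm // ltnW.
  rewrite -[LHS]/(f (q ^- k *: delta dp dm (desc T k x))) (lin_scale (@fL _)).
  rewrite /delta (lin_scale (@fL _)) (lin_sub (@fL _)) fdp !fdm fdp fdesc //.
have fU (y : M k) : f (invT T i.+1 y) = invT TV i.+1 (f y).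
  by rewrite /invT (lin_add (@fL _)) (lin_scale (@fL _)) fT.
rewrite -[LHS]/(f (q^-1 *: invT T i.+1 (Y_ i (invT T i.+1 x)))) (lin_scale (@fL _)).
by rewrite fU IH ?(ltnW ik) // fU.
Qed.

Lemma f_dpn k w : f (dpn dp k w) = dpn (@Vdp) k (f w).
Proof. by elim: k => //= k IH; rewrite fdp IH. Qed.

Lemma f_E a w : f (E_ a w) = - (eps 0 a.+1 * f w).
Proof.
rewrite -V_E /E fdm; congr (Vdm _); elim: a => [|a IH]; first by rewrite /= fdp.
by rewrite !iterS f_Y // V_Y // IH.
Qed.

(* The operators acting as multiplication by e_(a+1) on V_0. *)
Definition esym_op a (w : M 0) : M 0 := (-1) ^+ a *: E_ a w.

Lemma esym_op_linear a : linear (esym_op a).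
Proof.
move=> c x y; rewrite /esym_op (E_linear D) scalerDr; congr (_ + _).
by rewrite !scalerA mulrC.
Qed.

Lemma esym_op_comm a b w : esym_op a (esym_op b w) = esym_op b (esym_op a w).
Proof.
rewrite /esym_op !(lin_scale (@E_linear _ _ _ _ D _)) (E_comm D) !scalerA.
by rewrite mulrC.
Qed.

Lemma f_esym_op a w : f (esym_op a w) = SymV 0 (esym Qqt a.+1) * f w.
Proof.
rewrite /esym_op (lin_scale (@fL _)) f_E [@eps]unlock Exp_minus_zXE.
rewrite rmorphM rmorph_sign exprS /= scale_cst rmorph_sign.
transitivity ((-1) ^+ a ^+ 2 * (SymV 0 (esym Qqt a.+1) * f w)); last first.
  by rewrite sqrr_sign mul1r.
ring.
Qed.

Inductive esym_span : M 0 -> Prop :=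
| esym_span_gen : esym_span v0
| esym_span_lin c x y : esym_span x -> esym_span y -> esym_span (c *: x + y)
| esym_span_op a x : esym_span x -> esym_span (esym_op a x).

Lemma esym_span_E a w : esym_span w -> esym_span (E_ a w).
Proof.
move=> Sw; have -> : E_ a w = (-1) ^+ a *: esym_op a w.
  by rewrite /esym_op scalerA -expr2 sqrr_sign scale1r.
rewrite -[X in X *: _](subrK 1) scalerDl scale1r.
by apply: esym_span_lin; apply: esym_span_op.
Qed.

Section Lift.
Context (N : nat).
Let A (i : 'I_N) := esym_op i.

(** The operators [esym_op] commute, so this is P evaluated at them and applied to [v0]. As [M 0] is
    only a vector space, P is evaluated monomial by monomial. *)
Definition esym_lift (P : {mpoly Qqt[N]}) : M 0 := mlift (fun m => mact A m v0) P.

Lemma esym_lift_linear : linear esym_lift.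
Proof. exact: mlift_linear. Qed.

Lemma f_esym_lift P :
  f (esym_lift P) = SymV 0 (mmap (in_alg Sym) (fun i => esym Qqt (nat_of_ord i).+1) P).
Proof.
elim/mpolyind: P => [|c m P _ _ IH].
  rewrite (lin_0 esym_lift_linear) mmap0 (raddf0 (@SymV 0)).
  exact: (lin_0 (@fL 0)).
rewrite esym_lift_linear fL IH mmapD mmapZ (raddfD (@SymV 0)); congr (_ + _).
rewrite [RHS](rmorphM (@SymV 0)) /= SymV_alg mulr_algl; congr (_ *: _).
rewrite /esym_lift mliftX mmapX.
rewrite (@mact_mul _ _ _ _ (@f 0) (fun i => SymV 0 (esym Qqt (nat_of_ord i).+1))).
  rewrite fv0 mulr1 /mmap1 rmorph_prod; apply: eq_bigr => i _.
  by rewrite rmorphXn.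
by move=> i y; rewrite f_esym_op.
Qed.

Lemma esym_lift_span P : esym_span (esym_lift P).
Proof.
elim/mpolyind: P => [|c m P _ _ IH].
  rewrite (lin_0 esym_lift_linear) -[0](addNr v0) -scaleN1r.
  by apply: esym_span_lin; apply: esym_span_gen.
rewrite esym_lift_linear; apply: esym_span_lin => //.
rewrite /esym_lift mliftX; apply: mact_ind; last exact: esym_span_gen.
by move=> i y; apply: esym_span_op.
Qed.

Lemma esym_liftX i P : esym_lift ('X_i * P) = esym_op i (esym_lift P).
Proof.
elim/mpolyind: P => [|c m P _ _ IH].
  by rewrite mulr0 (lin_0 esym_lift_linear) (lin_0 (@esym_op_linear _)).
rewrite mulrDr -scalerAr !esym_lift_linear IH esym_op_linear; congr (_ *: _ + _).
rewrite -mpolyXD /esym_lift !mliftX mactU // => a b x.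
exact: esym_op_comm.
Qed.

Lemma esym_lift1 : esym_lift 1 = v0.
Proof. by rewrite -mpolyX0 /esym_lift mliftX mact0. Qed.
End Lift.

(** Asking for every large N allows two elements to be written with the same number of variables. *)
Lemma esym_spanP w : esym_span w ->
  exists N0, forall N, (N0 <= N)%N -> exists P : {mpoly Qqt[N]}, w = esym_lift P.
Proof.
elim=> [|c x y _ [N1 H1] _ [N2 H2]|a x _ [N1 H1]].
- by exists 0%N => N _; exists 1; rewrite esym_lift1.
- exists (maxn N1 N2) => N; rewrite geq_max => /andP[/H1[P ->] /H2[Q ->]].
  by exists (c *: P + Q); rewrite esym_lift_linear.
exists (maxn N1 a.+1) => N; rewrite geq_max => /andP[/H1[P ->] aN].
by exists ('X_(Ordinal aN) * P); rewrite esym_liftX.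
Qed.

Lemma esym_span_inj w : esym_span w -> f w = 0 -> w = 0.
Proof.
move=> /esym_spanP[N /(_ _ (leqnn N))[P ->]]; rewrite f_esym_lift => H.
have /esym_free -> : mmap (in_alg Sym) (fun i : 'I_N => esym Qqt i.+1) P = 0.
  exact: (SymV_eq0 H).
exact: (lin_0 (@esym_lift_linear N)).
Qed.

Lemma esym_span_surj F : exists2 w, esym_span w & f w = F.
Proof.
have [G ->] := V0_Sym F; have [N [P ->]] := symfun_esym G.
by exists (esym_lift P); [apply: esym_lift_span | rewrite f_esym_lift].
Qed.

Local Notation Sp := (span T dp dm esym_span).

Lemma span_surj k (F : V k) : exists2 x, Sp x & f x = F.
Proof.
elim/base_ind: F => [G|F F' [x Sx <-] [y Sy <-]|i F ik [x Sx <-]].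
- have [w Sw wE] := esym_span_surj (SymV 0 G); exists (dpn dp k w).
    exact: span_dpn.
  by rewrite f_dpn wE V_dpn.
- exists (x + y); first by rewrite -[x]scale1r; apply: span_lin.
  by rewrite (lin_add (@fL _)).
by exists (Y_ i x); [apply: span_Y | rewrite f_Y].
Qed.

Lemma shift_inj k : injective (@shift qc k).
Proof.
have := @shiftK (fun m => - qc m) k.
have -> : (fun m => - - qc m) = qc by apply: functional_extensionality_dep => m; rewrite opprK.
exact: can_inj.
Qed.

Section Monomials.
Context (k : nat).
Let A (i : 'I_k) := @Y_ k i.

(** Coefficients are vectors of [M 0], hence a list of pairs instead of a polynomial. An exponent
    may occur several times; [sum_by_key] collects the repetitions. *)
Lemma span_monomials (x : M k) : Sp x -> exists l : seq ('X_{1..k} * M 0),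
  (forall p, p \in l -> esym_span p.2)
  /\ x = \sum_(p <- l) mact A p.1 (dpn dp k p.2).
Proof.
have AL m : linear (mact A m).
  by apply: mact_linear => i; apply: (Y_linear D).
elim=> [w Sw|c {}x y _ [l1 [S1 ->]] _ [l2 [S2 ->]]|i {}x ik _ [l [Sl ->]]].
- exists [:: (0%MM, w)]; split=> [p|]; first by rewrite inE => /eqP->.
  by rewrite big_seq1 mact0.
- exists ([seq (p.1, c *: p.2) | p <- l1] ++ l2); split=> [p|].
    rewrite mem_cat => /orP[/mapP[p' /S1 Sp' ->]|/S2//] /=.
    rewrite -[c](subrK 1) scalerDl scale1r; exact: esym_span_lin.
  rewrite big_cat big_map /= scaler_sumr; congr (_ + _); apply: eq_bigr => p _.
  by rewrite (lin_scale (@dpn_linear _ _ _ _ D _)) (lin_scale (AL _)).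
exists [seq ((U_(Ordinal ik) + p.1)%MM, p.2) | p <- l]; split=> [p|].
  by move=> /mapP[p' /Sl Sp' ->].
rewrite big_map (big_morph _ (lin_add (Y_linear D ik)) (lin_0 (Y_linear D ik))).
apply: eq_bigr => p _; rewrite /= mactU // => a b y.
exact: (Y_commute D).
Qed.

Lemma sum_by_key (W : nmodType) (l : seq ('X_{1..k} * M 0)) (F : 'X_{1..k} * M 0 -> W) :
  \sum_(p <- l) F p = \sum_(m <- undup (unzip1 l)) \sum_(p <- l | p.1 == m) F p.
Proof.
under [RHS]eq_bigr do rewrite big_mkcond.
rewrite exchange_big /= big_seq [RHS]big_seq; apply: eq_bigr => p pl.
rewrite (bigD1_seq p.1) ?undup_uniq ?mem_undup ?map_f //= eqxx big1 ?addr0 // => m.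
by rewrite eq_sym => /negPf ->.
Qed.

Lemma f_mact m (x : M k) : f (mact A m x) = ('X_[m] : {mpoly Sym[k]}) * f x :> V k.
Proof.
rewrite (@mact_mul _ _ _ _ (@f k) (@y_ k)) -?mmap1_id //.
by move=> i y; rewrite f_Y // yvE.
Qed.

(** The total coefficient at each exponent m vanishes: its image under [f] is the coefficient of y^m
    in a polynomial over Sym that is 0, and [esym_span_inj] lifts this to [M 0]. *)
Lemma span_inj (x : M k) : Sp x -> f x = 0 -> x = 0.
Proof.
move=> /span_monomials[l [Sl ->]] fx0.
have AL m : linear (mact A m).
  by apply: mact_linear => i; apply: (Y_linear D).
have dL := @dpn_linear _ _ _ _ D k.
rewrite sum_by_key big1_seq // => m _.
rewrite (eq_bigr (fun p => mact A m (dpn dp k p.2))) => [|p /eqP -> //].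
rewrite -(big_morph _ (lin_add (AL m)) (lin_0 (AL m))).
rewrite -(big_morph _ (lin_add dL) (lin_0 dL)).
suff -> : \sum_(p <- l | p.1 == m) p.2 = 0 by rewrite (lin_0 dL) (lin_0 (AL m)).
apply: esym_span_inj.
  elim: l Sl {fx0} => [|p l IH] Sl.
    rewrite big_nil -[0](addNr v0) -scaleN1r.
    by apply: esym_span_lin; apply: esym_span_gen.
  have {}IH := IH (fun p' pl => Sl p' (mem_behead (s := p :: l) pl)).
  rewrite big_cons; case: ifP => // _.
  by rewrite -[p.2]scale1r; apply: esym_span_lin => //; apply: Sl; rewrite mem_head.
have [G GE] : exists G : M 0 -> Sym, forall w, f w = SymV 0 (G w).
  exists (fun w => sval (cid (V0_Sym (f w)))) => w.
  by case: cid.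
have GD w1 w2 : G (w1 + w2) = G w1 + G w2.
  by apply: (@SymV_inj 0); rewrite raddfD /= -!GE (lin_add (@fL _)).
have G0 : G 0 = 0.
  apply: (@SymV_eq0 0); rewrite -GE; exact: (lin_0 (@fL _)).
(* The image of x is a sum of y^m [base k G], so it is the image of this polynomial under the
   injective [shift qc]. *)
have H : \sum_(p <- l) (G p.2) *: 'X_[p.1] = 0 :> {mpoly Sym[k]}.
  apply: shift_inj; rewrite (raddf0 (@shift qc k)) (raddf_sum (@shift qc k)).
  apply: etrans fx0; rewrite (big_morph _ (lin_add (@fL _)) (lin_0 (@fL _))).
  apply: eq_bigr => p _; rewrite f_mact f_dpn GE V_dpn.
  exact: shift_monomial.
move/(congr1 (mcoeff m)): H; rewrite raddf_sum mcoeff0 /= => H.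
have GE0 : G (\sum_(p <- l | p.1 == m) p.2) = 0.
  rewrite (big_morph _ GD G0) [LHS]big_mkcond -[RHS]H.
  apply: eq_bigr => p _; rewrite mcoeffZ mcoeffX.
  by case: eqP => _; rewrite ?mulr1 ?mulr0.
rewrite GE GE0; exact: (raddf0 (@SymV 0)).
Qed.
End Monomials.
End Intertwiner.

(** * The action on V_* and the isomorphism *)

Lemma VdpE k (F : V k) : Vdp F = dplus F.
Proof.
rewrite dpE [@tau]unlock /dplus.
by elim: (iota 1 k) => //= i r ->; rewrite unlock.
Qed.

Lemma VdmE k (F : V k.+1) : Vdm F = dminus F.
Proof. by rewrite unlock. Qed.

Lemma VTE k i (F : V k) : Tl i F = T_ i F.
Proof. by rewrite unlock. Qed.

(* [path_op w g]: the word w, applied to the vertex k, is composable and acts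
   by the operator g. *)
Inductive path_op (M : nat -> Type) (T : forall k, nat -> M k -> M k)
    (dp : forall k, M k -> M k.+1) (dm : forall k, M k.+1 -> M k) (k : nat) :
    seq label -> forall j, (M k -> M j) -> Prop :=
| path_op_nil : path_op T dp dm [::] id
| path_op_plus w j (g : M k -> M j) : path_op T dp dm w g ->
    path_op T dp dm (Lplus :: w) (fun x => dp _ (g x))
| path_op_minus w j (g : M k -> M j.+1) : path_op T dp dm w g ->
    path_op T dp dm (Lminus :: w) (fun x => dm _ (g x))
| path_op_loop w j (g : M k -> M j) i : (0 < i < j)%N -> path_op T dp dm w g ->
    path_op T dp dm (Lloop i :: w) (fun x => T j i (g x)).

Ltac solve_path_op := repeat (first [ apply: path_op_nil | apply: path_op_plus
  | apply: path_op_minus | apply: path_op_loop; first by lia ]).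

Section DirectSumInjection.
Implicit Types v : Vstar.

Lemma dinj_same k (x : V k) : dinj x k = x.
Proof. by rewrite /= dfwith_in. Qed.

Lemma dinj_other k j (x : V k) : k != j -> dinj x j = 0.
Proof. by move=> kj; rewrite /= dfwith_out. Qed.

Lemma dinj_is_linear k : linear (fun x : V k => dinj x : Vstar).
Proof.
move=> c x y; apply: dsum_eq => j; have [<-|kj] := eqVneq k j.
  by rewrite -[RHS]/(c *: dinj x k + dinj y k) !dinj_same.
by rewrite -[RHS]/(c *: dinj x j + dinj y j) !dinj_other // scaler0 addr0.
Qed.

Lemma Vstar_ext v v' : (forall k, v k = v' k) -> v = v'.
Proof. exact: dsum_eq. Qed.
End DirectSumInjection.

(** * The representation of the algebra on V_* *)

Definition label_act (l : label) (k : nat) : Vstar -> Vstar :=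
  match l, k with
  | Lplus, _ => fun v => dinj (Vdp (v k))
  | Lminus, k'.+1 => fun v => dinj (Vdm (v k'.+1))
  | Lminus, 0 => fun=> 0
  | Lloop i, _ => fun v => if (0 < i < k)%N then dinj (Tl i (v k)) else 0
  end.

(** The value 0 on words that do not compose agrees with [pth k w] = 0. The empty word acts by the
    projection to V_k, as e_k must. *)
Fixpoint word_act (k : nat) (w : seq label) (v : Vstar) : Vstar :=
  if w is l :: w' then
    if walk w' k is Some j then label_act l j (word_act k w' v) else 0
  else dinj (v k).

Lemma label_act_linear l k : linear (label_act l k).
Proof.
have DL := dinj_is_linear; have [TL pL mL _ _ _ _ _ _ _ _ _] := V_dyck_module.
move=> c v v'; case: l => [||i] /=.
- by rewrite pL DL.
- by case: k => [|k]; rewrite ?mL ?DL // scaler0 addr0.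
by case: ifP => ik; rewrite ?scaler0 ?addr0 // TL // DL.
Qed.

Lemma word_act_linear k w : linear (word_act k w).
Proof.
move=> c v v'; elim: w => [|l w IH] /=; first exact: dinj_is_linear.
case: walk => [j|]; last by rewrite scaler0 addr0.
by rewrite IH label_act_linear.
Qed.

Lemma label_act_out l k (v : Vstar) j : step l k != Some j -> label_act l k v j = 0.
Proof.
case: l => [||i] /= H; first by rewrite -[LHS]/(dinj _ j) dinj_other.
  by case: k H => // k H; rewrite -[LHS]/(dinj _ j) dinj_other.
by case: ifP H => // _ H; rewrite -[LHS]/(dinj _ j) dinj_other.
Qed.

Lemma word_act_out k w (v : Vstar) j : walk w k != Some j -> word_act k w v j = 0.
Proof.
case: w => [|l w] /=; first by move=> H; rewrite -[LHS]/(dinj _ j) dinj_other.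
by case: walk => //= i; apply: label_act_out.
Qed.

Lemma word_act_none k w (v : Vstar) : walk w k = None -> word_act k w v = 0.
Proof. by move=> wk; apply: Vstar_ext => j; rewrite word_act_out // wk. Qed.

Lemma word_act_cat k w1 w2 (v : Vstar) : word_act k (w1 ++ w2) v =
  if walk w2 k is Some j then word_act j w1 (word_act k w2 v) else 0.
Proof.
case E : (walk w2 k) => [j|]; last by apply: word_act_none; rewrite walk_cat E.
elim: w1 => [|l w IH] /=.
  apply: Vstar_ext => i; have [<-|ij] := eqVneq j i.
    by rewrite -[RHS]/(dinj _ j) dinj_same.
  by rewrite word_act_out ?E // -[RHS]/(dinj _ i) dinj_other.
by rewrite walk_cat E /= IH.
Qed.

Lemma word_act_path_op k w j (g : V k -> V j) :
  path_op (fun k i => @Tl k i) (@Vdp) (@Vdm) w g ->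
  walk w k = Some j /\ forall v : Vstar, word_act k w v = dinj (g (v k)).
Proof.
elim=> {w j g} [|w j g _ [wk IH]|w j g _ [wk IH]|w j g i ij _ [wk IH]] //=; rewrite wk /=.
- by split=> // v; rewrite IH dinj_same.
- by split=> // v; rewrite IH dinj_same.
by rewrite ij; split=> // v; rewrite IH dinj_same.
Qed.

Definition path_act (a : path_alg) (v : Vstar) : Vstar :=
  fglift (fun p : qpath => word_act (source p) (word p) v) a.

Lemma path_act_pth k w (v : Vstar) : path_act (pth k w) v = word_act k w v.
Proof.
rewrite /path_act /pth; case: insubP => [p _ pE|].
  by rewrite liftU scale1r /source /word pE.
by rewrite negbK => /eqP /= wk; rewrite raddf0 word_act_none.
Qed.

Lemma path_act_linearl v c a b : path_act (c *: a + b) v = c *: path_act a v + path_act b v.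
Proof. by rewrite /path_act raddfD /= fgliftZ. Qed.

Lemma path_act_linear a : linear (path_act a).
Proof. by move=> c v v'; apply: fglift_linearf => p; apply: word_act_linear. Qed.

Lemma path_act_subl a b v : path_act (a - b) v = path_act a v - path_act b v.
Proof. exact: raddfB. Qed.

Lemma path_act0l v : path_act 0 v = 0.
Proof. exact: raddf0. Qed.

Lemma path_actM a b v : path_act (pmul a b) v = path_act a (path_act b v).
Proof.
elim/path_alg_ind: a => [|x k w a IH]; first by rewrite pmul0l !path_act0l.
rewrite pmul_linearl !path_act_linearl {}IH; congr (_ *: _ + _).
elim/path_alg_ind: b => [|y l u b IH].
  by rewrite pmul0r !path_act0l (lin_0 (@path_act_linear _)).
rewrite pmul_linearr !path_act_linearl path_act_linear {}IH; congr (_ *: _ + _).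
rewrite pth_comp !path_act_pth; case: eqP => [E|E]; first by rewrite path_act_pth word_act_cat E.
rewrite path_act0l.
(* The path u does not end at k, so its output has no component there, and w only reads that
   component. *)
have -> : word_act k w (word_act l u v) = word_act k w 0.
  elim: w => [|c w /= ->] //=.
  by rewrite word_act_out; [|apply/eqP].
by rewrite (lin_0 (@word_act_linear _ _)).
Qed.

Lemma path_act_op k w j (g : V k -> V j) v :
  path_op (fun k i => @Tl k i) (@Vdp) (@Vdm) w g ->
  path_act (pth k w) v = dinj (g (v k)).
Proof. by move=> /word_act_path_op[_ H]; rewrite path_act_pth H. Qed.

Lemma path_act_op_sub k w w' j (g g' : V k -> V j) v :
  path_op (fun k i => @Tl k i) (@Vdp) (@Vdm) w g ->
  path_op (fun k i => @Tl k i) (@Vdp) (@Vdm) w' g' ->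
  path_act (pth k w - pth k w') v = dinj (g (v k) - g' (v k)).
Proof.
move=> /path_act_op wg /path_act_op wg'.
by rewrite (lin_sub (@dinj_is_linear _)) -wg -wg' path_act_subl.
Qed.

Lemma path_act_scale c a v : path_act (c *: a) v = c *: path_act a v.
Proof. exact: fgliftZ. Qed.

Lemma path_act_rel a b v : dyck_rel a b -> path_act a v = path_act b v.
Proof.
have DL k := @dinj_is_linear k.
have [TL _ _ quad braid far Tm pT Tpp mmT cm cp] := V_dyck_module.
case=> {a b} [k i ik|k i i0 ik|k i j ik jk ij|k i i0 ik|k i ik|k|k k2|k k2|k k1].
- rewrite path_actM path_act0l path_act_subl.
  have loop u : path_act (pth k [:: Lloop i]) u = dinj (Tl i (u k)).
    by rewrite (@path_act_op _ _ _ (fun x => Tl i x)); last solve_path_op.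
  have nil u : path_act (pth k [::]) u = dinj (u k).
    by rewrite (@path_act_op _ _ _ id); last solve_path_op.
  have -> : path_act (pth k [:: Lloop i] + q *: pth k [::]) v
      = dinj (q *: v k + Tl i (v k)).
    by rewrite addrC path_act_linearl loop nil -DL.
  rewrite loop nil !dinj_same -(lin_sub (@DL _)) TL // quad //.
  rewrite addrA -scalerDl [q + _]addrC subrK scale1r [Tl i (v k) + _]addrC subrr.
  by rewrite (lin_0 (@DL _)).
- rewrite (@path_act_op _ _ _ (fun x : V k => Tl i (Tl i.+1 (Tl i x)))); last solve_path_op.
  rewrite (@path_act_op _ _ _ (fun x : V k => Tl i.+1 (Tl i (Tl i.+1 x)))); last solve_path_op.
  by rewrite braid.
- rewrite (@path_act_op _ _ _ (fun x : V k => Tl i (Tl j x))); last solve_path_op.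
  rewrite (@path_act_op _ _ _ (fun x : V k => Tl j (Tl i x))); last solve_path_op.
  by rewrite far.
- case: k ik => // k ik.
  rewrite (@path_act_op _ _ _ (fun x : V k.+1 => Tl i (Vdm x))); last solve_path_op.
  rewrite (@path_act_op _ _ _ (fun x : V k.+1 => Vdm (Tl i x))); last solve_path_op.
  by rewrite Tm ?i0.
- rewrite (@path_act_op _ _ _ (fun x : V k => Vdp (Tl i x))); last solve_path_op.
  rewrite (@path_act_op _ _ _ (fun x : V k => Tl i.+1 (Vdp x))); last solve_path_op.
  by rewrite pT.
- rewrite (@path_act_op _ _ _ (fun x : V k => Tl 1 (Vdp (Vdp x)))); last solve_path_op.
  rewrite (@path_act_op _ _ _ (fun x : V k => Vdp (Vdp x))); last solve_path_op.
  by rewrite Tpp.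
- case: k k2 => [|[|k]] // _.
  rewrite (@path_act_op _ _ _ (fun x : V k.+2 => Vdm (Vdm (Tl k.+1 x)))); last solve_path_op.
  rewrite (@path_act_op _ _ _ (fun x : V k.+2 => Vdm (Vdm x))); last solve_path_op.
  by rewrite mmT.
- case: k k2 => [|[|k]] // _.
  rewrite path_act_scale.
  rewrite (@path_act_op_sub _ _ _ _ (fun x : V k.+2 => Vdm (Vdp (Vdm (Tl k.+1 x))))
    (fun x => Vdm (Vdm (Vdp (Tl k.+1 x))))); [|solve_path_op..].
  rewrite (@path_act_op_sub _ _ _ _ (fun x : V k.+2 => Vdp (Vdm (Vdm x)))
    (fun x => Vdm (Vdp (Vdm x)))); [|solve_path_op..].
  by rewrite cm (lin_scale (@DL _)).
case: k k1 => // k _.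
rewrite path_act_scale.
rewrite (@path_act_op_sub _ _ _ _ (fun x : V k.+1 => Tl 1 (Vdp (Vdm (Vdp x))))
  (fun x => Tl 1 (Vdm (Vdp (Vdp x))))); [|solve_path_op..].
rewrite (@path_act_op_sub _ _ _ _ (fun x : V k.+1 => Vdp (Vdp (Vdm x)))
  (fun x => Vdp (Vdm (Vdp x)))); [|solve_path_op..].
by rewrite cp (lin_scale (@DL _)).
Qed.

Lemma path_act_ideal a v : in_dyck_ideal a -> path_act a v = 0.
Proof.
move=> H; elim: H v => {a} [a b ab|//|c a b _ IHa _ IHb|c a _ IH|c a _ IH] v.
- by rewrite path_act_subl (path_act_rel _ ab) subrr.
- exact: path_act0l.
- by rewrite path_act_linearl IHa IHb scaler0 addr0.
- by rewrite path_actM IH (lin_0 (@path_act_linear _)).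
- by rewrite path_actM IH.
Qed.

Definition dyck_rho (x : dyck_alg) (v : Vstar) : Vstar := path_act (drepr x) v.

Lemma dyck_rho_dpi a v : dyck_rho (dpi a) v = path_act a v.
Proof.
apply/eqP; rewrite -subr_eq0 -path_act_subl; apply/eqP.
exact/path_act_ideal/dpi_reprB.
Qed.

Lemma dyck_rho_representation : is_representation dyck_rho.
Proof.
split=> [c a b v|a|a b v].
- rewrite -[a]dpiK -[b]dpiK -dpiZ -dpiD !dyck_rho_dpi; exact: path_act_linearl.
- exact: path_act_linear.
- rewrite -[a]dpiK -[b]dpiK dpi_mul !dyck_rho_dpi; exact: path_actM.
Qed.


(** * The spaces e_k A e_0 as a module of the same kind *)

Lemma dyck_mulr_linear x : linear (dyck_mul x).
Proof. by move=> c y z; apply: dyck_mul_linearr. Qed.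

Lemma dyck_mull_linear z : linear (dyck_mul^~ z).
Proof. by move=> c x y; apply: dyck_mul_linearl. Qed.

Lemma dpi0 : dpi 0 = 0.
Proof. exact: raddf0. Qed.

Lemma e_word k w j : walk w k = Some j ->
  dyck_mul (e_ j) (dpi (pth k w)) = dpi (pth k w).
Proof. by move=> wk; rewrite dpi_mul pth_comp wk eqxx. Qed.

Lemma e_word_neq k w j : walk w k <> Some j -> dyck_mul (e_ j) (dpi (pth k w)) = 0.
Proof. by move=> wk; rewrite dpi_mul pth_comp; case: eqP => // _; apply: dpi0. Qed.

Lemma arr_word l k w j : walk w k = Some j ->
  dyck_mul (arr l j) (dpi (pth k w)) = dpi (pth k (l :: w)).
Proof. by move=> wk; rewrite dpi_mul pth_comp wk eqxx. Qed.

(** As e_k and e_0 are idempotent, these two equations describe e_k A e_0 without an existential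
    witness, and are linear in x. *)
Definition in_corner k (x : dyck_alg) : bool :=
  (dyck_mul (e_ k) x == x) && (dyck_mul x (e_ 0) == x).

Fact in_corner_submod k : submod_closed (in_corner k).
Proof.
split=> [|c x y]; rewrite !unfold_in /in_corner.
  by rewrite (lin_0 (@dyck_mulr_linear _)) (lin_0 (@dyck_mull_linear _)) eqxx.
move=> /andP[/eqP x1 /eqP x2] /andP[/eqP y1 /eqP y2].
by rewrite dyck_mul_linearr dyck_mul_linearl x1 x2 y1 y2 eqxx.
Qed.
HB.instance Definition _ k :=
  GRing.isSubmodClosed.Build Qqt dyck_alg (in_corner k) (@in_corner_submod k).

Record corner k := MkCorner { corner_val :> dyck_alg; _ : corner_val \in in_corner k }.
HB.instance Definition _ k := [isSub for @corner_val k].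
HB.instance Definition _ k := [Choice of corner k by <:].
HB.instance Definition _ k := [SubChoice_isSubLmodule of corner k by <:].

Lemma corner_val_linear k : linear (@corner_val k).
Proof. exact: (linearP (\val : corner k -> dyck_alg)). Qed.

Lemma corner_e k (x : corner k) : dyck_mul (e_ k) x = x.
Proof. by case: x => x /= /andP[/eqP]. Qed.

Lemma corner_e0 k (x : corner k) : dyck_mul x (e_ 0) = x.
Proof. by case: x => x /= /andP[_ /eqP]. Qed.

(** The alternative [None] serves [corner_T], which is total in i: for i out of range the arrow is
    0. *)
Lemma corner_op_subproof l k j (x : corner k) : step l k = Some j \/ step l k = None ->
  dyck_mul (arr l k) x \in in_corner j.
Proof.
move=> lk; rewrite unfold_in /in_corner -dyck_mulA corner_e0 eqxx andbT dyck_mulA.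
case: lk => lk; first by rewrite e_word.
by rewrite /arr pth0 /= ?lk // dpi0 !(lin_0 (@dyck_mull_linear _), lin_0 (@dyck_mulr_linear _)).
Qed.

Lemma step_loop i k : step (Lloop i) k = Some k \/ step (Lloop i) k = None.
Proof. by rewrite /=; case: ifP; [left | right]. Qed.

Definition corner_T k i (x : corner k) : corner k :=
  MkCorner (corner_op_subproof x (step_loop i k)).
Definition corner_dp k (x : corner k) : corner k.+1 :=
  MkCorner (corner_op_subproof (l := Lplus) x (or_introl erefl)).
Definition corner_dm k (x : corner k.+1) : corner k :=
  MkCorner (corner_op_subproof (l := Lminus) x (or_introl erefl)).

Lemma corner_path_op k w j (g : corner k -> corner j) :
  path_op corner_T corner_dp corner_dm w g ->
  walk w k = Some j /\ forall x : corner k, dyck_mul (dpi (pth k w)) x = g x :> dyck_alg.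
Proof.
elim=> {w j g} [|w j g _ [wk IH]|w j g _ [wk IH]|w j g i ij _ [wk IH]] /=; rewrite ?wk /=.
- by split=> // x; apply: corner_e.
- by split=> // x; rewrite -(arr_word _ wk) -dyck_mulA IH.
- by split=> // x; rewrite -(arr_word _ wk) -dyck_mulA IH.
by rewrite ij; split=> // x; rewrite -(arr_word _ wk) -dyck_mulA IH.
Qed.

Lemma corner_op k w j (g : corner k -> corner j) x :
  path_op corner_T corner_dp corner_dm w g ->
  corner_val (g x) = dyck_mul (dpi (pth k w)) x.
Proof. by move=> /corner_path_op[_ ->]. Qed.

Lemma dpi_rel a b : dyck_rel a b -> dpi a = dpi b.
Proof. by move=> ab; apply/dpi_eq; apply: ideal_rel. Qed.

Lemma dpi_sub a b : dpi (a - b) = dpi a - dpi b.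
Proof. exact: raddfB. Qed.

Lemma corner_op_linear k j (f : corner k -> corner j) b :
  (forall x, corner_val (f x) = dyck_mul b x) -> linear f.
Proof.
move=> fE c x y; apply: val_inj; rewrite [LHS]fE [RHS](@corner_val_linear j) !fE.
by rewrite corner_val_linear dyck_mul_linearr.
Qed.

Lemma corner_T_linear k i : linear (@corner_T k i).
Proof. exact: (@corner_op_linear _ _ _ (arr (Lloop i) k)). Qed.

Lemma corner_quad k i (x : corner k) : (0 < i < k)%N ->
  corner_T i (corner_T i x) = (1 - q) *: corner_T i x + q *: x.
Proof.
move=> ik; have vL := @corner_val_linear k.
have mL z := @dyck_mull_linear z.
have opT (y : corner k) : dyck_mul (dpi (pth k [:: Lloop i])) y = corner_T i y :> dyck_alg.
  by [].
have op1 (y : corner k) : dyck_mul (dpi (pth k [::])) y = y :> dyck_alg := corner_e y.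
(* This is (T_i + q) x, which the defining relation says is killed by T_i - 1. *)
pose z := q *: x + corner_T i x.
have E1 : corner_val (corner_T i z - z)
    = dyck_mul (dpi (pth k [:: Lloop i] - pth k [::])) z.
  by rewrite (lin_sub vL) -opT -[X in _ - X]op1 -(lin_sub (mL _)) -dpi_sub.
have E2 : corner_val z = dyck_mul (dpi (pth k [:: Lloop i] + q *: pth k [::])) x.
  rewrite /z vL -opT -[X in q *: X + _]op1 -dyck_mul_linearl -dpiZ -dpiD.
  by rewrite [q *: _ + _]addrC.
have : corner_T i z - z = 0.
  apply: val_inj; rewrite [LHS]E1 [RHS](lin_0 vL) E2.
  rewrite dyck_mulA dpi_mul (dpi_rel (rel_quadratic ik)) dpi0.
  exact: (lin_0 (mL _)).
move=> /eqP; rewrite subr_eq0 /z corner_T_linear => /eqP E.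
apply: (addrI (q *: corner_T i x)); rewrite E addrA -scalerDl [q + _]addrC subrK scale1r.
by rewrite addrC.
Qed.

Lemma corner_sub k w w' j (g g' : corner k -> corner j) (x : corner k) :
  path_op corner_T corner_dp corner_dm w g ->
  path_op corner_T corner_dp corner_dm w' g' ->
  corner_val (g x - g' x) = dyck_mul (dpi (pth k w - pth k w')) x.
Proof.
move=> /corner_op wg /corner_op wg'; rewrite (lin_sub (@corner_val_linear _)) wg wg'.
by rewrite dpi_sub (lin_sub (@dyck_mull_linear _)).
Qed.

Lemma corner_dyck_module : @dyck_module corner (@corner_T) (@corner_dp) (@corner_dm).
Proof.
have vL k := @corner_val_linear k.
split.
- by move=> k i _; apply: corner_T_linear.
- by move=> k; apply: (@corner_op_linear _ _ _ (arr Lplus k)).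
- by move=> k; apply: (@corner_op_linear _ _ _ (arr Lminus k.+1)).
- exact: corner_quad.
- move=> k i x i0 ik; apply: val_inj.
  rewrite [LHS](@corner_op _ [:: Lloop i; Lloop i.+1; Lloop i] _
    (fun x : corner k => corner_T i (corner_T i.+1 (corner_T i x)))); last solve_path_op.
  rewrite [RHS](@corner_op _ [:: Lloop i.+1; Lloop i; Lloop i.+1] _
    (fun x : corner k => corner_T i.+1 (corner_T i (corner_T i.+1 x)))); last solve_path_op.
  by rewrite (dpi_rel (rel_braid i0 ik)).
- move=> k i j x ik jk ij; apply: val_inj.
  rewrite [LHS](@corner_op _ [:: Lloop i; Lloop j] _ (fun x : corner k => corner_T i (corner_T j x)));
    last solve_path_op.
  rewrite [RHS](@corner_op _ [:: Lloop j; Lloop i] _ (fun x : corner k => corner_T j (corner_T i x)));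
    last solve_path_op.
  by rewrite (dpi_rel (rel_commute ik jk ij)).
- move=> k i x ik; apply: val_inj.
  rewrite [LHS](@corner_op _ [:: Lloop i; Lminus] _ (fun x : corner k.+1 => corner_T i (corner_dm x)));
    last solve_path_op.
  rewrite [RHS](@corner_op _ [:: Lminus; Lloop i] _ (fun x : corner k.+1 => corner_dm (corner_T i x)));
    last solve_path_op.
  by have /andP[i0 ik'] := ik; rewrite (dpi_rel (rel_loop_minus (k := k.+1) i0 ik')).
- move=> k i x ik; apply: val_inj.
  rewrite [LHS](@corner_op _ [:: Lplus; Lloop i] _ (fun x : corner k => corner_dp (corner_T i x)));
    last solve_path_op.
  rewrite [RHS](@corner_op _ [:: Lloop i.+1; Lplus] _ (fun x : corner k => corner_T i.+1 (corner_dp x)));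
    last solve_path_op.
  by rewrite (dpi_rel (rel_plus_loop ik)).
- move=> k x; apply: val_inj.
  rewrite [LHS](@corner_op _ [:: Lloop 1; Lplus; Lplus] _ (fun x : corner k => corner_T 1 (corner_dp (corner_dp x))));
    last solve_path_op.
  rewrite [RHS](@corner_op _ [:: Lplus; Lplus] _ (fun x : corner k => corner_dp (corner_dp x)));
    last solve_path_op.
  by rewrite (dpi_rel (rel_plus_plus k)).
- move=> k x; apply: val_inj.
  rewrite [LHS](@corner_op _ [:: Lminus; Lminus; Lloop k.+1] _
    (fun x : corner k.+2 => corner_dm (corner_dm (corner_T k.+1 x)))); last solve_path_op.
  rewrite [RHS](@corner_op _ [:: Lminus; Lminus] _ (fun x : corner k.+2 => corner_dm (corner_dm x)));
    last solve_path_op.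
  by rewrite (dpi_rel (rel_minus_minus (k := k.+2) isT)).
- move=> k x; apply: val_inj; rewrite [RHS](lin_scale (vL _)).
  rewrite [LHS](@corner_sub _ [:: Lminus; Lplus; Lminus; Lloop k.+1]
    [:: Lminus; Lminus; Lplus; Lloop k.+1] _
    (fun x : corner k.+2 => corner_dm (corner_dp (corner_dm (corner_T k.+1 x))))
    (fun x => corner_dm (corner_dm (corner_dp (corner_T k.+1 x))))); [|solve_path_op..].
  rewrite (@corner_sub _ [:: Lplus; Lminus; Lminus] [:: Lminus; Lplus; Lminus] _
    (fun x : corner k.+2 => corner_dp (corner_dm (corner_dm x)))
    (fun x => corner_dm (corner_dp (corner_dm x)))); [|solve_path_op..].
  rewrite (dpi_rel (rel_comm_minus (k := k.+2) isT)) dpiZ.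
  exact: (lin_scale (@dyck_mull_linear _)).
move=> k x; apply: val_inj; rewrite [RHS](lin_scale (vL _)).
rewrite [LHS](@corner_sub _ [:: Lloop 1; Lplus; Lminus; Lplus]
  [:: Lloop 1; Lminus; Lplus; Lplus] _
  (fun x : corner k.+1 => corner_T 1 (corner_dp (corner_dm (corner_dp x))))
  (fun x => corner_T 1 (corner_dm (corner_dp (corner_dp x))))); [|solve_path_op..].
rewrite (@corner_sub _ [:: Lplus; Lplus; Lminus] [:: Lplus; Lminus; Lplus] _
  (fun x : corner k.+1 => corner_dp (corner_dp (corner_dm x)))
  (fun x => corner_dp (corner_dm (corner_dp x)))); [|solve_path_op..].
rewrite (dpi_rel (rel_comm_plus (k := k.+1) isT)) dpiZ.
exact: (lin_scale (@dyck_mull_linear _)).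
Qed.

(** * The isomorphism *)

Definition vac : Vstar := dinj (1 : V 0).

Lemma dyck_rhoM a b v : dyck_rho (dyck_mul a b) v = dyck_rho a (dyck_rho b v).
Proof. by have [_ _ ->] := dyck_rho_representation. Qed.

Lemma dyck_rho_linearl v : linear (dyck_rho^~ v).
Proof. by have [H _ _] := dyck_rho_representation => c a b; apply: H. Qed.

Lemma dyck_rho_e k v : dyck_rho (e_ k) v = dinj (v k).
Proof. by rewrite dyck_rho_dpi path_act_pth. Qed.

Lemma dyck_rho_dp k v : dyck_rho (arr Lplus k) v = dinj (Vdp (v k)).
Proof.
by rewrite dyck_rho_dpi path_act_pth -[LHS]/(dinj (Vdp (dinj (v k) k))) dinj_same.
Qed.

Lemma dyck_rho_dm k v : dyck_rho (arr Lminus k.+1) v = dinj (Vdm (v k.+1)).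
Proof.
rewrite dyck_rho_dpi path_act_pth -[LHS]/(dinj (Vdm (dinj (v k.+1) k.+1))).
by rewrite dinj_same.
Qed.

Lemma dyck_rho_T k i v : (0 < i < k)%N ->
  dyck_rho (arr (Lloop i) k) v = dinj (Tl i (v k)).
Proof.
move=> ik; rewrite dyck_rho_dpi path_act_pth.
rewrite -[LHS]/(if (0 < i < k)%N then dinj (Tl i (dinj (v k) k)) else 0).
by rewrite ik dinj_same.
Qed.

Definition corner_phi k (x : corner k) : V k := dyck_rho x vac k.

Lemma corner_rho k (x : corner k) : dyck_rho x vac = dinj (corner_phi x).
Proof. by rewrite -{1}corner_e dyck_rhoM dyck_rho_e. Qed.

Lemma corner_phi_linear k : linear (@corner_phi k).
Proof. by move=> c x y; rewrite /corner_phi corner_val_linear dyck_rho_linearl. Qed.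

Lemma corner_phi_T k i (x : corner k) : (0 < i < k)%N ->
  corner_phi (corner_T i x) = Tl i (corner_phi x).
Proof. by move=> ik; rewrite {1}/corner_phi dyck_rhoM dyck_rho_T // dinj_same. Qed.

Lemma corner_phi_dp k (x : corner k) : corner_phi (corner_dp x) = Vdp (corner_phi x).
Proof. by rewrite {1}/corner_phi dyck_rhoM dyck_rho_dp dinj_same. Qed.

Lemma corner_phi_dm k (x : corner k.+1) : corner_phi (corner_dm x) = Vdm (corner_phi x).
Proof. by rewrite {1}/corner_phi dyck_rhoM dyck_rho_dm dinj_same. Qed.

Lemma corner_vac_subproof : e_ 0 \in in_corner 0.
Proof. by rewrite unfold_in /in_corner !e_word // eqxx. Qed.

Definition corner_vac : corner 0 := MkCorner corner_vac_subproof.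

Lemma corner_phi_vac : corner_phi corner_vac = 1.
Proof. by rewrite /corner_phi dyck_rho_e dinj_same /vac dinj_same. Qed.

Definition corner_span k : corner k -> Prop :=
  span corner_T corner_dp corner_dm
    (esym_span corner_T corner_dp corner_dm corner_vac) (k := k).

Lemma corner_phi_inj k (x : corner k) : corner_span x -> corner_phi x = 0 -> x = 0.
Proof.
exact: (span_inj corner_dyck_module corner_phi_linear corner_phi_T corner_phi_dp
  corner_phi_dm corner_phi_vac).
Qed.

Lemma corner_phi_surj k (F : V k) : exists x : corner k, corner_phi x = F.
Proof.
have [x _ xF] := span_surj corner_phi_linear corner_phi_T
  corner_phi_dp corner_phi_dm corner_phi_vac F.
by exists x.
Qed.

Lemma corner_span0 k : corner_span (0 : corner k).
Proof.
have vS : corner_span (dpn corner_dp k corner_vac).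
  exact/span_dpn/esym_span_gen.
rewrite -[0](addNr (dpn corner_dp k corner_vac)) -scaleN1r.
exact: span_lin.
Qed.

(** A word starting at vertex 0 is built arrow by arrow from e_0, and the span is stable under each
    arrow. *)
Lemma corner_span_word w k : walk w 0 = Some k ->
  exists2 x : corner k, corner_span x & corner_val x = dpi (pth 0 w).
Proof.
have D := corner_dyck_module.
have SL := @esym_span_lin _ corner_T corner_dp corner_dm corner_vac.
have SE := @esym_span_E _ corner_T corner_dp corner_dm corner_vac.
elim: w k => [|l w IH] k /=.
  by case=> <-; exists corner_vac => //; exact: (@span_dpn _ _ _ _ _ 0 corner_vac (esym_span_gen _ _ _ _)).
case E : (walk w 0) => [j|] //= lj; have [x Sx xE] := IH _ E.
rewrite -(arr_word l E) -xE.
case: l lj => [[<-]|lj|i].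
- by exists (corner_dp x) => //; apply: (span_dp D).
- case: j lj x Sx xE E => //= j [<-] x Sx xE E.
  by exists (corner_dm x) => //; apply: (span_dm D).
rewrite /=; case: ifP => // ij [<-].
by exists (corner_T i x) => //; apply: (span_T D).
Qed.

(** Between the two idempotents only paths from 0 to k survive, so the span is all of e_k A e_0. *)
Lemma corner_span_proj k a :
  exists2 x : corner k, corner_span x & corner_val x = dyck_mul (e_ k) (dyck_mul a (e_ 0)).
Proof.
rewrite -[a]dpiK; elim/path_alg_ind: (drepr a) => [|c l w b [x Sx xE]].
  exists 0; first exact: corner_span0.
  rewrite (lin_0 (@corner_val_linear _)) dpi0.
  by rewrite (lin_0 (@dyck_mull_linear _)) (lin_0 (@dyck_mulr_linear _)).
rewrite dpiD dpiZ dyck_mul_linearl dyck_mul_linearr -xE {xE}.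
suff [y Sy yE] : exists2 y : corner k, corner_span y &
    corner_val y = dyck_mul (e_ k) (dyck_mul (dpi (pth l w)) (e_ 0)).
  exists (c *: y + x); first exact: span_lin.
  by rewrite corner_val_linear yE.
rewrite {2}/e_ dpi_mul pth_comp /= cats0; case: eqP => [_|_].
  have [wk|wk] := eqVneq (walk w 0) (Some k).
    by have [y Sy yE] := corner_span_word wk; exists y => //; rewrite e_word.
  exists 0; first exact: corner_span0.
  by rewrite e_word_neq ?(lin_0 (@corner_val_linear _)) //; apply/eqP.
exists 0; first exact: corner_span0.
by rewrite (lin_0 (@corner_val_linear _)) dpi0 (lin_0 (@dyck_mulr_linear _)).
Qed.

(** An element involves finitely many paths, so a finite sum of the e_k acts on it as the missing
    unit does. The bound is upward closed so that it can be shared by two summands. *)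
Lemma dyck_alg_components (a : dyck_alg) : exists N0, forall N, (N0 <= N)%N ->
  a = \sum_(k < N) dyck_mul (e_ k) a.
Proof.
rewrite -[a]dpiK; elim/path_alg_ind: (drepr a) => [|c k w b [N1 H1]].
  exists 0%N => N _; rewrite dpi0 big1 // => i _.
  exact: (lin_0 (@dyck_mulr_linear _)).
case E : (walk w k) => [j|]; last first.
  by exists N1; rewrite pth0 // scaler0 add0r.
exists (maxn N1 j.+1) => N; rewrite geq_max => /andP[/H1 {}H1 jN].
rewrite dpiD dpiZ; under eq_bigr do rewrite dyck_mul_linearr.
rewrite big_split /= -H1 -scaler_sumr; congr (_ *: _ + _).
rewrite (bigD1 (Ordinal jN)) //= e_word // big1 ?addr0 // => i ij.
apply: e_word_neq; rewrite E => -[ji]; case/eqP: ij.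
exact/val_inj.
Qed.

Definition dyck_phi (x : Ae0) : Vstar := dyck_rho x vac.

Lemma Ae0_val_linear : linear Ae0_val.
Proof. exact: (linearP (\val : Ae0 -> dyck_alg)). Qed.

Lemma dyck_phi_linear : linear dyck_phi.
Proof. by move=> c x y; rewrite /dyck_phi Ae0_val_linear dyck_rho_linearl. Qed.
HB.instance Definition _ :=
  GRing.isLinear.Build Qqt Ae0 Vstar _ dyck_phi dyck_phi_linear.

Lemma corner_Ae0_subproof k (x : corner k) : corner_val x \in in_Ae0.
Proof. by rewrite unfold_in; apply/asboolP; exists x; rewrite corner_e0. Qed.

Definition corner_Ae0 k (x : corner k) : Ae0 := MkAe0 (corner_Ae0_subproof x).

Lemma corner_Ae0_phi k (x : corner k) : dyck_phi (corner_Ae0 x) = dinj (corner_phi x).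
Proof. exact: corner_rho. Qed.

(** Each e_k x lies in the span, where [corner_phi] is injective, and its image is the component in
    V_k of the image of x; the e_k x add up to x. *)
Lemma dyck_phi_inj : injective dyck_phi.
Proof.
suff phi0 x : dyck_phi x = 0 -> x = 0.
  move=> x y xy; apply/eqP; rewrite -subr_eq0; apply/eqP/phi0.
  by rewrite (lin_sub dyck_phi_linear) xy subrr.
move=> x0; apply: val_inj; rewrite [RHS](lin_0 Ae0_val_linear) /=.
have [N /(_ _ (leqnn N)) ->] := dyck_alg_components (Ae0_val x).
rewrite big1 // => k _.
have /asboolP[a aE] : Ae0_val x \in in_Ae0 by case: (x).
have [y Sy yE] := corner_span_proj k a.
rewrite aE -yE (_ : y = 0) ?(lin_0 (@corner_val_linear _)) //.
apply: corner_phi_inj => //.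
rewrite /corner_phi yE -aE dyck_rhoM dyck_rho_e dinj_same.
by rewrite -[dyck_rho _ _]/(dyck_phi x) x0.
Qed.

Lemma Vstar_sum (v : Vstar) N : (forall k, (N <= k)%N -> v k = 0) ->
  v = \sum_(k < N) dinj (v k).
Proof.
move=> vN; apply: Vstar_ext => j.
have evL : linear (fun u : Vstar => u j) by [].
rewrite (big_morph (fun u : Vstar => u j) (lin_add evL) (lin_0 evL)).
case: (ltnP j N) => jN; last first.
  rewrite vN // big1 // => i _; apply: dinj_other.
  by rewrite neq_ltn (leq_trans (ltn_ord i) jN).
rewrite (bigD1 (Ordinal jN)) // dinj_same big1 => [|i ij].
  by symmetry; apply: addr0.
by apply: dinj_other; apply: contraNneq ij => ij; apply/eqP/val_inj.
Qed.

Lemma dyck_phi_surj v : exists x, dyck_phi x = v.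
Proof.
have [N vN] := dsumP v; rewrite (Vstar_sum vN).
elim/big_ind: _ => [|_ _ [x <-] [y <-]|k _].
- by exists 0; apply: (lin_0 dyck_phi_linear).
- by exists (x + y); apply: (lin_add dyck_phi_linear).
have [x <-] := corner_phi_surj (v k).
by exists (corner_Ae0 x); apply: corner_Ae0_phi.
Qed.

Theorem theorem5p3 :
  exists rho : dyck_alg -> Vstar -> Vstar,
    [/\ is_representation rho,
        (forall k (v : Vstar), rho (e_ k) v = dinj (v k)),
        (forall k (v : Vstar), rho (arr Lplus k) v = dinj (dplus (v k))),
        (forall k (v : Vstar), rho (arr Lminus k.+1) v = dinj (dminus (v k.+1)))
      & (forall k i (v : Vstar), (0 < i < k)%N ->
           rho (arr (Lloop i) k) v = dinj (T_ i (v k)))]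
    /\
    exists phi : {linear Ae0 -> Vstar},
      [/\ bijective phi,
          (forall a x, phi (Ae0_mul a x) = rho a (phi x)),
          phi e0 = dinj (1 : V 0)
        & (forall k (v : Vstar),
             (exists2 x, in_ekAe0 k x & phi x = v)
             <-> (exists F : V k, v = dinj F))].
Proof.
exists dyck_rho; split.
  split=> [|k v|k v|k v|k i v ik]; first exact: dyck_rho_representation.
  - exact: dyck_rho_e.
  - by rewrite dyck_rho_dp VdpE.
  - by rewrite dyck_rho_dm VdmE.
  - by rewrite dyck_rho_T // VTE.
exists dyck_phi; split=> [|a x||k v].
- exists (fun v => sval (cid (dyck_phi_surj v))) => [x|v]; last by case: cid.
  by apply: dyck_phi_inj; case: cid.
- exact: dyck_rhoM.
- by rewrite -[LHS]/(dyck_rho (e_ 0) vac) dyck_rho_e dinj_same.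
split=> [[x [a xE] <-]|[F ->]].
  exists (dyck_rho (dyck_mul a (e_ 0)) vac k).
  by rewrite -[LHS]/(dyck_rho x vac) xE dyck_rhoM dyck_rho_e.
have [x <-] := corner_phi_surj F.
exists (corner_Ae0 x); last exact: corner_Ae0_phi.
by exists x; rewrite corner_e0 corner_e.
Qed.
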